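(* Let $\Omega$ be one among $\mathbb{B}$, $\mathbb{H}$ or $\mathbb{D}$. Let $g\in\mathcal{R}(\Omega)$ with $g^s\equiv1$ be such that - $g_v$ has a finite number of non-real isolated zeroes $\{q_1,\dots,q_N\}$; - $g_0(q_\ell)=1$ for all $\ell=1,\dots,N$; - the union $\mathbb{S}_{q_1}\cup\dots\cup\mathbb{S}_{q_N}$ is contained in a unique connected component $\mathcal{U}$ of $\Omega\setminus g_0^{-1}((-\infty,-1])$. If for some $I\in\mathbb{S}$ (and hence for any) the set $\mathcal{U}_I^+=\mathcal{U}\cap\mathbb{C}_I^+$ is convex, and $\mathcal{U}$ is slice if $\Omega$ is, then there exists a slice regular $*$-logarithm of $g$, i.e. $f\in\mathcal{R}(\Omega)$ with $\exp_*(f)=g$.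
   Context: $\mathbb{H}$ is the algebra of quaternions; $q=q_0+q_v$ with $q_0$ real and $q_v$ purely imaginary, $q^c=q_0-q_v$, $\mathbb{S}=\{I\in\mathbb{H}: I^2=-1\}$, $\mathbb{C}_I=\mathbb{R}+\mathbb{R}I$, $\mathbb{C}_I^+=\{\alpha+I\beta:\beta\ge0\}$, $\mathbb{S}_q=\{q_0+\|q_v\|J: J\in\mathbb{S}\}$, $\Omega_I=\Omega\cap\mathbb{C}_I$. A domain (nonempty connected open set) $\Omega\subset\mathbb{H}$ is circular if $\mathbb{S}_q\subset\Omega$ for all $q\in\Omega$; it is slice if $\Omega\cap\mathbb{R}\neq\emptyset$ and product if $\Omega\cap\mathbb{R}=\emptyset$. $\mathbb{B}\subset\mathbb{H}$ is the open unit ball centered at the origin and $\mathbb{D}=\{\alpha+I\beta\in\mathbb{H}:\alpha^2+(\beta-2)^2<1,\ I\in\mathbb{S}\}$; $\mathbb{B}$ and $\mathbb{H}$ are slice, $\mathbb{D}$ is product. A function $f:\Omega\to\mathbb{H}$ is slice regular if $f(\alpha+I\beta)=F_0(\alpha+\sqrt{-1}\beta)+I F_1(\alpha+\sqrt{-1}\beta)$ for all $I\in\mathbb{S}$ and $\alpha,\beta\in\mathbb{R}$ with $\alpha+I\beta\in\Omega$, where $F_0,F_1:\{\alpha+\sqrt{-1}\beta:\alpha+I\beta\in\Omega\}\to\mathbb{H}$ are $C^1$, $F_0(\bar z)=F_0(z)$, $F_1(\bar z)=-F_1(z)$ and $\partial_\alpha F_0=\partial_\beta F_1$, $\partial_\beta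 F_0=-\partial_\alpha F_1$. $\mathcal{R}(\Omega)$ is the set of slice regular functions; $f\in\mathcal{R}(\Omega)$ is slice preserving if $f(\Omega_I)\subset\mathbb{C}_I$ for all $I\in\mathbb{S}$, and $\mathcal{R}_{\mathbb{R}}(\Omega)$ is the set of slice preserving functions. The $*$-product is $(f*g)(q)=0$ if $f(q)=0$, and $(f*g)(q)=f(q)\,g(f(q)^{-1}qf(q))$ otherwise; with pointwise sum it makes $\mathcal{R}(\Omega)$ an associative algebra. The slice conjugate $f^c$ is the function induced by $(F_0^c,F_1^c)$ (pointwise conjugates), and $f^s=f*f^c$. Every $f\in\mathcal{R}(\Omega)$ is uniquely $f=f_0+f_1i+f_2j+f_3k$ with $f_\ell\in\mathcal{R}_{\mathbb{R}}(\Omega)$; $f_0$ is its real part and $f_v=f-f_0$ its vector part. $\exp_*(f)=\sum_{n\ge0}f^{*n}/n!$, with $f^{*n}$ the $n$-th $*$-power. Since $g_0$ is slice preserving, each connected component of $\Omega\setminus g_0^{-1}((-\infty,-1])$ is a circular domain. Non-real isolated zeroes: let $f\in\mathcal{R}(\Omega)$ with $f^s\not\equiv0$ and $q_0\in\Omega\setminus\mathbb{R}$. Write $f=\Delta^m\tilde f$ with $m\ge0$ the largest integer for which this is possible with $\tilde f\in\mathcal{R}(\Omega)$, where $\Delta(q)=q^2-2q\,\mathrm{Re}(q_0)+|q_0|^2$ (so $\tilde f\not\equiv0$ on $\mathbb{S}_{q_0}$). The point $q_0$ is a non-real isolated zero of $f$ if $\tilde f(q_0)=0$. If $f^s\equiv0$,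 $f$ has no non-real isolated zeroes. *)

(* Defs.v *)
From HB Require Import structures.
From mathcomp Require Import all_boot all_order all_algebra.
From mathcomp Require Import all_classical all_reals all_analysis.
From mathcomp Require Import ring lra.

Set Implicit Arguments.
Unset Strict Implicit.
Unset Printing Implicit Defensive.

Import Order.TTheory GRing.Theory Num.Theory.
Import numFieldNormedType.Exports.

Local Open Scope classical_set_scope.
Local Open Scope ring_scope.

(* The norm `|q| inherited from 'rV_4 is the sup norm; it is only used for
   the topology (and the vector-valued derivatives).  The Euclidean norm of a
   quaternion is [qnorm]. *)
Definition quat (R : realType) : Type := 'rV[R]_4.

HB.instance Definition _ (R : realType) :=
  NormedModule.copy (quat R) 'rV[R]_4.
HB.instance Definition _ (R : realType) := Complete.copy (quat R) 'rV[R]_4.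

Section QuaternionAlgebra.
Variable R : realType.
Implicit Types (p q r : quat R) (a b c d : R).

Definition Quat a b c d : quat R := \row_(j < 4) nth 0 [:: a; b; c; d] j.

Definition q0 q : R := q ord0 (inord 0).
Definition q1 q : R := q ord0 (inord 1).
Definition q2 q : R := q ord0 (inord 2).
Definition q3 q : R := q ord0 (inord 3).

Lemma quatP p q :
  [/\ q0 p = q0 q, q1 p = q1 q, q2 p = q2 q & q3 p = q3 q] -> p = q.
Proof.
case=> h0 h1 h2 h3; apply/rowP => j.
have -> : j = inord j by rewrite inord_val.
by case: j => -[|[|[|[|//]]]] /= _.
Qed.

Lemma q0_Quat a b c d : q0 (Quat a b c d) = a.
Proof. by rewrite /q0 mxE inordK. Qed.
Lemma q1_Quat a b c d : q1 (Quat a b c d) = b.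
Proof. by rewrite /q1 mxE inordK. Qed.
Lemma q2_Quat a b c d : q2 (Quat a b c d) = c.
Proof. by rewrite /q2 mxE inordK. Qed.
Lemma q3_Quat a b c d : q3 (Quat a b c d) = d.
Proof. by rewrite /q3 mxE inordK. Qed.
Definition Quat_coord := (q0_Quat, q1_Quat, q2_Quat, q3_Quat).

Lemma quat_coordD p q :
  (q0 (p + q) = q0 p + q0 q) * (q1 (p + q) = q1 p + q1 q) *
  (q2 (p + q) = q2 p + q2 q) * (q3 (p + q) = q3 p + q3 q).
Proof. by rewrite /q0 /q1 /q2 /q3 !mxE. Qed.

Lemma quat_coordZ a q :
  (q0 (a *: q) = a * q0 q) * (q1 (a *: q) = a * q1 q) *
  (q2 (a *: q) = a * q2 q) * (q3 (a *: q) = a * q3 q).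
Proof. by rewrite /q0 /q1 /q2 /q3 !mxE. Qed.

Lemma quat_coord0 :
  (q0 0 = 0) * (q1 0 = 0) * (q2 0 = 0) * (q3 0 = 0).
Proof. by rewrite /q0 /q1 /q2 /q3 !mxE. Qed.

Definition qone : quat R := Quat 1 0 0 0.

Definition qmul p q : quat R := Quat
  (q0 p * q0 q - q1 p * q1 q - q2 p * q2 q - q3 p * q3 q)
  (q0 p * q1 q + q1 p * q0 q + q2 p * q3 q - q3 p * q2 q)
  (q0 p * q2 q - q1 p * q3 q + q2 p * q0 q + q3 p * q1 q)
  (q0 p * q3 q + q1 p * q2 q - q2 p * q1 q + q3 p * q0 q).

Let quatE := (Quat_coord, quat_coordD, quat_coordZ, quat_coord0).

Fact qmulA : associative qmul.
Proof. by move=> p q r; apply: quatP; rewrite !quatE; split; ring. Qed.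
Fact qmul1r : left_id qone qmul.
Proof. by move=> p; apply: quatP; rewrite !quatE; split; ring. Qed.
Fact qmulr1 : right_id qone qmul.
Proof. by move=> p; apply: quatP; rewrite !quatE; split; ring. Qed.
Fact qmulDl : left_distributive qmul +%R.
Proof. by move=> p q r; apply: quatP; rewrite !quatE; split; ring. Qed.
Fact qmulDr : right_distributive qmul +%R.
Proof. by move=> p q r; apply: quatP; rewrite !quatE; split; ring. Qed.
Fact qone_neq0 : qone != 0.
Proof.
apply/eqP => /(congr1 q0); rewrite !quatE => /eqP.
by rewrite oner_eq0.
Qed.

HB.instance Definition _ := GRing.Zmodule_isNzRing.Build (quat R)
  qmulA qmul1r qmulr1 qmulDl qmulDr qone_neq0.

Fact qscaleAl a p q : a *: (p * q) = (a *: p) * q.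
Proof. by apply: quatP; rewrite !quatE; split; ring. Qed.

HB.instance Definition _ := GRing.Lmodule_isLalgebra.Build R (quat R) qscaleAl.

Fact qscaleAr a p q : a *: (p * q) = p * (a *: q).
Proof. by apply: quatP; rewrite !quatE; split; ring. Qed.

HB.instance Definition _ := GRing.Lalgebra_isAlgebra.Build R (quat R) qscaleAr.

Definition qconj q : quat R := Quat (q0 q) (- q1 q) (- q2 q) (- q3 q).

Definition qnorm q : R :=
  Num.sqrt (q0 q ^+ 2 + q1 q ^+ 2 + q2 q ^+ 2 + q3 q ^+ 2).

Definition qinv q : quat R := (qnorm q ^+ 2)^-1 *: qconj q.

Let qnorm2E q : qnorm q ^+ 2 = q0 q ^+ 2 + q1 q ^+ 2 + q2 q ^+ 2 + q3 q ^+ 2.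
Proof. by rewrite sqr_sqrtr // !addr_ge0 ?sqr_ge0. Qed.

Let qnorm2_neq0 q : q != 0 -> qnorm q ^+ 2 != 0.
Proof.
apply: contra_neq; rewrite qnorm2E => /eqP.
rewrite !paddr_eq0 ?addr_ge0 ?sqr_ge0 // !sqrf_eq0.
by case/andP=> /andP[/andP[/eqP h0 /eqP h1] /eqP h2] /eqP h3;
  apply: quatP; rewrite !quatE.
Qed.

Fact qmulVr : {in [pred q : quat R | q != 0], left_inverse 1 qinv *%R}.
Proof.
move=> q /qnorm2_neq0 n0; rewrite /qinv -scalerAl.
have -> : qconj q * q = qnorm q ^+ 2 *: 1.
  by rewrite qnorm2E; apply: quatP; rewrite !quatE; split; ring.
by rewrite scalerA mulVf // scale1r.
Qed.

Fact qmulrV : {in [pred q : quat R | q != 0], right_inverse 1 qinv *%R}.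
Proof.
move=> q /qnorm2_neq0 n0; rewrite /qinv -scalerAr.
have -> : q * qconj q = qnorm q ^+ 2 *: 1.
  by rewrite qnorm2E; apply: quatP; rewrite !quatE; split; ring.
by rewrite scalerA mulVf // scale1r.
Qed.

Fact qunitP p q : q * p = 1 /\ p * q = 1 -> [pred q : quat R | q != 0] p.
Proof.
case=> _ /eqP; apply: contraL => /eqP ->.
by rewrite mul0r eq_sym oner_eq0.
Qed.

Fact qinv0id : {in [predC [pred q : quat R | q != 0]], qinv =1 id}.
Proof.
move=> q; rewrite !inE negbK => /eqP ->.
by apply: quatP; rewrite !quatE !(oppr0, mulr0).
Qed.

HB.instance Definition _ := GRing.NzRing_hasMulInverse.Build (quat R)
  qmulVr qmulrV qunitP qinv0id.

Definition qi : quat R := Quat 0 1 0 0.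
Definition qj : quat R := Quat 0 0 1 0.
Definition qk : quat R := Quat 0 0 0 1.

Definition qvec q : quat R := q - (q0 q)%:A.

End QuaternionAlgebra.

Section SliceRegular.
Variable R : realType.
Local Notation H := (quat R).
Implicit Types (Omega : set H) (f g h : H -> H) (F : R * R -> H).

Definition isphere : set H := [set I | I * I = -1].

Definition qreals : set H := range (fun a : R => a%:A).

Definition slice_plane (I : H) : set H :=
  [set q | exists a b : R, q = a%:A + b *: I].

Definition slice_half_plane (I : H) : set H :=
  [set q | exists a b : R, 0 <= b /\ q = a%:A + b *: I].

Definition sphere_at (q : H) : set H :=
  [set p | exists2 J, isphere J & p = (q0 q)%:A + qnorm (qvec q) *: J].

Definition is_slice Omega : Prop := Omega `&` qreals !=set0.

(* {alpha + sqrt(-1) beta : alpha + I beta \in Omega}, with the complex plane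
   represented by pairs (alpha, beta) *)
Definition stem_domain Omega : set (R * R) :=
  [set z | exists2 I, isphere I & Omega (z.1%:A + z.2 *: I)].

Definition d_alpha F : R * R -> H := 'D_((1, 0) : R * R) F.
Definition d_beta F : R * R -> H := 'D_((0, 1) : R * R) F.

(* Meant for open D, where the values of the partial derivatives outside D do
   not influence their continuity at points of D. *)
Definition C1_on (D : set (R * R)) F : Prop := forall z, D z ->
  [/\ derivable F z ((1, 0) : R * R), derivable F z ((0, 1) : R * R),
      {for z, continuous (d_alpha F)} & {for z, continuous (d_beta F)}].

Record holomorphic_stem (D : set (R * R)) F0 F1 : Prop := HolomorphicStem {
  stem_C1_0 : C1_on D F0;
  stem_C1_1 : C1_on D F1;
  stem_even : forall a b, D (a, b) -> F0 (a, - b) = F0 (a, b);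
  stem_odd : forall a b, D (a, b) -> F1 (a, - b) = - F1 (a, b);
  stem_CR_alpha : forall z, D z -> d_alpha F0 z = d_beta F1 z;
  stem_CR_beta : forall z, D z -> d_beta F0 z = - d_alpha F1 z }.

Definition induced_by Omega f F0 F1 : Prop :=
  forall (I : H) (a b : R), isphere I -> Omega (a%:A + b *: I) ->
    f (a%:A + b *: I) = F0 (a, b) + I * F1 (a, b).

Definition is_stem Omega f (E : (R * R -> H) * (R * R -> H)) : Prop :=
  holomorphic_stem (stem_domain Omega) E.1 E.2 /\ induced_by Omega f E.1 E.2.

(* Functions on Omega are total functions of which only the values on Omega
   are meaningful. *)
Definition slice_regular Omega f : Prop := exists E, is_stem Omega f E.

Definition slice_preserving Omega f : Prop :=
  slice_regular Omega f /\
  forall I, isphere I -> f @` (Omega `&` slice_plane I) `<=` slice_plane I.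

Definition star f g : H -> H :=
  fun q => if f q == 0 then 0 else f q * g ((f q)^-1 * q * f q).

Definition star_pow f n : H -> H := iter n (star f) (fun=> 1).

Definition is_star_exp Omega f h : Prop := forall q, Omega q ->
  (fun n => \sum_(0 <= k < n) (k`!%:R : R)^-1 *: star_pow f k q) @ \oo --> h q.

(* The function induced by (F0, F1), evaluated at alpha + I beta with
   beta = |q_v| >= 0; when q is real, (qvec q) is 0 and so is the second
   term, in agreement with the oddness of F1. *)
Definition induced F0 F1 : H -> H := fun q =>
  let b := qnorm (qvec q) in
  F0 (q0 q, b) + (b^-1 *: qvec q) * F1 (q0 q, b).

(* The stem functions of a slice regular f on Omega, which are unique on
   [stem_domain Omega]. *)
Definition stem Omega f : (R * R -> H) * (R * R -> H) :=
  xget (cst 0, cst 0) [set E | is_stem Omega f E].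

Definition slice_conj Omega f : H -> H :=
  induced (@qconj R \o (stem Omega f).1) (@qconj R \o (stem Omega f).2).

Definition symm Omega f : H -> H := star f (slice_conj Omega f).

Definition is_real_part Omega f f0 : Prop := exists f1 f2 f3 : H -> H,
  [/\ slice_preserving Omega f0, slice_preserving Omega f1,
      slice_preserving Omega f2, slice_preserving Omega f3 &
      forall q, Omega q ->
        f q = f0 q + f1 q * qi R + f2 q * qj R + f3 q * qk R].

(* Unique on Omega for slice regular f. *)
Definition real_part Omega f : H -> H :=
  xget (cst 0) [set f0 | is_real_part Omega f f0].

Definition vector_part Omega f : H -> H :=
  fun q => f q - real_part Omega f q.

Definition Delta (p q : H) : H :=
  q ^+ 2 - (2 * q0 p) *: q + (qnorm p ^+ 2)%:A.

(* Delta p is slice preserving, so its *-product with ft is pointwise. *)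
Definition Delta_factor Omega f p m ft : Prop :=
  slice_regular Omega ft /\
  forall q, Omega q -> f q = Delta p q ^+ m * ft q.

Definition nonreal_isolated_zero Omega f (p : H) : Prop :=
  [/\ Omega p, ~ qreals p,
      ~ (forall q, Omega q -> symm Omega f q = 0) &
      exists m ft,
        [/\ Delta_factor Omega f p m ft,
            forall n fn, Delta_factor Omega f p n fn -> (n <= m)%N &
            ft p = 0]].

Definition is_component (A U : set H) : Prop :=
  exists2 x, A x & U = connected_component A x.

Definition qball : set H := [set q | qnorm q < 1].

Definition qD : set H :=
  [set q | exists (I : H) (a b : R),
     [/\ isphere I, a ^+ 2 + (b - 2) ^+ 2 < 1 & q = a%:A + b *: I]].

(* h^{-1}((-oo, c]) inside Omega, the half-line being one of real
   quaternions *)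
Definition preimage_real_le Omega h (c : R) : set H :=
  [set q | Omega q /\ exists2 a : R, a <= c & h q = a%:A].

End SliceRegular.

(* Main.v *)
(* A slice regular function is determined by four holomorphic functions of a complex variable z,
   symmetric under conjugation: its real part g0 and the components G of its vector part, seen as a
   vector of the complexified quaternions.  The condition g^s = 1 reads g0^2 + G.G = 1, and a vector
   F with G = sin(mu) W, F = mu W, W.W = 1, cos(mu) = g0 satisfies exp(F) = g0 + G; if G.G = 0 and
   g0 = 1, the vector F = G does.

   Where z does not belong to the sphere of a non-real isolated zero, mu and W exist locally, and two
   local solutions differ by a multiple 2 pi n W: as the bilinear square (2 pi n)^2 of the difference
   is locally constant, solutions continue uniquely along segments.  On the part of the domain
   corresponding to U, where g0 avoids (-oo, -1], the principal determination of arccos(g0) gives a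
   solution that is holomorphic even at the exceptional points, because it is an even function of mu
   times G.  Those points lie in U, which is star-shaped about a point c (by convexity; in the slice
   case c is real and the union of U+ and its mirror image is used), so that the principal solution
   extends along the rays from c to the whole (convex) domain.  Uniqueness gives the conjugation
   symmetry of the extension in the slice case; in the product case one reflects it. *)
Require Import Defs.
From mathcomp Require Import all_boot all_order all_algebra.
From mathcomp Require Import all_classical all_reals all_analysis.
From mathcomp Require Import complex ring lra.
Set Implicit Arguments.
Unset Strict Implicit.
Unset Printing Implicit Defensive.
Import Order.TTheory GRing.Theory Num.Theory.
Import numFieldNormedType.Exports.
Local Open Scope classical_set_scope.
Local Open Scope ring_scope.

(** * Complex numbers over a real type *)

(** Near a point a write G = (z - a)^n w with w(a) nonzero. If w(a).w(a) is not 0, then w.w has a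
    square root near a, and W = w / sqrt(w.w) is defined at a even when G vanishes there. At a real
    point w(a) is a real vector, hence not isotropic; at a non-real point an isotropic w(a) means
    that the sphere of a carries an isolated zero. These last points are the obstacle: no W exists
    around them in general. Suppose g0(a) = 1 and take mu small near a. If G.G has odd order at a,
    turning around a changes (mu, W) into (-mu, -W). This fixes mu W but exchanges (mu + 2 pi n) W
    and (mu - 2 pi n) W, so that the principal solution is the only single-valued one there. One
    global solution must therefore be the principal one near all exceptional points at once, which
    is what a single component U containing them provides. Between exceptional points the values of
    solutions at a given point form a discrete set. All gluing is done on open sets whose
    intersections are convex or joined to U by segments, so that agreement at one point is
    enough. *)

Definition Cx (R : realType) : numFieldType := R[i].

Section ComplexBasics.
Variable R : realType.
Local Notation C := (Cx R).
Implicit Types (z w : C) (a b : R).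

Definition mkC a b : C := Complex a b.
Definition re z : R := complex.Re z.
Definition im z : R := complex.Im z.
Definition cj z : C := mkC (re z) (- im z).
(** The norm of [Cx R] as a numeric field takes its values in [Cx R]; estimates are made with this
    real modulus, which [normCE] relates to it. *)
Definition cabs z : R := Num.sqrt (re z ^+ 2 + im z ^+ 2).

Lemma cxP z w : re z = re w -> im z = im w -> z = w.
Proof. by case: z w => a b [c d] /= -> ->. Qed.

Lemma re_mk a b : re (mkC a b) = a. Proof. by []. Qed.
Lemma im_mk a b : im (mkC a b) = b. Proof. by []. Qed.
Lemma mk_reim z : mkC (re z) (im z) = z. Proof. by case: z. Qed.

Lemma reD z w : re (z + w) = re z + re w. Proof. by case: z w => a b []. Qed.
Lemma imD z w : im (z + w) = im z + im w. Proof. by case: z w => a b []. Qed.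
Lemma reN z : re (- z) = - re z. Proof. by case: z. Qed.
Lemma imN z : im (- z) = - im z. Proof. by case: z. Qed.
Lemma reM z w : re (z * w) = re z * re w - im z * im w.
Proof. by case: z w => a b []. Qed.
Lemma imM z w : im (z * w) = re z * im w + im z * re w.
Proof. by case: z w => a b []. Qed.
Lemma re0 : re 0 = 0. Proof. by []. Qed.
Lemma im0 : im 0 = 0. Proof. by []. Qed.
Lemma re1 : re 1 = 1. Proof. by []. Qed.
Lemma im1 : im 1 = 0. Proof. by []. Qed.
Definition reimE := (re_mk, im_mk, reD, imD, reN, imN, reM, imM, re0, im0, re1, im1).

Lemma cj_def z : (re (cj z) = re z) * (im (cj z) = - im z).
Proof. by []. Qed.
Lemma cjD z w : cj (z + w) = cj z + cj w.
Proof. by apply: cxP; rewrite !(cj_def, reimE) // opprD. Qed.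
Lemma cjN z : cj (- z) = - cj z.
Proof. by apply: cxP; rewrite !(cj_def, reimE). Qed.
Lemma cjB z w : cj (z - w) = cj z - cj w.
Proof. by rewrite cjD cjN. Qed.
Lemma cjM z w : cj (z * w) = cj z * cj w.
Proof. by apply: cxP; rewrite !(cj_def, reimE) //; ring. Qed.
Lemma cjK z : cj (cj z) = z.
Proof. by apply: cxP; rewrite !cj_def // opprK. Qed.
Lemma cj1 : cj 1 = 1. Proof. by apply: cxP; rewrite cj_def // oppr0. Qed.
Lemma cj0 : cj 0 = 0. Proof. by apply: cxP; rewrite cj_def // oppr0. Qed.
Lemma cjX z n : cj (z ^+ n) = cj z ^+ n.
Proof. by elim: n => [|n IH]; rewrite ?expr0 ?cj1 // !exprS cjM IH. Qed.
Lemma cj_eq0 z : (cj z == 0) = (z == 0).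
Proof.
by apply/eqP/eqP => [h|->]; [rewrite -(cjK z) h cj0 | rewrite cj0].
Qed.
Lemma cjV z : cj z^-1 = (cj z)^-1.
Proof.
have [->|z0] := eqVneq z 0; first by rewrite invr0 cj0 invr0.
have cz0 : cj z != 0 by rewrite cj_eq0.
by apply: (mulfI cz0); rewrite mulfV // -cjM mulfV // cj1.
Qed.
Lemma cj_real a : cj (mkC a 0) = mkC a 0.
Proof. by apply: cxP; rewrite cj_def // oppr0. Qed.

Lemma normCE z : `|z| = mkC (cabs z) 0.
Proof. exact: normc_def. Qed.

Lemma ltCE z w : (z < w) = (im w == im z) && (re z < re w).
Proof. by rewrite ltcE. Qed.
Lemma leCE z w : (z <= w) = (im w == im z) && (re z <= re w).
Proof. by rewrite lecE. Qed.

Lemma norm_ltC z (e : C) : 0 < e -> (`|z| < e) = (cabs z < re e).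
Proof.
by rewrite ltCE => /andP[/eqP ie _]; rewrite normCE ltCE ie /= eqxx.
Qed.
Lemma pos_re (e : C) : 0 < e -> 0 < re e.
Proof. by rewrite ltCE => /andP[]. Qed.
Lemma pos_mk a : (0 < mkC a 0) = (0 < a).
Proof. by rewrite ltCE /= eqxx. Qed.

Lemma cabs_ge0 z : 0 <= cabs z. Proof. exact: sqrtr_ge0. Qed.
Lemma cabs2 z : cabs z ^+ 2 = re z ^+ 2 + im z ^+ 2.
Proof. by rewrite sqr_sqrtr // addr_ge0 ?sqr_ge0. Qed.
Lemma cabs0 : cabs 0 = 0.
Proof. by rewrite /cabs re0 im0 expr0n /= addr0 sqrtr0. Qed.
Lemma cabs_eq0 z : (cabs z == 0) = (z == 0).
Proof.
apply/idP/eqP => [/eqP h|->]; last by rewrite cabs0.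
apply/eqP; rewrite -normr_eq0 normCE h; exact/eqP.
Qed.
Lemma cabs_gt0 z : (0 < cabs z) = (z != 0).
Proof. by rewrite lt_def cabs_ge0 andbT cabs_eq0. Qed.
Lemma cabsM z w : cabs (z * w) = cabs z * cabs w.
Proof.
have := normrM z w; rewrite !normCE => /(congr1 re).
by rewrite !reimE mul0r subr0.
Qed.
Lemma cabsN z : cabs (- z) = cabs z.
Proof. by rewrite /cabs reN imN !sqrrN. Qed.
Lemma cabs_distC z w : cabs (z - w) = cabs (w - z).
Proof. by rewrite -cabsN opprB. Qed.
Lemma cabsD z w : cabs (z + w) <= cabs z + cabs w.
Proof.
have := ler_normD z w; rewrite !normCE leCE => /andP[_].
by rewrite !reimE.
Qed.
Lemma cabsB z w : cabs (z - w) <= cabs z + cabs w.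
Proof. by rewrite (le_trans (cabsD _ _)) // cabsN. Qed.
Lemma cabs_cj z : cabs (cj z) = cabs z.
Proof. by rewrite /cabs !cj_def sqrrN. Qed.
Lemma cabs_re z : `|re z| <= cabs z.
Proof.
by rewrite -(ler_pXn2r (n := 2)) ?nnegrE ?cabs_ge0 // real_normK ?num_real //
   cabs2 lerDl sqr_ge0.
Qed.
Lemma cabs_im z : `|im z| <= cabs z.
Proof.
by rewrite -(ler_pXn2r (n := 2)) ?nnegrE ?cabs_ge0 // real_normK ?num_real //
   cabs2 lerDr sqr_ge0.
Qed.
Lemma cabs_mk a b : cabs (mkC a b) <= `|a| + `|b|.
Proof.
rewrite -(ler_pXn2r (n := 2)) ?nnegrE ?cabs_ge0 ?addr_ge0 //.
rewrite cabs2 /= sqrrD !real_normK ?num_real //.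
by rewrite lerD2r lerDl mulrn_wge0 // mulr_ge0.
Qed.
Lemma cabs_real a : cabs (mkC a 0) = `|a|.
Proof. by rewrite /cabs /= expr0n addr0 sqrtr_sqr. Qed.
Lemma cabs1 : cabs 1 = 1.
Proof. by rewrite /cabs re1 im1 expr0n addr0 expr1n sqrtr1. Qed.
Lemma cabsX z n : cabs (z ^+ n) = cabs z ^+ n.
Proof. by elim: n => [|n IH]; rewrite ?expr0 ?cabs1 // !exprS cabsM IH. Qed.
Lemma cabsV z : cabs z^-1 = (cabs z)^-1.
Proof.
have [->|z0] := eqVneq z 0; first by rewrite invr0 cabs0 invr0.
have az0 : cabs z != 0 by rewrite cabs_eq0.
by apply: (mulfI az0); rewrite mulfV // -cabsM mulfV // cabs1.
Qed.

Lemma nbhsCP (z : C) (A : set C) :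
  nbhs z A <-> exists2 r : R, 0 < r & forall w, cabs (w - z) < r -> A w.
Proof.
split.
  move=> /nbhs_ballP[e /= e0 eA]; exists (re e); first exact: pos_re.
  move=> w wz; apply: eA; rewrite -ball_normE /= norm_ltC //.
  by rewrite cabs_distC.
case=> r r0 rA; apply/nbhs_ballP; exists (mkC r 0); first by rewrite /= pos_mk.
move=> w; rewrite -ball_normE /= norm_ltC ?pos_mk //= cabs_distC => h.
exact: rA.
Qed.

Lemma cvgCP (T : Type) (F : set_system T) {FF : Filter F} (f : T -> C) l :
  f @ F --> l <-> (forall e : R, 0 < e -> \forall t \near F, cabs (f t - l) < e).
Proof.
split=> [/cvgrPdist_lt h e e0|h].
  have := h (mkC e 0); rewrite pos_mk => /(_ e0); apply: filterS => t.
  by rewrite norm_ltC ?pos_mk // cabs_distC.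
apply/cvgrPdist_lt => e e0; have := h _ (pos_re e0); apply: filterS => t.
by rewrite norm_ltC // cabs_distC.
Qed.

Lemma cvg_reim (T : Type) (F : set_system T) {FF : Filter F} (f : T -> C) l :
  f @ F --> l <->
  ((fun t => re (f t)) @ F --> re l /\ (fun t => im (f t)) @ F --> im l).
Proof.
split=> [/cvgCP h|[/cvgrPdist_lt h1 /cvgrPdist_lt h2]].
  split; apply/cvgrPdist_lt => e e0; have := h _ e0; apply: filterS => t ft.
    by rewrite distrC -reN -reD (le_lt_trans (cabs_re _)).
  by rewrite distrC -imN -imD (le_lt_trans (cabs_im _)).
apply/cvgCP => e e0.
have e20 : 0 < e / 2 by rewrite divr_gt0.
apply: filterS2 (h1 _ e20) (h2 _ e20) => t /= ht1 ht2.
rewrite -(mk_reim (f t - l)) (le_lt_trans (cabs_mk _ _)) // !reimE.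
by rewrite (splitr e) ltrD // distrC.
Qed.

Lemma continuous_re : continuous re.
Proof. by move=> z; have /(cvg_reim (fun t : C => t))[] : id @ nbhs z --> z by exact: cvg_id. Qed.
Lemma continuous_im : continuous im.
Proof. by move=> z; have /(cvg_reim (fun t : C => t))[] : id @ nbhs z --> z by exact: cvg_id. Qed.
Lemma cvg_mk (T : Type) (F : set_system T) {FF : Filter F} (f g : T -> R) a b :
  f @ F --> a -> g @ F --> b -> (fun t => mkC (f t) (g t)) @ F --> mkC a b.
Proof. by move=> fa gb; apply/cvg_reim. Qed.
Lemma continuous_cj : continuous cj.
Proof.
move=> z; have h1 := @continuous_re z; have h2 := @continuous_im z.
by apply/(@cvg_reim _ (nbhs z)); split; [exact: h1 | exact: cvgN].
Qed.
Lemma continuous_cabs : continuous cabs.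
Proof.
move=> z; apply/(@cvgrPdist_lt _ _ _ (nbhs z)) => e e0; apply/nbhsCP; exists e => // w wz.
rewrite ltr_distl; apply/andP; split.
  by rewrite ltrBlDr -[w in ltLHS](subrK z) (le_lt_trans (cabsD _ _)) // addrC ltrD2l.
rewrite -ltrBlDr -[z in ltLHS](subrK w) ltrBlDr (le_lt_trans (cabsD _ _)) //.
by rewrite addrC ltrD2l cabs_distC.
Qed.

End ComplexBasics.

Global Opaque Cx.

(** * Complex derivatives *)

Section ComplexDerivative.
Variable R : realType.
Local Notation C := (Cx R).
Implicit Types (z w : C) (a b t : R) (f g : C -> C).

(** First-order expansion without division by the increment, so that estimates need not set the case
    [y = x] apart. *)
Lemma is_deriveRP (f : R -> R) (x c : R) :
  is_derive x 1 f c <-> forall e : R, 0 < e -> exists2 d : R, 0 < d &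
    forall y, `|y - x| < d -> `|f y - f x - c * (y - x)| <= e * `|y - x|.
Proof.
split.
  move=> [df dfE] e e0.
  have : (fun h : R => h^-1 *: (f (h *: 1 + x) - f x)) @ 0^' --> c.
    have := df; rewrite /derivable => /cvg_ex[l hl].
    have : 'D_1 f x = l by apply: cvg_lim.
    by rewrite dfE => ->.
  move=> /cvgrPdist_lt /(_ _ e0) /nbhs_ballP[d /= d0 hd].
  exists d => // y yx; have [->|yNx] := eqVneq y x.
    by rewrite !subrr mulr0 subr0 normr0 mulr0.
  have yx0 : y - x != 0 by rewrite subr_eq0.
  have := hd (y - x); rewrite /ball /= sub0r normrN => /(_ yx yx0).
  rewrite [_%:A]mulr1 subrK distrC => /ltW h.
  rewrite -ler_pdivrMr ?normr_gt0 // -normfV -normrM.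
  by apply: le_trans h; rewrite le_eqVlt; apply/orP; left; apply/eqP; congr (`|_|);
    rewrite [_ *: _]mulrC mulrBl mulfK.
move=> h.
have cv : (fun h : R => h^-1 *: (f (h *: 1 + x) - f x)) @ 0^' --> c.
  apply/cvgrPdist_le => e e0; have [d d0 hd] := h _ e0.
  apply/nbhs_ballP; exists d => // k; rewrite /ball /= sub0r normrN => kd k0.
  have := hd (k + x); rewrite addrK => /(_ kd) {}hd.
  rewrite distrC [_%:A]mulr1.
  have -> : k^-1 *: (f (k + x) - f x) - c = k^-1 * (f (k + x) - f x - c * k).
    by rewrite mulrBr [c * k]mulrC mulKf.
  by rewrite normrM normfV mulrC ler_pdivrMr ?normr_gt0.
by apply: DeriveDef; [apply/cvg_ex; exists c | apply: cvg_lim].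
Qed.

Lemma is_deriveCP f z (c : C) :
  is_derive z 1 f c <-> forall e : R, 0 < e -> exists2 d : R, 0 < d &
    forall w, cabs (w - z) < d ->
      cabs (f w - f z - c * (w - z)) <= e * cabs (w - z).
Proof.
split.
  move=> [df dfE] e e0.
  have : (fun h : C => h^-1 *: (f (h *: 1 + z) - f z)) @ 0^' --> c.
    have := df; rewrite /derivable => /cvg_ex[l hl].
    have : 'D_1 f z = l by apply: cvg_lim.
    by rewrite dfE => ->.
  move=> /cvgCP /(_ _ e0) /nbhsCP[d d0 hd].
  exists d => // w wz; have [->|wNz] := eqVneq w z.
    by rewrite !subrr mulr0 subr0 cabs0 mulr0.
  have wz0 : w - z != 0 by rewrite subr_eq0.
  have := hd (w - z); rewrite subr0 => /(_ wz wz0).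
  rewrite /= [_%:A]mulr1 subrK => /ltW h.
  rewrite -ler_pdivrMr ?cabs_gt0 // -cabsV -cabsM.
  by apply: le_trans h; rewrite le_eqVlt; apply/orP; left; apply/eqP; congr (cabs _);
    rewrite [_ *: _]mulrC mulrBl mulfK.
move=> h.
have cv : (fun h : C => h^-1 *: (f (h *: 1 + z) - f z)) @ 0^' --> c.
  apply/cvgCP => e e0; have e20 : 0 < e / 2 by rewrite divr_gt0.
  have [d d0 hd] := h _ e20.
  apply/nbhsCP; exists d => // k; rewrite subr0 => kd k0.
  have := hd (k + z); rewrite addrK => /(_ kd) {}hd.
  rewrite /= [_%:A]mulr1.
  have -> : k^-1 *: (f (k + z) - f z) - c = k^-1 * (f (k + z) - f z - c * k).
    by rewrite mulrBr [c * k]mulrC mulKf.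
  rewrite cabsM cabsV mulrC ltr_pdivrMr ?cabs_gt0 //.
  by rewrite (le_lt_trans hd) // ltr_pM2r ?cabs_gt0 // ltr_pdivrMr // mulr_natr mulr2n ltrDl.
by apply: DeriveDef; [apply/cvg_ex; exists c | apply: cvg_lim].
Qed.

Lemma is_deriveC_continuous f z (c : C) :
  is_derive z 1 f c -> {for z, continuous f}.
Proof.
move=> [df _]; apply: differentiable_continuous.
exact/derivable1_diffP.
Qed.

Lemma is_deriveC_comp f g z (c d : C) :
  is_derive z 1 g d -> is_derive (g z) 1 f c ->
  is_derive z 1 (fun x => f (g x)) (c * d).
Proof.
move=> dg df; apply/is_deriveCP => e e0.
have cg := is_deriveC_continuous dg.
move/is_deriveCP: dg => dg; move/is_deriveCP: df => df.
(* The error of [f] is scaled by |g w - g z| <= (|d| + 1) |w - z|, that of [g] by |c|; the added 1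
   keeps both denominators positive. *)
pose e1 := e / 2 / (cabs d + 1); pose e2 := e / 2 / (cabs c + 1).
have p1 : 0 < cabs d + 1 by rewrite ltr_wpDl ?cabs_ge0.
have p2 : 0 < cabs c + 1 by rewrite ltr_wpDl ?cabs_ge0.
have e10 : 0 < e1 by rewrite !divr_gt0.
have e20 : 0 < e2 by rewrite !divr_gt0.
have [r1 r10 h1] := df _ e10.
have [r2 r20 h2] := dg _ e20.
have [r3 r30 h3] := dg _ ltr01.
move/cvgCP: cg => /(_ _ r10) /nbhsCP[r4 r40 h4].
exists (Num.min r2 (Num.min r3 r4)); first by rewrite !lt_min r20 r30 r40.
move=> w; rewrite !lt_min => /and3P[w2 w3 w4].
have {}h1 := h1 _ (h4 _ w4); have {}h2 := h2 _ w2; have {}h3 := h3 _ w3.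
have bg : cabs (g w - g z) <= (cabs d + 1) * cabs (w - z).
  rewrite -[g w - g z](subrK (d * (w - z))) (le_trans (cabsD _ _)) //.
  by rewrite addrC mulrDl cabsM lerD2l.
have -> : f (g w) - f (g z) - c * d * (w - z) =
  (f (g w) - f (g z) - c * (g w - g z)) + c * (g w - g z - d * (w - z)).
  by ring.
rewrite (le_trans (cabsD _ _)) // [e in leRHS]splitr mulrDl lerD //.
  rewrite (le_trans h1) // (le_trans (ler_wpM2l (ltW e10) bg)) //.
  by rewrite /e1 mulrA divfK ?gt_eqF.
rewrite cabsM (le_trans (ler_wpM2l (cabs_ge0 _) h2)) // mulrA ler_wpM2r ?cabs_ge0 //.
by rewrite /e2 mulrA ler_pdivrMr // mulrC ler_pM2l ?divr_gt0 // lerDl.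
Qed.

Lemma is_deriveC_line f z0 v (c p : C) t0 :
  p + mkC t0 0 * v = z0 -> is_derive z0 1 f c ->
  is_derive t0 1 (fun t => re (f (p + mkC t 0 * v))) (re (c * v)) /\
  is_derive t0 1 (fun t => im (f (p + mkC t 0 * v))) (im (c * v)).
Proof.
move=> pz /is_deriveCP df.
suff H : forall e : R, 0 < e -> exists2 d : R, 0 < d & forall y, `|y - t0| < d ->
    cabs (f (p + mkC y 0 * v) - f (p + mkC t0 0 * v) - c * v * mkC (y - t0) 0)
      <= e * `|y - t0|.
  split; apply/is_deriveRP => e /H[d d0 hd]; exists d => // y /hd {}hd.
    by apply: le_trans hd; apply: le_trans (cabs_re _); rewrite !reimE mulr0 subr0.
  apply: le_trans hd; apply: le_trans (cabs_im _); rewrite !reimE mulr0 add0r.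
  by rewrite le_eqVlt; apply/orP; left; apply/eqP; congr (`|_|); ring.
move=> e e0; have p1 : 0 < cabs v + 1 by rewrite ltr_wpDl ?cabs_ge0.
have e10 : 0 < e / (cabs v + 1) by rewrite divr_gt0.
have [d d0 hd] := df _ e10; exists (d / (cabs v + 1)); first by rewrite divr_gt0.
move=> y yt.
have E : p + mkC y 0 * v - z0 = v * mkC (y - t0) 0.
  by rewrite -pz; apply: cxP; rewrite !reimE; ring.
have B : cabs (v * mkC (y - t0) 0) <= (cabs v + 1) * `|y - t0|.
  by rewrite cabsM cabs_real ler_wpM2r // lerDl.
have := hd (p + mkC y 0 * v); rewrite E.
have dd : cabs (v * mkC (y - t0) 0) < d.
  by rewrite (le_lt_trans B) // mulrC -ltr_pdivlMr.
move=> /(_ dd); rewrite pz mulrA => /le_trans -> //.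
rewrite (le_trans (ler_wpM2l (ltW e10) B)) //.
by rewrite mulrA divfK ?gt_eqF.
Qed.

(* Real mean value theorem applied to both components, whence the factor 2. *)
Lemma segment_bound f (f' : C -> C) z w (M : R) :
  (forall t, 0 <= t <= 1 -> is_derive (z + mkC t 0 * (w - z)) 1 f
      (f' (z + mkC t 0 * (w - z)))) ->
  (forall t, 0 <= t <= 1 -> cabs (f' (z + mkC t 0 * (w - z))) <= M) ->
  cabs (f w - f z) <= 2 * M * cabs (w - z).
Proof.
move=> df bf.
have e1 : w = z + mkC 1 0 * (w - z).
  by apply: cxP; rewrite !reimE; ring.
have e0 : z = z + mkC 0 0 * (w - z).
  by apply: cxP; rewrite !reimE; ring.
have H t : 0 <= t <= 1 -> _ := fun ht => is_deriveC_line erefl (df t ht).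
have [] := @MVT_segment R (fun t => re (f (z + mkC t 0 * (w - z))))
   (fun t => re (f' (z + mkC t 0 * (w - z)) * (w - z))) 0 1 ler01.
- by move=> t /[!in_itv]/= /andP[/ltW a /ltW b]; have [] := H t; rewrite ?a ?b.
- apply: continuous_in_subspaceT => t /[!inE]/= /[!in_itv]/= /H[[d1 _] _].
  by apply: differentiable_continuous; apply/derivable1_diffP.
move=> s1 /[!in_itv]/= s1i E1.
have [] := @MVT_segment R (fun t => im (f (z + mkC t 0 * (w - z))))
   (fun t => im (f' (z + mkC t 0 * (w - z)) * (w - z))) 0 1 ler01.
- by move=> t /[!in_itv]/= /andP[/ltW a /ltW b]; have [] := H t; rewrite ?a ?b.
- apply: continuous_in_subspaceT => t /[!inE]/= /[!in_itv]/= /H[_ [d1 _]].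
  by apply: differentiable_continuous; apply/derivable1_diffP.
move=> s2 /[!in_itv]/= s2i E2.
rewrite -(mk_reim (f w - f z)) (le_trans (cabs_mk _ _)) //.
move: E1 E2; rewrite /= -e1 -e0 subr0 !mulr1 => E1 E2.
rewrite !reD !imD !reN !imN E1 E2.
rewrite mulrDl mul1r mulrDl; apply: lerD.
  by rewrite (le_trans (cabs_re _)) // cabsM ler_wpM2r ?cabs_ge0 // bf.
by rewrite (le_trans (cabs_im _)) // cabsM ler_wpM2r ?cabs_ge0 // bf.
Qed.

Lemma segment_const f z w :
  (forall t, 0 <= t <= 1 -> is_derive (z + mkC t 0 * (w - z)) 1 f 0) ->
  f w = f z.
Proof.
move=> df; have c0 : cabs (0 : C) <= 0 by rewrite cabs0.
have := @segment_bound f (fun=> 0) z w 0 df.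
move=> /(_ (fun _ _ => c0)); rewrite mulr0 mul0r => h.
by apply/eqP; rewrite -subr_eq0 -cabs_eq0 eq_le h cabs_ge0.
Qed.

(** The Cauchy-Riemann equations give complex differentiability here because the candidate
    derivative is continuous: partial derivatives are then compared with their values at [z] along a
    horizontal and a vertical leg. *)
Lemma is_derive_CR f (f' : C -> C) (D : set C) :
  open D ->
  (forall z, D z ->
   [/\ is_derive (re z) 1 (fun a => re (f (mkC a (im z)))) (re (f' z)),
       is_derive (re z) 1 (fun a => im (f (mkC a (im z)))) (im (f' z)),
       is_derive (im z) 1 (fun b => re (f (mkC (re z) b))) (- im (f' z)) &
       is_derive (im z) 1 (fun b => im (f (mkC (re z) b))) (re (f' z))]) ->
  (forall z, D z -> {for z, continuous f'}) ->
  forall z, D z -> is_derive z 1 f (f' z).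
Proof.
move=> oD df cf z Dz; apply/is_deriveCP => e e0.
(* Two legs, each contributing to two real components, hence the quarter. *)
have e40 : 0 < e / 4 by rewrite divr_gt0.
have /nbhsCP[r1 r10 h1] : nbhs z D by apply: open_nbhs_nbhs.
have /cvgCP /(_ _ e40) /nbhsCP[r2 r20 h2] := cf z Dz.
pose r := Num.min r1 r2.
have r0 : 0 < r by rewrite lt_min r10.
exists (r / 2) => [|w wz]; first by rewrite divr_gt0.
pose near w := `|re w - re z| <= cabs (w - z) /\ `|im w - im z| <= cabs (w - z).
have near_r x : `|re x - re z| <= cabs (w - z) -> `|im x - im z| <= cabs (w - z) ->
    D x /\ cabs (f' x - f' z) < e / 4.
  move=> xr xi; have : cabs (x - z) < r.
    rewrite -(mk_reim (x - z)) (le_lt_trans (cabs_mk _ _)) // !reimE.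
    by rewrite (le_lt_trans (lerD xr xi)) // (splitr r) ltrD.
  by rewrite lt_min => /andP[/h1 ? /h2].
have wr : `|re w - re z| <= cabs (w - z) by rewrite -reN -reD cabs_re.
have wi : `|im w - im z| <= cabs (w - z) by rewrite -imN -imD cabs_im.
(* mean value theorem along the two legs of the path z -> (re w, im z) -> w *)
have leg (F F' : R -> R) (x y B L : R) : `|y - x| <= L ->
    (forall s, `|s - x| <= L -> is_derive s 1 F (F' s)) ->
    (forall s, `|s - x| <= L -> `|F' s - B| < e / 4) ->
    `|F y - F x - B * (y - x)| <= e / 4 * L.
  move=> xy dF bF.
  suff [s sx ->] : exists2 s, `|s - x| <= L & F y - F x = F' s * (y - x).
    rewrite -mulrBl normrM ler_pM //; exact/ltW/bF.
  have ct s : `|s - x| <= L -> {for s, continuous F}.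
    by move=> /dF[d _]; apply: differentiable_continuous; apply/derivable1_diffP.
  have [xley|yltx] := leP x y.
    have I s : x <= s <= y -> `|s - x| <= L.
      move=> /andP[a b]; rewrite ger0_norm ?subr_ge0 // (le_trans _ xy) //.
      by rewrite ger0_norm ?subr_ge0 // lerD2r.
    have [||s /[!in_itv]/= /I sI E] := @MVT_segment R F F' x y xley.
    - by move=> s /[!in_itv]/= /andP[/ltW a /ltW b]; apply/dF/I; rewrite a.
    - by apply: continuous_in_subspaceT => s /[!inE]/= /[!in_itv]/= /I /ct.
    by exists s.
  have I s : y <= s <= x -> `|s - x| <= L.
    move=> /andP[a b]; rewrite distrC ger0_norm ?subr_ge0 // (le_trans _ xy) //.
    by rewrite distrC ger0_norm ?subr_ge0 ?(ltW yltx) // lerD2l lerN2.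
  have [||s /[!in_itv]/= /I sI E] := @MVT_segment R F F' y x (ltW yltx).
  - by move=> s /[!in_itv]/= /andP[/ltW a /ltW b]; apply/dF/I; rewrite a.
  - by apply: continuous_in_subspaceT => s /[!inE]/= /[!in_itv]/= /I /ct.
  by exists s => //; rewrite -[LHS]opprB E -mulrN opprB.
pose w1 := mkC (re w) (im z).
have near1 s : `|s - re z| <= cabs (w - z) -> D (mkC s (im z)) /\ cabs (f' (mkC s (im z)) - f' z) < e / 4.
  by move=> hs; apply: near_r => //=; rewrite subrr normr0 cabs_ge0.
have near2 s : `|s - im z| <= cabs (w - z) -> D (mkC (re w) s) /\ cabs (f' (mkC (re w) s) - f' z) < e / 4.
  by move=> hs; apply: near_r.
have l1 := leg (fun a => re (f (mkC a (im z)))) (fun a => re (f' (mkC a (im z)))) _ _ (re (f' z)) _ wr.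
have l2 := leg (fun a => im (f (mkC a (im z)))) (fun a => im (f' (mkC a (im z)))) _ _ (im (f' z)) _ wr.
have l3 := leg (fun b => re (f (mkC (re w) b))) (fun b => - im (f' (mkC (re w) b))) _ _ (- im (f' z)) _ wi.
have l4 := leg (fun b => im (f (mkC (re w) b))) (fun b => re (f' (mkC (re w) b))) _ _ (re (f' z)) _ wi.
have {}l1 : `|re (f w1) - re (f z) - re (f' z) * (re w - re z)| <= e / 4 * cabs (w - z).
  rewrite -[in re (f z)](mk_reim z); apply: l1 => s /near1[Ds bs].
    by have [] := df _ Ds.
  by rewrite (le_lt_trans _ bs) // -reN -reD cabs_re.
have {}l2 : `|im (f w1) - im (f z) - im (f' z) * (re w - re z)| <= e / 4 * cabs (w - z).
  rewrite -[in im (f z)](mk_reim z); apply: l2 => s /near1[Ds bs].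
    by have [] := df _ Ds.
  by rewrite (le_lt_trans _ bs) // -imN -imD cabs_im.
have {}l3 : `|re (f w) - re (f w1) - - im (f' z) * (im w - im z)| <= e / 4 * cabs (w - z).
  rewrite -[in re (f w)](mk_reim w); apply: l3 => s /near2[Ds bs].
    by have [] := df _ Ds.
  by rewrite (le_lt_trans _ bs) // -opprD normrN -imN -imD cabs_im.
have {}l4 : `|im (f w) - im (f w1) - re (f' z) * (im w - im z)| <= e / 4 * cabs (w - z).
  rewrite -[in im (f w)](mk_reim w); apply: l4 => s /near2[Ds bs].
    by have [] := df _ Ds.
  by rewrite (le_lt_trans _ bs) // -reN -reD cabs_re.
rewrite -(mk_reim (f w - _ - _)) (le_trans (cabs_mk _ _)) // !reimE.
have -> : re (f w) - re (f z) - (re (f' z) * (re w - re z) - im (f' z) * (im w - im z)) =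
  (re (f w1) - re (f z) - re (f' z) * (re w - re z)) +
  (re (f w) - re (f w1) - - im (f' z) * (im w - im z)) by ring.
have -> : im (f w) - im (f z) - (re (f' z) * (im w - im z) + im (f' z) * (re w - re z)) =
  (im (f w1) - im (f z) - im (f' z) * (re w - re z)) +
  (im (f w) - im (f w1) - re (f' z) * (im w - im z)) by ring.
rewrite (le_trans (lerD (ler_normD _ _) (ler_normD _ _))) //.
by rewrite (le_trans (lerD (lerD l1 l3) (lerD l2 l4))) // -!mulrDl; lra.
Qed.

End ComplexDerivative.

(** * Integrals over the unit interval depending on a complex parameter *)

Section ComplexIntegral.
Variable R : realType.
Local Notation C := (Cx R).
Local Notation mu := (@lebesgue_measure R).
Implicit Types (z w : C) (a b t : R).

Definition ri (f : R -> R) : R := \int[mu]_(t in `[0, 1]) f t.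
Definition cint (F : R -> C) : C :=
  mkC (ri (fun t => re (F t))) (ri (fun t => im (F t))).

(** Continuity is two-sided at 0 and 1: the integrands considered are defined and continuous beyond
    the interval. *)
Definition cont01 (T : topologicalType) (F : R -> T) :=
  forall t, 0 <= t <= 1 -> {for t, continuous F}.

Lemma cont01_integrable (f : R -> R) : cont01 f ->
  mu.-integrable `[0, 1] (EFin \o f).
Proof.
move=> cf; apply: continuous_compact_integrable; first exact: segment_compact.
by apply: continuous_in_subspaceT => t /[!inE]/= /[!in_itv]/= /cf.
Qed.

Lemma riD (f g : R -> R) : cont01 f -> cont01 g ->
  ri (fun t => f t + g t) = ri f + ri g.
Proof. by move=> cf cg; apply: RintegralD => //; apply: cont01_integrable. Qed.

Lemma riZ a (f : R -> R) : cont01 f -> ri (fun t => a * f t) = a * ri f.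
Proof. by move=> cf; apply: RintegralZl => //; apply: cont01_integrable. Qed.

Lemma eq_ri (f g : R -> R) : (forall t, 0 <= t <= 1 -> f t = g t) ->
  ri f = ri g.
Proof.
by move=> fg; apply: eq_Rintegral => t /[!inE]/= /[!in_itv]/= /fg.
Qed.

Lemma ri_cst a : ri (fun=> a) = a.
Proof.
rewrite /ri Rintegral_cst //.
suff -> : fine (mu `[0, 1]%classic) = 1 by rewrite mulr1.
by rewrite lebesgue_measure_itv /= lte_fin ltr01 /= oppr0 addr0.
Qed.

Lemma ri_bound (f : R -> R) M : cont01 f ->
  (forall t, 0 <= t <= 1 -> `|f t| <= M) -> `|ri f| <= M.
Proof.
move=> cf fM; apply: (le_trans (le_normr_Rintegral _ (cont01_integrable cf))) => //.
rewrite -[leRHS]ri_cst; apply: le_Rintegral => //.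
- apply: (@cont01_integrable (fun t => `|f t|)) => t /cf h.
  by apply: (@cvg_comp _ _ _ f Num.norm _ (nbhs (f t)) _ h); exact: norm_continuous.
- by apply: (@cont01_integrable (fun _ => M)) => t _; exact: cvg_cst.
Qed.

Lemma cont01_re (F : R -> C) : cont01 F -> cont01 (fun t => re (F t)).
Proof. by move=> cF t /cF /(@cvg_reim _ _ (nbhs t))[]. Qed.
Lemma cont01_im (F : R -> C) : cont01 F -> cont01 (fun t => im (F t)).
Proof. by move=> cF t /cF /(@cvg_reim _ _ (nbhs t))[]. Qed.

Lemma eq_cint (F G : R -> C) : (forall t, 0 <= t <= 1 -> F t = G t) ->
  cint F = cint G.
Proof. by move=> FG; congr mkC; apply: eq_ri => t /FG ->. Qed.

Lemma cintD (F G : R -> C) : cont01 F -> cont01 G ->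
  cint (fun t => F t + G t) = cint F + cint G.
Proof.
move=> cF cG; apply: cxP; rewrite !reimE.
  by rewrite -riD; [apply: eq_ri => t _; rewrite reD | exact: cont01_re..].
by rewrite -riD; [apply: eq_ri => t _; rewrite imD | exact: cont01_im..].
Qed.

Lemma cont01_cst (z : C) : cont01 (fun=> z).
Proof. by move=> t _; exact: cvg_cst. Qed.

Lemma cont01M (F G : R -> C) : cont01 F -> cont01 G ->
  cont01 (fun t => F t * G t).
Proof. by move=> cF cG t ht; exact: (cvgM (cF t ht) (cG t ht)). Qed.
Lemma cont01D (F G : R -> C) : cont01 F -> cont01 G ->
  cont01 (fun t => F t + G t).
Proof. by move=> cF cG t ht; exact: (cvgD (cF t ht) (cG t ht)). Qed.
Lemma cont01N (F : R -> C) : cont01 F -> cont01 (fun t => - F t).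
Proof. by move=> cF t ht; exact: (cvgN (cF t ht)). Qed.
Lemma cintZ z (F : R -> C) : cont01 F ->
  cint (fun t => z * F t) = z * cint F.
Proof.
move=> cF; have cr := cont01_re cF; have ci := cont01_im cF.
have crZ a : cont01 (fun t => a * re (F t)).
  by move=> t ht; apply: cvgMl_tmp; exact: cr.
have ciZ a : cont01 (fun t => a * im (F t)).
  by move=> t ht; apply: cvgMl_tmp; exact: ci.
apply: cxP; rewrite !reimE.
  transitivity (ri (fun t => re z * re (F t) + - im z * im (F t))).
    by apply: eq_ri => t _; rewrite reM mulNr.
  by rewrite riD // !riZ // mulNr.
transitivity (ri (fun t => re z * im (F t) + im z * re (F t))).
  by apply: eq_ri => t _; rewrite imM.
by rewrite riD // !riZ.
Qed.

Lemma cintB (F G : R -> C) : cont01 F -> cont01 G ->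
  cint (fun t => F t - G t) = cint F - cint G.
Proof.
move=> cF cG; rewrite (cintD cF (cont01N cG)); congr (_ + _).
rewrite -[RHS]mulN1r -(cintZ (-1) cG).
by apply: eq_cint => t _; rewrite mulN1r.
Qed.

Lemma cint_cst z : cint (fun=> z) = z.
Proof. by rewrite /cint !ri_cst mk_reim. Qed.

(** The components are bounded separately, which costs a factor 2; it is harmless since the bound
    only serves limits and vanishing statements. *)
Lemma cint_bound (F : R -> C) M : cont01 F ->
  (forall t, 0 <= t <= 1 -> cabs (F t) <= M) -> cabs (cint F) <= 2 * M.
Proof.
move=> cF FM; rewrite (le_trans (cabs_mk _ _)) // mulrDl mul1r; apply: lerD.
  apply: ri_bound; first exact: cont01_re.
  by move=> t /FM; apply: le_trans; exact: cabs_re.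
apply: ri_bound; first exact: cont01_im.
by move=> t /FM; apply: le_trans; exact: cabs_im.
Qed.

Lemma ri_FTC (P p : R -> R) : cont01 p ->
  (forall t, 0 <= t <= 1 -> is_derive t 1 P (p t)) -> ri p = P 1 - P 0.
Proof.
move=> cp dP.
have cP : cont01 P.
  move=> t /dP[d _]; apply: differentiable_continuous; exact/derivable1_diffP.
rewrite /ri /Rintegral (@continuous_FTC2 _ p P 0 1 ltr01) //.
- by apply: continuous_in_subspaceT => t /[!inE]/= /[!in_itv]/= /cp.
- split.
  + by move=> t /[!in_itv]/= /andP[/ltW a /ltW b]; have [] := dP t; rewrite ?a.
  + by apply: cvg_at_right_filter; apply: cP; rewrite lexx ler01.
  + by apply: cvg_at_left_filter; apply: cP; rewrite lexx ler01.
- move=> t /[!in_itv]/= /andP[/ltW a /ltW b].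
  by rewrite derive1E; have [|_ ->] := dP t; rewrite ?a.
Qed.

Lemma cint_FTC (P p : C -> C) : cont01 (fun t => p (mkC t 0)) ->
  (forall t, 0 <= t <= 1 -> is_derive (mkC t 0) 1 P (p (mkC t 0))) ->
  cint (fun t => p (mkC t 0)) = P 1 - P 0.
Proof.
move=> cp dP.
have H t (ht : 0 <= t <= 1) : is_derive t 1 (fun t => re (P (mkC t 0))) (re (p (mkC t 0))) /\
    is_derive t 1 (fun t => im (P (mkC t 0))) (im (p (mkC t 0))).
  have E s : 0 + mkC s 0 * 1 = mkC s 0 :> C by rewrite add0r mulr1.
  have := is_deriveC_line (E t) (dP t ht); rewrite mulr1.
  by under eq_fun do rewrite E; under [X in _ /\ is_derive _ _ X _]eq_fun do rewrite E.
apply: cxP; rewrite !reimE.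
  apply: (@ri_FTC (fun t => re (P (mkC t 0)))); first exact: (cont01_re cp).
  by move=> t /H[].
apply: (@ri_FTC (fun t => im (P (mkC t 0)))); first exact: (cont01_im cp).
by move=> t /H[].
Qed.

(** Tube lemma: compactness of the interval turns joint continuity at every (z, t) into an estimate
    uniform in t. *)
Lemma joint_uniform (Phi : C -> R -> C) z :
  (forall t, 0 <= t <= 1 -> {for (z, t), continuous (fun p : C * R => Phi p.1 p.2)}) ->
  forall e : R, 0 < e -> exists2 d : R, 0 < d & forall w, cabs (w - z) < d ->
    forall t, 0 <= t <= 1 -> cabs (Phi w t - Phi z t) < e.
Proof.
move=> cPhi e e0.
have e20 : 0 < e / 2 by rewrite divr_gt0.
have /compact_near_coveringP nc := @segment_compact R 0 1.
pose P w t := cabs (Phi w t - Phi z t) < e.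
have /nbhsCP[d d0 hd] : nbhs z [set w | [set` `[0, 1]] `<=` P w].
  refine (nc C (nbhs z) P (nbhs_filter z) _) => t /=; rewrite in_itv /= => t01.
  have /(@cvgCP _ _ (nbhs (z, t))) /(_ _ e20) := cPhi t t01.
  case=> -[A B] /= [nA nB] AB.
  have Az : A z by move: nA => /nbhsCP[r r0]; apply; rewrite subrr cabs0.
  exists (B, A) => //= -[s w] /= [Bs Aw]; rewrite /P.
  have h1 : cabs (Phi w s - Phi z t) < e / 2 by exact: (AB (w, s)).
  have h2 : cabs (Phi z s - Phi z t) < e / 2 by apply: (AB (z, s)); split => /=; [exact: Az | exact: Bs].
  have -> : Phi w s - Phi z s = (Phi w s - Phi z t) - (Phi z s - Phi z t) by ring.
  by rewrite (le_lt_trans (cabsB _ _)) // (splitr e) ltrD.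
by exists d => // w wz t t01; apply: (hd w wz t); rewrite /= in_itv.
Qed.

Lemma cont_slice (Phi : C -> R -> C) z t :
  {for (z, t), continuous (fun p : C * R => Phi p.1 p.2)} ->
  {for t, continuous (Phi z)}.
Proof.
move=> h; apply: (@cvg_comp _ _ _ (fun s => (z, s)) (fun p : C * R => Phi p.1 p.2) _ (nbhs (z, t)) _ _ h).
have c1 : (fun _ : R => z) @ nbhs t --> nbhs z by exact: cvg_cst.
have c2 : (fun s : R => s) @ nbhs t --> nbhs t by exact: cvg_id.
exact: (cvg_pair c1 c2).
Qed.

Lemma cint_continuous (Phi : C -> R -> C) (D : set C) z :
  open D -> D z ->
  (forall w, D w -> cont01 (Phi w)) ->
  (forall t, 0 <= t <= 1 -> {for (z, t), continuous (fun p : C * R => Phi p.1 p.2)}) ->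
  {for z, continuous (fun w => cint (Phi w))}.
Proof.
move=> oD Dz c1 c2; apply/(@cvgCP _ _ (nbhs z)) => e e0.
have e40 : 0 < e / 4 by rewrite divr_gt0.
have [d d0 hd] := joint_uniform c2 e40.
have /nbhsCP[r r0 hr] : nbhs z D by apply: open_nbhs_nbhs.
apply/nbhsCP; exists (Num.min d r) => [|w]; first by rewrite lt_min d0.
rewrite lt_min => /andP[/hd wd /hr wD].
rewrite -(cintB (c1 _ wD) (c1 _ Dz)).
apply: (@le_lt_trans _ _ (2 * (e / 4))); last by lra.
apply: cint_bound; first exact: (cont01D (c1 _ wD) (cont01N (c1 _ Dz))).
by move=> t /wd /ltW.
Qed.

Lemma cint_derive (Phi Phi' : C -> R -> C) (D : set C) :
  open D ->
  (forall w, D w -> cont01 (Phi w)) ->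
  (forall w t, D w -> 0 <= t <= 1 ->
     {for (w, t), continuous (fun p : C * R => Phi' p.1 p.2)}) ->
  (forall w t, D w -> 0 <= t <= 1 -> is_derive w 1 (Phi ^~ t) (Phi' w t)) ->
  forall z, D z -> is_derive z 1 (fun w => cint (Phi w)) (cint (Phi' z)).
Proof.
move=> oD c1 c2 dPhi z Dz; apply/is_deriveCP => e e0.
have e40 : 0 < e / 4 by rewrite divr_gt0.
have [d d0 hd] := joint_uniform (fun t => c2 z t Dz) e40.
have /nbhsCP[r r0 hr] : nbhs z D by apply: open_nbhs_nbhs.
exists (Num.min d r) => [|w]; first by rewrite lt_min d0.
rewrite lt_min => /andP[wd wr].
have Dw := hr _ wr.
have c1z := c1 _ Dz; have c1w := c1 _ Dw.
have c2z : cont01 (Phi' z) by move=> t ht; apply: cont_slice; exact: c2.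
have cB : cont01 (fun t => Phi w t - Phi z t) := cont01D c1w (cont01N c1z).
have cZ : cont01 (fun t => (w - z) * Phi' z t) := cont01M (@cont01_cst (w - z)) c2z.
rewrite mulrC -(cintB c1w c1z) -(cintZ (w - z) c2z) -(cintB cB cZ).
apply: (@le_trans _ _ (2 * (e / 2 * cabs (w - z)))); last by lra.
apply: cint_bound; first exact: (cont01D cB (cont01N cZ)).
move=> t t01.
(* The derivative of [g] is Phi' x t - Phi' z t, smaller than e / 4 uniformly in t, so the mean
   value bound controls the remainder. The constant absorbs the factors 2 of [segment_bound] and
   [cint_bound]. *)
pose g x := Phi x t - x * Phi' z t.
have -> : Phi w t - Phi z t - (w - z) * Phi' z t = g w - g z by rewrite /g; ring.
have on_seg s : 0 <= s <= 1 -> cabs (z + mkC s 0 * (w - z) - z) <= cabs (w - z).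
  move=> /andP[s0 s1]; rewrite addrC addKr cabsM cabs_real ger0_norm //.
  by rewrite ler_piMl ?cabs_ge0.
apply: le_trans (segment_bound (f := g) (f' := fun x => Phi' x t - Phi' z t) (M := e / 4) _ _) _.
- move=> s s01; set x := z + _.
  have Dx : D x by apply: hr; rewrite (le_lt_trans (on_seg _ s01)).
  have d1 := dPhi x t Dx t01.
  have d2 : is_derive x 1 (fun x => x * Phi' z t) (Phi' z t).
    by apply: is_derive_eq; rewrite scaler0 add0r [_ *: _]mulr1.
  exact: is_deriveB.
- move=> s s01; apply/ltW/hd => //.
  by rewrite (le_lt_trans (on_seg _ s01)).
- by rewrite le_eqVlt; apply/orP; left; apply/eqP; lra.
Qed.

End ComplexIntegral.

(** * Holomorphic functions *)

Section Holomorphic.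
Variable R : realType.
Local Notation C := (Cx R).
Implicit Types (z w : C) (a b t : R) (f g : C -> C) (D : set C).

(** The derivative exists near [z] and is continuous at [z]. Over an open set this is C1 holomorphy:
    slice regular functions supply it, and differentiation under the integral sign requires it. *)
Definition holat f z := exists2 f' : C -> C,
  (\forall w \near z, is_derive (w : C) (1 : C) f (f' w)) & {for z, continuous f'}.

Lemma holat_open f (f' : C -> C) D : open D ->
  (forall z, D z -> is_derive z 1 f (f' z)) ->
  (forall z, D z -> {for z, continuous f'}) ->
  forall z, D z -> holat f z.
Proof.
move=> oD df cf z Dz; exists f'; last exact: cf.
have : nbhs z D by apply: open_nbhs_nbhs.
by apply: filterS => w; exact: df.
Qed.

Lemma holat_derive f z : holat f z ->
  is_derive z 1 f ('D_1 f z) /\ {for z, continuous ('D_1 f : C -> C)}.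
Proof.
case=> f' df cf; split.
  by have := nbhs_singleton df => dfz; apply: derivableP; case: dfz.
have E : \forall w \near z, f' w = 'D_1 f w.
  by apply: filterS df => w [].
have Ez : f' z = 'D_1 f z := nbhs_singleton E.
have cf1 : f' @ nbhs z --> 'D_1 f z by rewrite -Ez.
by apply: cvg_trans cf1; exact: (near_eq_cvg E).
Qed.

Lemma holat_continuous f z : holat f z -> {for z, continuous f}.
Proof. by move=> /holat_derive[/is_deriveC_continuous]. Qed.

Lemma holat_eq f g z : (\forall w \near z, f w = g w) -> holat f z -> holat g z.
Proof.
move=> fg [f' df cf]; exists f' => //.
have : \forall w \near z, \forall x \near w, f x = g x.
  exact: near_join fg.
move=> fg2; near=> w.
have E : \near w, f w = g w by near: w.
by apply: (near_eq_is_derive E); near: w.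
Unshelve. all: by end_near. Qed.

Lemma holat_cst (c : C) z : holat (fun=> c) z.
Proof.
exists (fun=> 0) => [|]; last exact: (@cvg_cst _ _ _ (nbhs z)).
by near=> w; exact: is_derive_cst.
Unshelve. all: by end_near. Qed.
Lemma holat_id z : holat id z.
Proof.
exists (fun=> 1) => [|]; last exact: (@cvg_cst _ _ _ (nbhs z)).
by near=> w; exact: is_derive_id.
Unshelve. all: by end_near. Qed.

Lemma holatD f g z : holat f z -> holat g z -> holat (fun w => f w + g w) z.
Proof.
move=> [f' df cf] [g' dg cg]; exists (fun w => f' w + g' w); last exact: (cvgD cf cg).
by apply: filterS2 df dg => w h1 h2; apply: is_deriveD.
Qed.
Lemma holatM f g z : holat f z -> holat g z -> holat (fun w => f w * g w) z.
Proof.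
move=> hf hg; have hf1 := holat_continuous hf; have hg1 := holat_continuous hg.
case: hf hg => f' df cf [g' dg cg].
exists (fun w => f w * g' w + g w * f' w).
  by apply: filterS2 df dg => w h1 h2; apply: is_deriveM.
exact: (cvgD (cvgM hf1 cg) (cvgM hg1 cf)).
Qed.
Lemma holatN f z : holat f z -> holat (fun w => - f w) z.
Proof.
move=> [f' df cf]; exists (fun w => - f' w); last exact: (cvgN cf).
by apply: filterS df => w h1; apply: is_deriveN.
Qed.
Lemma holatB f g z : holat f z -> holat g z -> holat (fun w => f w - g w) z.
Proof. by move=> hf hg; apply: holatD => //; exact: holatN. Qed.
Lemma holatX f n z : holat f z -> holat (fun w => f w ^+ n) z.
Proof.
move=> hf; elim: n => [|n IH].
  by under eq_fun do rewrite expr0; exact: holat_cst.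
by under eq_fun do rewrite exprS; exact: holatM.
Qed.
Lemma is_deriveC_inv z : z != 0 -> is_derive z 1 (fun w : C => w^-1) (- z^-2).
Proof.
move=> z0; have h : is_derive z 1 (id : C -> C) 1 by exact: is_derive_id.
have [dv ev] : is_derive z 1 (fun w : C => (id w)^-1) (- (id z) ^- 2 *: 1).
  apply: DeriveDef; first exact: derivableV.
  by rewrite deriveV // derive_id.
by apply: DeriveDef => //; rewrite ev [_ *: _]mulr1.
Qed.
Lemma holat_comp f g z : holat g z -> holat f (g z) ->
  holat (fun w => f (g w)) z.
Proof.
move=> hg [f' df cf]; have cg := holat_continuous hg.
case: hg => g' dg cg'; exists (fun w => f' (g w) * g' w).
  apply: filterS2 dg (cg _ df) => w h1 h2; exact: is_deriveC_comp.
exact: (cvgM (@continuous_comp _ _ _ g f' z cg cf) cg').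
Qed.
Lemma holatV f z : f z != 0 -> holat f z -> holat (fun w => (f w)^-1) z.
Proof.
move=> f0 hf; apply: (holat_comp (f := fun w : C => w^-1) hf).
exists (fun w => - w ^- 2).
  have : nbhs (f z) [set x : C | x != 0].
    apply/nbhsCP; exists (cabs (f z)); first by rewrite cabs_gt0.
    by move=> w; apply: contraTneq => ->; rewrite sub0r cabsN ltxx.
  by apply: filterS => w; exact: is_deriveC_inv.
have c1 : (fun w : C => w * w) @ nbhs (f z) --> f z * f z.
  by have h := @cvg_id C (nbhs (f z)); exact: (cvgM h h).
have ff0 : f z * f z != 0 by rewrite mulf_neq0.
exact: (cvgN (cvgV ff0 c1)).
Qed.
Lemma holat_div f g z : g z != 0 -> holat f z -> holat g z ->
  holat (fun w => f w / g w) z.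
Proof. by move=> g0 hf hg; apply: holatM => //; exact: holatV. Qed.

Lemma is_derive_cj f z (c : C) : is_derive z 1 f c ->
  is_derive (cj z) 1 (fun w => cj (f (cj w))) (cj c).
Proof.
move=> /is_deriveCP df; apply/is_deriveCP => e /df[d d0 hd].
exists d => // w wz.
have E1 : cabs (w - cj z) = cabs (cj w - z) by rewrite -[RHS]cabs_cj cjB cjK.
have := hd (cj w); rewrite -E1 => /(_ wz); apply: le_trans.
by rewrite -[leRHS]cabs_cj !cjB cjM cjB !cjK.
Qed.

Lemma holat_cj f z : holat f (cj z) -> holat (fun w => cj (f (cj w))) z.
Proof.
case=> f' df cf; exists (fun w => cj (f' (cj w))).
  have cz : @cj R @ z --> cj z := @continuous_cj R z.
  have H : \forall w \near z, is_derive (cj w) (1 : C) f (f' (cj w)) := cz _ df.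
  apply: filterS H => w /= /is_derive_cj; rewrite cjK.
  exact.
apply: (@continuous_comp _ _ _ (@cj R) (fun w => cj (f' w)) z); first exact: continuous_cj.
exact: (@continuous_comp _ _ _ f' (@cj R) (cj z) cf (@continuous_cj R _)).
Qed.

Definition cexp z : C := mkC (expR (re z) * cos (im z)) (expR (re z) * sin (im z)).

Lemma cexpD z w : cexp (z + w) = cexp z * cexp w.
Proof. by apply: cxP; rewrite !reimE expRD ?cosD ?sinD; ring. Qed.
Lemma cexp0 : cexp 0 = 1.
Proof. by apply: cxP; rewrite !reimE expR0 ?cos0 ?sin0 ?mulr1 ?mulr0. Qed.
Lemma cexpN z : cexp (- z) = (cexp z)^-1.
Proof.
have h : cexp z * cexp (- z) = 1 by rewrite -cexpD subrr cexp0.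
have z0 : cexp z != 0.
  by apply/eqP => e; move: h; rewrite e mul0r => /eqP; rewrite eq_sym oner_eq0.
by apply: (mulfI z0); rewrite h mulfV.
Qed.
Lemma cexp_neq0 z : cexp z != 0.
Proof.
apply/eqP => e; have : cexp z * cexp (- z) = 1 by rewrite -cexpD subrr cexp0.
by rewrite e mul0r => /eqP; rewrite eq_sym oner_eq0.
Qed.
Lemma cexp_cj z : cexp (cj z) = cj (cexp z).
Proof. by apply: cxP; rewrite !(cj_def, reimE) ?cosN ?sinN ?mulrN. Qed.

Lemma continuous_cexp : continuous cexp.
Proof.
move=> z; apply/(@cvg_reim _ _ (nbhs z)); split => /=; apply: (@cvgM _ _ (nbhs z)).
- by apply: (@continuous_comp _ _ _ (@re R) expR); [exact: continuous_re | exact: continuous_expR].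
- by apply: (@continuous_comp _ _ _ (@im R) cos); [exact: continuous_im | exact: continuous_cos].
- by apply: (@continuous_comp _ _ _ (@re R) expR); [exact: continuous_re | exact: continuous_expR].
- by apply: (@continuous_comp _ _ _ (@im R) sin); [exact: continuous_im | exact: continuous_sin].
Qed.

Lemma is_derive_cexp z : is_derive z 1 cexp (cexp z).
Proof.
apply: (@is_derive_CR _ cexp cexp setT) => //; first exact: openT.
  move=> x _; split => /=.
  - by apply: is_derive_eq; rewrite scaler0 add0r [_ *: _]mulrC.
  - by apply: is_derive_eq; rewrite scaler0 add0r [_ *: _]mulrC.
  - by apply: is_derive_eq; rewrite [_ *: _]mulrN.
  - by apply: is_derive_eq.
by move=> x _; exact: continuous_cexp.
Qed.

Lemma holat_cexp z : holat cexp z.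
Proof.
exists cexp; last exact: continuous_cexp.
by near=> w; exact: is_derive_cexp.
Unshelve. all: by end_near. Qed.

(** Reduction modulo 2 pi gives b in [0, 2 pi); injectivity of cos on [0, pi] then applies to b or
    to 2 pi - b. *)
Lemma cos_eq1 a : cos a = 1 -> exists n : int, a = pi *+ 2 * n%:~R.
Proof.
move=> ca; have p2 : 0 < (pi : R) *+ 2 by rewrite mulrn_wgt0 ?pi_gt0.
pose n := Num.floor (a / (pi *+ 2)); exists n.
pose b := a - pi *+ 2 * n%:~R.
have cosP x (k : int) : cos (x + pi *+ 2 * k%:~R) = cos x.
  have H (m : nat) y : cos (y + pi *+ 2 * m%:R) = cos y.
    by rewrite mulr_natr; apply: periodicn; exact: cosD2pi.
  case: k => k; first exact: H.
  rewrite NegzE mulrNz mulrN -[in RHS](subrK (pi *+ 2 * k.+1%:R) x).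
  exact/esym/H.
have nP : pi *+ 2 * n%:~R <= a.
  by rewrite mulrC -ler_pdivlMr // floor_le.
have nP1 : a < pi *+ 2 * n%:~R + pi *+ 2.
  have := floorD1_gt (a / (pi *+ 2)).
  by rewrite ltr_pdivrMr // intrD mulrDl mul1r mulrC.
have b0 : 0 <= b by rewrite subr_ge0.
have bP : b < pi *+ 2 by rewrite /b ltrBlDl.
have cb : cos b = 1 by rewrite /b -mulrN -intrN cosP.
suff : b = 0 by move=> /eqP; rewrite subr_eq0 => /eqP.
have [bpi|pib] := leP b pi.
  by apply: (@cos_inj R); rewrite ?in_itv /= ?b0 ?bpi ?lexx ?pi_ge0 // cb cos0.
have : pi *+ 2 - b = 0.
  apply: (@cos_inj R); rewrite ?in_itv /= ?lexx ?pi_ge0 //.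
    by rewrite subr_ge0 (ltW bP) mulr2n lerBlDl lerD2r ltW.
  have -> : pi *+ 2 - b = - b + pi *+ 2 * (1%:~R) by rewrite mulr1 addrC.
  by rewrite cosP cosN cb cos0.
by move=> /eqP; rewrite subr_eq0 => /eqP E; move: bP; rewrite E ltxx.
Qed.

Lemma cexp_eq1 z : cexp z = 1 -> exists n : int, z = mkC 0 (pi *+ 2 * n%:~R).
Proof.
move=> h; have := congr1 (@re R) h; have := congr1 (@im R) h.
rewrite !reimE => hs hc.
have s0 : sin (im z) = 0.
  by apply/eqP; move/eqP: hs; rewrite mulf_eq0 expR_eq0.
have c0 : 0 < cos (im z).
  have : 0 < expR (re z) * cos (im z) by rewrite hc.
  by rewrite pmulr_rgt0 // expR_gt0.
have c1 : cos (im z) = 1.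
  have := sin0cos1 s0; rewrite gtr0_norm //.
have [n hn] := cos_eq1 c1; exists n; apply: cxP; rewrite ?reimE //.
by move: hc; rewrite c1 mulr1 -(@expR0 R) => /expR_inj.
Qed.

Lemma cexp_inj z w : cexp z = cexp w ->
  exists n : int, z = w + mkC 0 (pi *+ 2 * n%:~R).
Proof.
move=> h; have [n hn] : exists n : int, z - w = mkC 0 (pi *+ 2 * n%:~R).
  by apply: cexp_eq1; rewrite cexpD cexpN h mulfV // cexp_neq0.
by exists n; rewrite -hn addrC subrK.
Qed.

Lemma cexp_2pi (n : int) : cexp (mkC 0 (pi *+ 2 * n%:~R)) = 1.
Proof.
have H : cexp (mkC 0 (pi *+ 2)) = 1.
  by apply: cxP; rewrite !reimE expR0 mul1r ?cos2pi ?sin2pi.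
have Hn (m : nat) : cexp (mkC 0 (pi *+ 2 * m%:R)) = 1.
  elim: m => [|m IH]; first by rewrite mulr0; exact: cexp0.
  have -> : mkC 0 (pi *+ 2 * m.+1%:R) = mkC 0 (pi *+ 2 * m%:R) + mkC 0 (pi *+ 2) :> C.
    by apply: cxP; rewrite !reimE ?addr0 // -natr1 mulrDr mulr1.
  by rewrite cexpD IH H mulr1.
case: n => n; first exact: Hn.
rewrite NegzE intrN mulrN.
have -> : mkC 0 (- (pi *+ 2 * n.+1%:~R)) = - mkC 0 (pi *+ 2 * n.+1%:R) :> C.
  by apply: cxP; rewrite !reimE ?oppr0.
by rewrite cexpN Hn invr1.
Qed.

Lemma cexp_surj z : z != 0 -> exists w, cexp w = z.
Proof.
move=> z0; have a0 : 0 < cabs z by rewrite cabs_gt0.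
pose x := re z / cabs z; pose y := im z / cabs z.
have xy : x ^+ 2 + y ^+ 2 = 1.
  by rewrite !expr_div_n -mulrDl -cabs2 mulfV // expf_neq0 // gt_eqF.
have x1 : -1 <= x <= 1.
  have : x ^+ 2 <= 1 by rewrite -xy lerDl sqr_ge0.
  by move=> h; rewrite -ler_norml -(ler_pXn2r (n := 2)) ?nnegrE // real_normK ?num_real // expr1n.
have s2 : sin (acos x) = `|y|.
  by rewrite sin_acos // -xy addrC addKr sqrtr_sqr.
have [t ct st] : exists2 t, cos t = x & sin t = y.
  have [y0|y0] := leP 0 y.
    by exists (acos x); rewrite ?acosK ?s2 ?ger0_norm ?in_itv.
  exists (- acos x); first by rewrite cosN acosK ?in_itv.
  by rewrite sinN s2 ltr0_norm // opprK.
exists (mkC (ln (cabs z)) t).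
apply: cxP; rewrite !reimE lnK ?posrE // ?ct ?st.
  by rewrite mulrC divfK ?gt_eqF.
by rewrite mulrC divfK ?gt_eqF.
Qed.

End Holomorphic.

(** * Holomorphic parametric integrals and the logarithm near 1 *)

Section CauchyTheory.
Variable R : realType.
Local Notation C := (Cx R).
Implicit Types (z w : C) (a b t : R) (f g : C -> C) (D : set C).

Lemma open_cball (c : C) (r : R) : open [set w : C | cabs (w - c) < r].
Proof.
rewrite openE => w /= wr; apply/nbhsCP; exists (r - cabs (w - c)).
  by rewrite subr_gt0.
move=> x xw /=; have -> : x - c = (x - w) + (w - c) by ring.
by rewrite (le_lt_trans (cabsD _ _)) // -ltrBrDr.
Qed.

Lemma is_deriveC_ext f g z (c : C) : (forall w, f w = g w) ->
  is_derive z 1 f c -> is_derive z 1 g c.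
Proof. by move=> /funext ->. Qed.

Lemma is_deriveC_eq f g z (c d : C) : is_derive z 1 f c ->
  (forall w, f w = g w) -> c = d -> is_derive z 1 g d.
Proof. by move=> h /funext <- <-. Qed.

Lemma is_deriveC_mul f g z (df dg : C) :
  is_derive z 1 f df -> is_derive z 1 g dg ->
  is_derive z 1 (fun w => f w * g w) (df * g z + f z * dg).
Proof.
move=> hf hg; have hm := is_deriveM hf hg; apply: (is_derive_eq hm).
by rewrite [LHS]addrC; congr (_ + _); exact: mulrC.
Qed.

Lemma is_deriveC_add f g z (df dg : C) :
  is_derive z 1 f df -> is_derive z 1 g dg ->
  is_derive z 1 (fun w => f w + g w) (df + dg).
Proof. by move=> hf hg; have h := is_deriveD hf hg; exact: h. Qed.

Lemma is_deriveC_affine (a b z : C) : is_derive z 1 (fun w : C => a + b * w) b.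
Proof.
have h := is_deriveD (is_derive_cst a z (1 : C))
  (is_deriveC_mul (is_derive_cst b z (1 : C)) (is_derive_id z (1 : C))).
by apply: (is_derive_eq h); rewrite mul0r mulr1 !add0r.
Qed.

Lemma is_deriveC_div f g z (df dg : C) :
  is_derive z 1 f df -> is_derive z 1 g dg -> g z != 0 ->
  is_derive z 1 (fun w => f w / g w) ((df * g z - f z * dg) / g z ^+ 2).
Proof.
move=> hf hg g0.
have hm := is_deriveC_mul hf (is_deriveC_comp hg (is_deriveC_inv g0)).
by apply: (is_derive_eq hm); field.
Qed.

Lemma jc_fst (p : C * R) : {for p, continuous (fun q : C * R => q.1)}.
Proof. by case: p => z t; exact: cvg_fst. Qed.
Lemma jc_snd (p : C * R) : {for p, continuous (fun q : C * R => mkC q.2 0)}.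
Proof.
apply/(@cvg_reim _ _ (nbhs p)); split => /=; last exact: (@cvg_cst _ _ _ (nbhs p)).
by case: p => z t; exact: cvg_snd.
Qed.
Lemma jc_cst (T : topologicalType) (c : C) (p : T) : {for p, continuous (fun q : T => c)}.
Proof. exact: (@cvg_cst _ _ _ (nbhs p)). Qed.
Lemma jcD (T : topologicalType) (F G : T -> C) (p : T) :
  {for p, continuous F} -> {for p, continuous G} ->
  {for p, continuous (fun q => F q + G q)}.
Proof. by move=> hF hG; exact: (cvgD hF hG). Qed.
Lemma jcN (T : topologicalType) (F : T -> C) (p : T) : {for p, continuous F} ->
  {for p, continuous (fun q => - F q)}.
Proof. by move=> hF; exact: (cvgN hF). Qed.
Lemma jcM (T : topologicalType) (F G : T -> C) (p : T) :
  {for p, continuous F} -> {for p, continuous G} ->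
  {for p, continuous (fun q => F q * G q)}.
Proof. by move=> hF hG; exact: (cvgM hF hG). Qed.
Lemma jcV (T : topologicalType) (F : T -> C) (p : T) : F p != 0 ->
  {for p, continuous F} -> {for p, continuous (fun q => (F q)^-1)}.
Proof. by move=> F0 hF; exact: (cvgV F0 hF). Qed.
Lemma jc_comp (T : topologicalType) (f : C -> C) (F : T -> C) (p : T) :
  {for p, continuous F} ->
  {for F p, continuous f} -> {for p, continuous (fun q => f (F q))}.
Proof. by move=> hF hf; exact: (@continuous_comp _ _ _ F f p hF hf). Qed.
Lemma jc_t (F : R -> C) (p : C * R) : {for p.2, continuous F} ->
  {for p, continuous (fun q => F q.2)}.
Proof.
move=> hF; apply: (@continuous_comp _ _ _ snd F p _ hF).
by case: p {hF} => z t; exact: cvg_snd.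
Qed.

Lemma cint_holomorphic (Phi Phi' : C -> R -> C) (D : set C) :
  open D ->
  (forall w t, D w -> 0 <= t <= 1 ->
     {for (w, t), continuous (fun p : C * R => Phi p.1 p.2)}) ->
  (forall w t, D w -> 0 <= t <= 1 ->
     {for (w, t), continuous (fun p : C * R => Phi' p.1 p.2)}) ->
  (forall w t, D w -> 0 <= t <= 1 -> is_derive w 1 (Phi ^~ t) (Phi' w t)) ->
  forall z, D z -> is_derive z 1 (fun w => cint (Phi w)) (cint (Phi' z)) /\
    holat (fun w => cint (Phi w)) z.
Proof.
move=> oD c1 c2 dPhi.
have c1' w : D w -> cont01 (Phi w).
  by move=> Dw t ht; apply: cont_slice; exact: c1.
have c2' w : D w -> cont01 (Phi' w).
  by move=> Dw t ht; apply: cont_slice; exact: c2.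
have dz z : D z -> is_derive z 1 (fun w => cint (Phi w)) (cint (Phi' z)).
  exact: cint_derive.
move=> z Dz; split; first exact: dz.
apply: (holat_open oD dz) => // w Dw.
by apply: (cint_continuous oD Dw c2') => t ht; exact: c2.
Qed.

(** The integral of 1 / w along the segment from 1 to [z]. *)
Definition clog z : C := cint (fun t => (z - 1) / (1 + mkC t 0 * (z - 1))).

Lemma one_plus_neq0 z : cabs z < 1 -> 1 + z != 0.
Proof.
move=> h; apply/eqP => e; have : cabs (- 1 : C) < 1.
  by rewrite -[X in cabs X](_ : z = _) //; apply/eqP; rewrite -subr_eq0 opprK addrC e.
by rewrite cabsN cabs1 ltxx.
Qed.

(** Differentiating under the integral gives (1 + t (w - 1))^-2, with antiderivative t / (1 + t (w -
    1)); hence the derivative of [clog] is 1 / w, and w exp(- clog w) is constant along the segment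
    from 1 to [z]. *)
Lemma clog_spec z : cabs (z - 1) < 1 -> cexp (clog z) = z /\ holat clog z.
Proof.
pose D := [set w : C | cabs (w - 1) < 1].
have oD : open D by exact: (@open_cball 1 1).
have n0 w t : D w -> 0 <= t <= 1 -> 1 + mkC t 0 * (w - 1) != 0.
  move=> Dw /andP[t0 t1]; apply: one_plus_neq0.
  by rewrite cabsM cabs_real ger0_norm // (le_lt_trans _ Dw) // ler_piMl ?cabs_ge0.
have jden w t : {for (w, t), continuous (fun p : C * R => 1 + mkC p.2 0 * (p.1 - 1))}.
  apply: jcD; first exact: jc_cst.
  apply: jcM; first exact: jc_snd.
  by apply: jcD; [exact: jc_fst | exact: jc_cst].
have Hd := @cint_holomorphic (fun w t => (w - 1) / (1 + mkC t 0 * (w - 1)))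
  (fun w t => (1 + mkC t 0 * (w - 1)) ^- 2) D oD.
have {}Hd w : D w -> is_derive w 1 clog (cint (fun t => (1 + mkC t 0 * (w - 1)) ^- 2))
    /\ holat clog w.
  apply: Hd => {w} w t Dw ht.
  - apply: jcM; first by apply: jcD; [exact: jc_fst | exact: jc_cst].
    by apply: jcV; [exact: n0 | exact: jden].
  - apply: (@jcV _ (fun p : C * R => (1 + mkC p.2 0 * (p.1 - 1)) ^+ 2)).
      by rewrite expf_neq0 //; exact: n0.
    by apply: (@jcM _ (fun p : C * R => (1 + mkC p.2 0 * (p.1 - 1))) (fun p : C * R => (1 + mkC p.2 0 * (p.1 - 1)))); exact: jden.
  - have d1 : is_derive w 1 (fun z : C => z - 1) 1.
      by apply: is_deriveC_ext (is_deriveC_affine (-1) 1 w) => x; ring.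
    have d2 : is_derive w 1 (fun z : C => 1 + mkC t 0 * (z - 1)) (mkC t 0).
      by apply: is_deriveC_ext (is_deriveC_affine (1 - mkC t 0) (mkC t 0) w) => x; ring.
    apply: (is_deriveC_eq (is_deriveC_div d1 d2 (n0 _ _ Dw ht))) => //.
    have := n0 _ _ Dw ht; move: (mkC t 0) => T h.
    by rewrite (_ : 1 * _ - _ = 1) ?mul1r //; ring.
have Hlog w : D w -> is_derive w 1 clog w^-1.
  move=> Dw; have [d _] := Hd w Dw; apply: (is_derive_eq d).
  suff -> : cint (fun t => (1 + mkC t 0 * (w - 1)) ^- 2) =
      1 / (1 + 1 * (w - 1)) - 0 / (1 + 0 * (w - 1)).
    by rewrite mul0r subr0 mul1r mul1r; congr (_^-1); ring.
  apply: (@cint_FTC _ (fun T => T / (1 + T * (w - 1))) (fun T => (1 + T * (w - 1)) ^- 2)).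
  - move=> t ht; apply: (@cont_slice _ (fun w t => (1 + mkC t 0 * (w - 1)) ^- 2) w t).
    apply: (@jcV _ (fun p : C * R => (1 + mkC p.2 0 * (p.1 - 1)) ^+ 2)).
      by rewrite expf_neq0 //; exact: n0.
    by apply: (@jcM _ (fun p : C * R => (1 + mkC p.2 0 * (p.1 - 1))) (fun p : C * R => (1 + mkC p.2 0 * (p.1 - 1)))); exact: jden.
  - move=> t ht; have := n0 _ _ Dw ht; move: (mkC t 0) => T h.
    have d1 : is_derive T 1 (id : C -> C) 1 by exact: is_derive_id.
    have d2 : is_derive T 1 (fun T : C => 1 + T * (w - 1)) (w - 1).
      by apply: is_deriveC_ext (is_deriveC_affine 1 (w - 1) T) => x; ring.
    apply: (is_deriveC_eq (is_deriveC_div d1 d2 h)) => //.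
    by rewrite (_ : 1 * _ - _ = 1) ?mul1r //; rewrite /=; ring.
move=> zD; split; last by have [] := Hd z zD.
have z0 w : D w -> w != 0.
  by move=> Dw; have := one_plus_neq0 Dw; rewrite addrC subrK.
have K : z * cexp (- clog z) = 1 * cexp (- clog 1).
  apply: (@segment_const _ (fun w => w * cexp (- clog w)) 1 z) => t ht.
  set w := _ + _.
  have Dw : D w.
    rewrite /D /= /w [1 + _]addrC addrK cabsM cabs_real.
    by case/andP: ht => t0 t1; rewrite ger0_norm // (le_lt_trans _ zD) // ler_piMl ?cabs_ge0.
  have dl := is_deriveN (Hlog _ Dw).
  have de := is_deriveC_comp dl (is_derive_cexp (- clog w)).
  have di : is_derive w 1 (id : C -> C) 1 by exact: is_derive_id.
  apply: (is_deriveC_eq (is_deriveC_mul di de)) => //.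
  by rewrite mul1r !mulrN mulrCA mulfV ?z0 // mulr1 addrN.
have l1 : clog 1 = 0.
  rewrite /clog -[RHS](@cint_cst R 0); apply: eq_cint => t _.
  by rewrite subrr mul0r.
move: K; rewrite l1 oppr0 cexp0 mulr1 cexpN => K.
by rewrite -[LHS]mul1r -K divfK // cexp_neq0.
Qed.

End CauchyTheory.

(** * The quotient arctan x / x as a holomorphic function of the square of x *)

Section ArctanQuotient.
Variable R : realType.
Local Notation C := (Cx R).
Implicit Types (z w m x : C) (a b t : R).

Definition iC : C := mkC 0 1.

Lemma iC2 : iC * iC = -1.
Proof. by apply: cxP; rewrite !reimE ?oppr0; ring. Qed.

(** The complement of the half-line (-oo, -1]. It is star-shaped about 0, so 1 + m t^2 has no zero
    for m in it and t in [0, 1]. *)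
Definition slit : set C := [set m | im m != 0 \/ -1 < re m].

Lemma open_slit : open slit.
Proof.
rewrite openE => m [h|h]; apply/nbhsCP.
  exists `|im m|; first by rewrite normr_gt0.
  move=> w wm; left; apply/eqP => e.
  have := le_lt_trans (cabs_im _) wm.
  by rewrite imD imN e sub0r normrN ltxx.
exists (re m + 1); first by rewrite -ltrBlDr sub0r.
move=> w wm; right; have := le_lt_trans (cabs_re _) wm.
rewrite reD reN ltr_norml => /andP[+ _]; lra.
Qed.

Lemma slit_scale m t : slit m -> 0 <= t <= 1 -> slit (mkC t 0 * m).
Proof.
move=> h /andP[t0 t1]; rewrite /slit /= !reimE !mul0r subr0 addr0.
have [->|tN0] := eqVneq t 0; first by right; rewrite mul0r ltrN10.
case: h => h; first by left; rewrite mulf_neq0.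
right; have tp : 0 < t by rewrite lt_def tN0.
have : t * -1 < t * re m by rewrite ltr_pM2l.
by rewrite mulrN1; lra.
Qed.

Lemma slit_neq0 m t : slit m -> 0 <= t <= 1 -> 1 + m * mkC t 0 ^+ 2 != 0.
Proof.
move=> h ht; have ht2 : 0 <= t ^+ 2 <= 1.
  by case/andP: ht => t0 t1; rewrite sqr_ge0 expr_le1.
have -> : m * mkC t 0 ^+ 2 = mkC (t ^+ 2) 0 * m.
  by apply: cxP; rewrite !expr2 !reimE; ring.
apply/eqP => e; case: (slit_scale h ht2) => /=.
  by have /eqP := congr1 (@im R) e; rewrite imD im1 add0r => -> .
by have := congr1 (@re R) e; rewrite reD re1 re0; lra.
Qed.

(* [atanq (x ^ 2) = arctan x / x] *)
Definition atanq m : C := cint (fun t => (1 + m * mkC t 0 ^+ 2)^-1).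

Let jden w t : {for (w, t), continuous (fun p : C * R => 1 + p.1 * mkC p.2 0 ^+ 2)}.
Proof.
apply: jcD; first exact: jc_cst.
apply: jcM; first exact: jc_fst.
by apply: (@jcM _ _ (fun p : C * R => mkC p.2 0) (fun p : C * R => mkC p.2 0)); exact: jc_snd.
Qed.

Let jden2 w t : slit w -> 0 <= t <= 1 ->
  {for (w, t), continuous (fun p : C * R => (1 + p.1 * mkC p.2 0 ^+ 2) ^- 2)}.
Proof.
move=> Dw ht; apply: (@jcV _ _ (fun p : C * R => (1 + p.1 * mkC p.2 0 ^+ 2) ^+ 2)).
  by rewrite expf_neq0 //; exact: slit_neq0.
by apply: (@jcM _ _ (fun p : C * R => (1 + p.1 * mkC p.2 0 ^+ 2)) (fun p : C * R => (1 + p.1 * mkC p.2 0 ^+ 2))); exact: jden.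
Qed.

Let dq m t := - mkC t 0 ^+ 2 * (1 + m * mkC t 0 ^+ 2) ^- 2.

Let jdq w t : slit w -> 0 <= t <= 1 ->
  {for (w, t), continuous (fun p : C * R => dq p.1 p.2)}.
Proof.
move=> Dw ht; apply: jcM; last exact: jden2.
apply: jcN.
by apply: (@jcM _ _ (fun p : C * R => mkC p.2 0) (fun p : C * R => mkC p.2 0)); exact: jc_snd.
Qed.

Let datanq m : slit m -> is_derive m 1 atanq (cint (dq m)) /\ holat atanq m.
Proof.
apply: (@cint_holomorphic _ (fun m t => (1 + m * mkC t 0 ^+ 2)^-1) dq slit open_slit) => {m} w t Dw ht.
- by apply: jcV; [exact: slit_neq0 | exact: jden].
- exact: jdq.
- have d2 : is_derive w 1 (fun w : C => 1 + w * mkC t 0 ^+ 2) (mkC t 0 ^+ 2).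
    by apply: is_deriveC_ext (is_deriveC_affine 1 (mkC t 0 ^+ 2) w) => x; ring.
  apply: (is_deriveC_eq (is_deriveC_comp d2 (is_deriveC_inv (slit_neq0 Dw ht)))) => //.
  by rewrite /dq mulrC mulNr mulrN.
Qed.

Lemma holat_atanq m : slit m -> holat atanq m.
Proof. by move=> /datanq[]. Qed.

(** With m = x^2 the derivative is the integral of 1 / (1 + m t^2) - 2 m t^2 / (1 + m t^2)^2, which
    is the derivative in t of t / (1 + m t^2). *)
Lemma is_derive_xatanq x : slit (x ^+ 2) ->
  is_derive x 1 (fun x => x * atanq (x ^+ 2)) (1 + x ^+ 2)^-1.
Proof.
move=> Dx; have [da _] := datanq Dx.
have d1 : is_derive x 1 (fun x : C => x ^+ 2) (x + x).
  have di := is_derive_id x (1 : C).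
  by apply: (is_deriveC_eq (is_deriveC_mul di di)) => //; rewrite mul1r mulr1.
have d2 := is_deriveC_mul (is_derive_id x (1 : C)) (is_deriveC_comp d1 da).
apply: (is_deriveC_eq d2) => //=; rewrite mul1r.
move: Dx; set m := x ^+ 2 => Dm.
have -> : x * (cint (dq m) * (x + x)) = (m + m) * cint (dq m) by rewrite /m; ring.
have c1 : cont01 (dq m) by move=> t ht; apply: cont_slice; exact: jdq.
have c0 : cont01 (fun t => (1 + m * mkC t 0 ^+ 2)^-1).
  move=> t ht; apply: (@cont_slice _ (fun m t => (1 + m * mkC t 0 ^+ 2)^-1) m t).
  by apply: jcV; [exact: slit_neq0 | exact: jden].
rewrite -(cintZ (m + m) c1) -(cintD c0 (cont01M (@cont01_cst _ (m + m)) c1)).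
pose p (T : C) := (1 + m * T ^+ 2)^-1 + (m + m) * (- T ^+ 2 * (1 + m * T ^+ 2) ^- 2).
suff -> : cint (fun t => p (mkC t 0)) = 1 / (1 + m * 1 ^+ 2) - 0 / (1 + m * 0 ^+ 2).
  by rewrite mul0r subr0 expr1n mul1r mulr1.
apply: (@cint_FTC _ (fun T => T / (1 + m * T ^+ 2)) p).
  exact: (cont01D c0 (cont01M (@cont01_cst _ (m + m)) c1)).
move=> t ht; have n0 := slit_neq0 Dm ht; move: n0; rewrite /p; move: (mkC t 0) => T n0.
have d3 : is_derive T 1 (fun x : C => 1 + m * x ^+ 2) (m * (T + T)).
  have di := is_derive_id T (1 : C).
  have dd := is_deriveC_mul (is_derive_cst m T (1 : C)) (is_deriveC_mul di di).
  have da1 := is_deriveD (is_derive_cst (1 : C) T (1 : C)) dd.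
  by apply: (is_deriveC_eq da1) => //; rewrite mul0r !add0r mul1r mulr1.
apply: (is_deriveC_eq (is_deriveC_div (is_derive_id T (1 : C)) d3 n0)) => //.
by move: n0 => /=; move: (1 + _) => d n0; field.
Qed.

(** This is exp (2 i arctan x) = (1 + i x) / (1 - i x). The quotient of both sides has derivative 0
    along the segment from 0 to [x], on which the square of the variable is a multiple t^2 x^2 and
    stays in [slit]. *)
Lemma cexp_atanq x : slit (x ^+ 2) ->
  cexp ((iC + iC) * (x * atanq (x ^+ 2))) * (1 - iC * x) = 1 + iC * x.
Proof.
move=> Dx.
have E w : (1 + iC * w) * (1 - iC * w) = 1 + w ^+ 2.
  by transitivity (1 - iC * iC * w ^+ 2); [ring | rewrite iC2; ring].
have n1 w : slit (w ^+ 2) -> 1 + w ^+ 2 != 0.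
  move=> Dw; have h1 : 0 <= (1 : R) <= (1 : R) by rewrite ler01 lexx.
  by have := slit_neq0 Dw h1; rewrite -[mkC 1 0]/(1 : C) expr1n mulr1.
have K : cexp ((iC + iC) * (x * atanq (x ^+ 2))) * ((1 - iC * x) / (1 + iC * x)) =
  cexp ((iC + iC) * (0 * atanq (0 ^+ 2))) * ((1 - iC * 0) / (1 + iC * 0)).
  apply: (@segment_const _ (fun w => cexp ((iC + iC) * (w * atanq (w ^+ 2))) * ((1 - iC * w) / (1 + iC * w))) 0 x) => t ht.
  set w := _ + _.
  have Dw : slit (w ^+ 2).
    have -> : w ^+ 2 = mkC (t ^+ 2) 0 * x ^+ 2.
      rewrite /w add0r subr0 exprMn; congr (_ * _).
      by apply: cxP; rewrite !expr2 !reimE; ring.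
    by apply: slit_scale => //; case/andP: ht => t0 t1; rewrite sqr_ge0 expr_le1.
  have nw := n1 _ Dw; rewrite -E mulf_eq0 negb_or in nw; case/andP: nw => u0 v0.
  have dn := is_derive_xatanq Dw.
  have dn2 := is_deriveC_mul (is_derive_cst (iC + iC) w (1 : C)) dn.
  have de := is_deriveC_comp dn2 (is_derive_cexp _).
  have du : is_derive w 1 (fun w : C => 1 + iC * w) iC := is_deriveC_affine 1 iC w.
  have dv : is_derive w 1 (fun w : C => 1 - iC * w) (- iC).
    by apply: is_deriveC_ext (is_deriveC_affine 1 (- iC) w) => y; ring.
  have dd := is_deriveC_mul de (is_deriveC_div dv du u0).
  apply: (is_deriveC_eq dd) => //; rewrite /cst mul0r add0r -E.
  set e := cexp _; move: u0 v0; set u := 1 + iC * w; set v := 1 - iC * w => u0 v0.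
  have uv : - iC * u - v * iC = - (iC + iC) by rewrite /u /v; ring.
  by move: u v e uv u0 v0 => u v e -> u0 v0; field; rewrite u0 v0.
have u0 : 1 + iC * x != 0.
  by have := n1 _ Dx; rewrite -E mulf_eq0 negb_or => /andP[].
move: K; rewrite !mulr0 mul0r mulr0 cexp0 subr0 addr0 divr1 mul1r => K.
by apply: (mulIf (invr_neq0 u0)); rewrite -mulrA K mulfV.
Qed.

Lemma cint_cj (F : R -> C) : cont01 F -> cint (fun t => cj (F t)) = cj (cint F).
Proof.
move=> cF; apply: cxP; rewrite !(cj_def, reimE) //.
rewrite -mulN1r -(riZ (-1) (cont01_im cF)); apply: eq_ri => t _.
by rewrite mulN1r.
Qed.

Lemma atanq_cj m : slit m -> atanq (cj m) = cj (atanq m).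
Proof.
move=> Dm; rewrite /atanq -cint_cj.
  by apply: eq_cint => t _; rewrite cjV cjD cjM cj1 cjX cj_real.
move=> t ht; apply: (@cont_slice _ (fun m t => (1 + m * mkC t 0 ^+ 2)^-1) m t).
by apply: jcV; [exact: slit_neq0 | exact: jden].
Qed.

Lemma atanq0 : atanq 0 = 1.
Proof.
rewrite /atanq -[RHS]cint_cst; apply: eq_cint => t _.
by rewrite mul0r addr0 invr1.
Qed.

End ArctanQuotient.

(** * Cauchy's formula and its consequences *)

Section CauchyFormula.
Variable R : realType.
Local Notation C := (Cx R).
Implicit Types (z w m x : C) (t : R) (f g : C -> C).

Let k : C := mkC 0 (pi *+ 2).

Let k_neq0 : k != 0.
Proof.
rewrite -cabs_gt0 (lt_le_trans _ (cabs_im _)) // normr_gt0 /=.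
by rewrite mulrn_eq0 /= gt_eqF // pi_gt0.
Qed.

Let cexpk : cexp k = 1.
Proof. by have := @cexp_2pi R 1; rewrite mulr1. Qed.

Lemma cexp_unit t : cabs (cexp (k * mkC t 0)) = 1.
Proof.
apply/eqP; rewrite -(@eqrXn2 _ 2) ?cabs_ge0 // cabs2 expr1n.
by rewrite !reimE !mul0r mulr0 subr0 expR0 !mul1r cos2Dsin2.
Qed.

Variables (a : C) (r : R).
Hypothesis r_gt0 : 0 < r.

(** The radius vector of the circle. The derivative of the contour is [k] times it, and this factor
    2 pi i cancels the normalisation of Cauchy's formula, so the integrals below carry no
    constant. *)
Definition dcirc t : C := mkC r 0 * cexp (k * mkC t 0).
Definition circ t : C := a + dcirc t.

Lemma cabs_dcirc t : cabs (dcirc t) = r.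
Proof. by rewrite cabsM cabs_real cexp_unit mulr1 gtr0_norm. Qed.

Lemma circ_gap w t : cabs (w - a) < r -> r - cabs (w - a) <= cabs (circ t - w).
Proof.
move=> wr; rewrite lerBlDr -{1}(cabs_dcirc t).
have -> : dcirc t = (circ t - w) + (w - a) by rewrite /circ; ring.
exact: cabsD.
Qed.

Lemma circ_neq w t : cabs (w - a) < r -> circ t - w != 0.
Proof.
move=> wr; rewrite -cabs_gt0 (lt_le_trans _ (circ_gap t wr)) //.
by rewrite subr_gt0.
Qed.

Lemma is_derive_dcirc z :
  is_derive z 1 (fun T : C => mkC r 0 * cexp (k * T)) (k * (mkC r 0 * cexp (k * z))).
Proof.
have d1 := is_deriveC_mul (is_derive_cst k z (1 : C)) (is_derive_id z (1 : C)).
have d2 := is_deriveC_comp d1 (is_derive_cexp _).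
have d3 := is_deriveC_mul (is_derive_cst (mkC r 0 : C) z (1 : C)) d2.
by apply: (is_deriveC_eq d3) => //; rewrite /cst /=; ring.
Qed.

Lemma continuous_dcirc : continuous dcirc.
Proof.
move=> t; have h := @jc_snd R ((0 : C), t).
have c1 := @cont_slice R (fun _ t => mkC t 0) 0 t h.
have c2 : {for mkC t 0, continuous (fun T : C => mkC r 0 * cexp (k * T))}.
  by have := is_deriveC_continuous (is_derive_dcirc (mkC t 0)).
exact: (@continuous_comp _ _ _ (fun t => mkC t 0) (fun T : C => mkC r 0 * cexp (k * T)) t c1 c2).
Qed.

Lemma continuous_circ : continuous circ.
Proof.
by move=> t; apply: (jcD (@jc_cst R _ a t)); exact: continuous_dcirc.
Qed.

Lemma jc_den w t : {for (w, t), continuous (fun p : C * R => circ p.2 - p.1)}.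
Proof.
apply: jcD; first by apply: jc_t; exact: continuous_circ.
by apply: jcN; exact: jc_fst.
Qed.

Lemma cauchy_kernel_derive (psi : R -> C) w : cont01 psi -> cabs (w - a) < r ->
  is_derive w 1 (fun w => cint (fun t => psi t / (circ t - w)))
    (cint (fun t => psi t / (circ t - w) ^+ 2)) /\
  holat (fun w => cint (fun t => psi t / (circ t - w))) w.
Proof.
move=> cpsi; pose D := [set w : C | cabs (w - a) < r].
apply: (@cint_holomorphic _ (fun w t => psi t / (circ t - w))
  (fun w t => psi t / (circ t - w) ^+ 2) D) => {w} [|w t Dw ht|w t Dw ht|w t Dw ht].
- exact: open_cball.
- apply: jcM; first by apply: jc_t; exact: cpsi.
  by apply: jcV; [exact: circ_neq | exact: jc_den].
- apply: jcM; first by apply: jc_t; exact: cpsi.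
  apply: (@jcV _ _ (fun p : C * R => (circ p.2 - p.1) ^+ 2)).
    by rewrite expf_neq0 // circ_neq.
  by apply: (@jcM _ _ (fun p : C * R => (circ p.2 - p.1)) (fun p : C * R => (circ p.2 - p.1))); exact: jc_den.
- have d1 : is_derive w 1 (fun w : C => circ t - w) (-1).
    by apply: is_deriveC_ext (is_deriveC_affine (circ t) (-1) w) => y; ring.
  have d2 := is_deriveC_div (is_derive_cst (psi t) w (1 : C)) d1 (circ_neq t Dw).
  by apply: (is_deriveC_eq d2) => //=; rewrite mul0r sub0r mulrN1 opprK.
Qed.

Lemma cont01_dcirc : cont01 dcirc.
Proof. by move=> t _; exact: continuous_dcirc. Qed.

Lemma cint_dcirc : cint dcirc = 0.
Proof.
apply: (mulfI k_neq0); rewrite mulr0 -(cintZ k cont01_dcirc).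
have := @cint_FTC _ (fun T : C => mkC r 0 * cexp (k * T)) (fun T : C => k * (mkC r 0 * cexp (k * T))).
rewrite mulr1 mulr0 cexpk cexp0 subrr; apply.
  exact: (cont01M (@cont01_cst _ k) cont01_dcirc).
by move=> t _; exact: is_derive_dcirc.
Qed.

(** The derivative in [w] is the integral of dcirc / (circ - w)^2, whose antiderivative is a
    multiple of the periodic function -1 / (circ - w); so the integral does not depend on [w], and
    for w = a the integrand is 1. *)
Lemma cauchy_kernel1 w : cabs (w - a) < r ->
  cint (fun t => dcirc t / (circ t - w)) = 1.
Proof.
move=> wr; transitivity (cint (fun t => dcirc t / (circ t - a))); last first.
  rewrite -[RHS]cint_cst; apply: eq_cint => t _.
  have h : cabs (a - a) < r by rewrite subrr cabs0.
  by have := circ_neq t h; rewrite /circ addrC addKr => h'; rewrite mulfV.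
apply: (@segment_const _ (fun w => cint (fun t => dcirc t / (circ t - w))) a w) => s hs.
set v := _ + _.
have vr : cabs (v - a) < r.
  rewrite /v addrC addKr cabsM cabs_real.
  by case/andP: hs => s0 s1; rewrite ger0_norm // (le_lt_trans _ wr) // ler_piMl ?cabs_ge0.
have [d _] := cauchy_kernel_derive cont01_dcirc vr.
apply: (is_deriveC_eq d) => //; apply: (mulfI k_neq0); rewrite mulr0.
pose cC (T : C) := a + mkC r 0 * cexp (k * T).
pose p (T : C) := k * (mkC r 0 * cexp (k * T) / (cC T - v) ^+ 2).
have cp : cont01 (fun t => dcirc t / (circ t - v) ^+ 2).
  move=> t ht; apply: (@cont_slice _ (fun v t => dcirc t / (circ t - v) ^+ 2) v t).
  apply: jcM; first by apply: jc_t; exact: cont01_dcirc.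
  apply: (@jcV _ _ (fun p : C * R => (circ p.2 - p.1) ^+ 2)).
    by rewrite expf_neq0 // circ_neq.
  by apply: (@jcM _ _ (fun p : C * R => (circ p.2 - p.1)) (fun p : C * R => (circ p.2 - p.1))); exact: jc_den.
rewrite -(cintZ k cp).
have F := @cint_FTC _ (fun T => - 1 / (cC T - v)) p.
transitivity (- 1 / (cC 1 - v) - - 1 / (cC 0 - v)); last first.
  by rewrite /cC mulr1 mulr0 cexpk cexp0 subrr.
apply: F; first exact: (cont01M (@cont01_cst _ k) cp).
move=> t ht; have n0 : cC (mkC t 0) - v != 0 by exact: (circ_neq t vr).
have d1 : is_derive (mkC t 0 : C) 1 (fun T => cC T - v) (k * (mkC r 0 * cexp (k * mkC t 0))).
  have d0 := is_deriveC_add (is_derive_cst (a - v) (mkC t 0 : C) (1 : C)) (is_derive_dcirc (mkC t 0)).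
  by apply: (is_deriveC_eq d0) => [T|]; rewrite ?add0r // /cC /=; ring.
have d2 := is_deriveC_div (is_derive_cst (- 1 : C) (mkC t 0 : C) (1 : C)) d1 n0.
apply: (is_deriveC_eq d2) => //=; rewrite /p mul0r sub0r mulN1r opprK -mulrA.
by [].
Qed.

(** The circle is contracted to [w] through w + s (circ - w). The derivative in s of the integral is
    the integral of f'(w + s (circ - w)) dcirc; up to the factor [k * s] its integrand is the
    derivative in t of a function with equal values at 0 and 1. At s = 0 the integral is f(w) by
    [cauchy_kernel1]. *)
Lemma cauchy_formula f w rho : r < rho ->
  (forall z, cabs (z - a) < rho -> holat f z) -> cabs (w - a) < r ->
  f w = cint (fun t => f (circ t) * dcirc t / (circ t - w)).
Proof.
move=> rrho hf wr.
(* An open set of complex parameters containing [0, 1] for which the contracted circle stays in the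
   disc of radius [rho]: the derivative in s is a complex one. *)
pose D := [set s : C | cabs (1 - s) * cabs (w - a) + cabs s * r < rho].
have pr : 0 < cabs (w - a) + r by rewrite ltr_wpDl ?cabs_ge0.
have oD : open D.
  rewrite openE => s; rewrite /D /= => hs; apply/nbhsCP.
  set g := _ + _ in hs; exists ((rho - g) / (cabs (w - a) + r)).
    by rewrite divr_gt0 // subr_gt0.
  move=> s'; rewrite ltr_pdivlMr // => h /=.
  have h1 : cabs (1 - s') <= cabs (1 - s) + cabs (s' - s).
    by rewrite [cabs (s' - s)]cabs_distC (le_trans _ (cabsD _ _)) // -[1 - s + _]/(_) addrA subrK.
  have h2 : cabs s' <= cabs s + cabs (s' - s).
    by rewrite (le_trans _ (cabsD _ _)) // addrC subrK.
  apply: (@le_lt_trans _ _ ((cabs (1 - s) + cabs (s' - s)) * cabs (w - a) + (cabs s + cabs (s' - s)) * r)).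
    by rewrite lerD // ler_wpM2r ?cabs_ge0 // ltW.
  by move: h; rewrite /g; lra.
have D01 t : 0 <= t <= 1 -> D (mkC t 0).
  move=> /andP[t0 t1]; rewrite /D /=.
  have -> : 1 - mkC t 0 = mkC (1 - t) 0 :> C by apply: cxP; rewrite !reimE ?subr0.
  rewrite !cabs_real !ger0_norm ?subr_ge0 //; apply: le_lt_trans rrho.
  have : (1 - t) * cabs (w - a) <= (1 - t) * r by rewrite ler_wpM2l ?subr_ge0 // ltW.
  by lra.
have inb s t : D s -> cabs (w + s * (circ t - w) - a) < rho.
  move=> Ds; apply: le_lt_trans Ds.
  have -> : w + s * (circ t - w) - a = (1 - s) * (w - a) + s * dcirc t by rewrite /circ; ring.
  by rewrite (le_trans (cabsD _ _)) // (cabsM s) (cabsM (1 - s)) cabs_dcirc.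
have hf' z : cabs (z - a) < rho -> is_derive z 1 f ('D_1 f z) /\ {for z, continuous ('D_1 f : C -> C)}.
  by move=> /hf /holat_derive.
pose Phi s t := f (w + s * (circ t - w)) * (dcirc t / (circ t - w)).
pose Phi' s t := ('D_1 f (w + s * (circ t - w)) : C) * dcirc t.
have jarg s t : {for (s, t), continuous (fun p : C * R => w + p.1 * (circ p.2 - w))}.
  apply: jcD; first exact: jc_cst.
  apply: jcM; first exact: jc_fst.
  by apply: jcD; [apply: jc_t; exact: continuous_circ | exact: jc_cst].
have jPhi s t : D s -> 0 <= t <= 1 -> {for (s, t), continuous (fun p : C * R => Phi p.1 p.2)}.
  move=> Ds ht; apply: jcM.
    apply: (@jc_comp _ _ f (fun p : C * R => w + p.1 * (circ p.2 - w)) (s, t)); first exact: jarg.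
    exact/holat_continuous/hf/inb.
  apply: (@jc_t _ (fun t => dcirc t / (circ t - w))).
  have c1 := @continuous_circ t; have c2 := @continuous_dcirc t.
  have c3 := @jc_cst R _ w t.
  exact: (cvgM c2 (cvgV (circ_neq t wr) (cvgB c1 c3))).
have jPhi' s t : D s -> 0 <= t <= 1 -> {for (s, t), continuous (fun p : C * R => Phi' p.1 p.2)}.
  move=> Ds ht; apply: jcM; last by apply: jc_t; exact: continuous_dcirc.
  apply: (@jc_comp _ _ ('D_1 f) (fun p : C * R => w + p.1 * (circ p.2 - w)) (s, t)); first exact: jarg.
  by have [] := hf' _ (inb s t Ds).
have dPhi s t : D s -> 0 <= t <= 1 -> is_derive s 1 (Phi ^~ t) (Phi' s t).
  move=> Ds ht; have [df _] := hf' _ (inb s t Ds).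
  have d1 : is_derive s 1 (fun s : C => w + s * (circ t - w)) (circ t - w).
    by apply: is_deriveC_ext (is_deriveC_affine w (circ t - w) s) => y; ring.
  have d2 := is_deriveC_mul (is_deriveC_comp d1 df) (is_derive_cst (dcirc t / (circ t - w)) s (1 : C)).
  apply: (is_deriveC_eq d2) => //=; rewrite mulr0 addr0 /Phi'.
  by rewrite -mulrA; congr (_ * _); rewrite mulrC divfK // circ_neq.
have H := cint_holomorphic oD jPhi jPhi' dPhi.
have cPhi' s : D s -> cont01 (Phi' s).
  by move=> Ds t ht; apply: cont_slice; exact: jPhi'.
have Z t : 0 <= t <= 1 -> cint (Phi' (mkC t 0)) = 0.
  move=> ht; have Ds := D01 t ht; set s : C := mkC t 0 in Ds *.
  (* The antiderivative argument divides by [k * s]; at s = 0 the integrand is a constant times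
     [dcirc], of integral 0. *)
  have [s0|s0] := eqVneq s 0.
    rewrite -[RHS](mulr0 ('D_1 f w : C)) -cint_dcirc -(cintZ _ cont01_dcirc).
    by apply: eq_cint => u _; rewrite /Phi' s0 mul0r addr0.
  apply: (mulfI (mulf_neq0 k_neq0 s0)); rewrite mulr0 -(cintZ _ (cPhi' _ Ds)).
  pose cC (T : C) := a + mkC r 0 * cexp (k * T).
  pose p (T : C) : C := (k * s) * ('D_1 f (w + s * (cC T - w)) * (mkC r 0 * cexp (k * T))).
  transitivity (f (w + s * (cC 1 - w)) - f (w + s * (cC 0 - w))); last first.
    by rewrite /cC mulr1 mulr0 cexpk cexp0 subrr.
  apply: (@cint_FTC _ (fun T => f (w + s * (cC T - w))) p).
    exact: (cont01M (@cont01_cst _ (k * s)) (cPhi' _ Ds)).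
  move=> u hu; have [df _] := hf' _ (inb s u Ds).
  have d0 := is_deriveC_add (is_derive_cst (a - w) (mkC u 0 : C) (1 : C)) (is_derive_dcirc (mkC u 0)).
  have d1 := is_deriveC_add (is_derive_cst w (mkC u 0 : C) (1 : C)) (is_deriveC_mul (is_derive_cst s (mkC u 0 : C) (1 : C)) d0).
  have d1' : is_derive (mkC u 0 : C) 1 (fun T => w + s * (cC T - w)) (s * (k * (mkC r 0 * cexp (k * mkC u 0)))).
    apply: (is_deriveC_eq d1) => [T|]; first by rewrite /cC /=; ring.
    by rewrite mul0r !add0r.
  apply: (is_deriveC_eq (is_deriveC_comp d1' df)) => //.
  by rewrite /p /cC; ring.
have E : cint (Phi 1) = cint (Phi 0).
  apply: (@segment_const _ (fun s => cint (Phi s)) 0 1) => t ht.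
  rewrite add0r subr0 mulr1.
  by have [d _] := H _ (D01 t ht); apply: (is_deriveC_eq d) => //; exact: Z.
have -> : cint (fun t => f (circ t) * dcirc t / (circ t - w)) = cint (Phi 1).
  by apply: eq_cint => t _; rewrite /Phi mul1r [w + _]addrC subrK mulrA.
have ck : cont01 (fun t => dcirc t / (circ t - w)).
  move=> t ht; apply: (@cont_slice _ (fun _ t => dcirc t / (circ t - w)) 0 t).
  apply: (@jc_t _ (fun t => dcirc t / (circ t - w))).
  have c1 := @continuous_circ t; have c2 := @continuous_dcirc t.
  have c3 := @jc_cst R _ w t.
  exact: (cvgM c2 (cvgV (circ_neq t wr) (cvgB c1 c3))).
rewrite E -[LHS]mulr1 -(cauchy_kernel1 wr) -(cintZ _ ck).
by apply: eq_cint => t _; rewrite /Phi mul0r addr0.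
Qed.

End CauchyFormula.

(** * Orders of vanishing and the identity theorem *)

Section Factorization.
Variable R : realType.
Local Notation C := (Cx R).
Implicit Types (z w a : C) (t r : R) (f g : C -> C) (D : set C).

Definition hol D f := forall z, D z -> holat f z.

Lemma open_ballP D a : open D -> D a ->
  exists2 r : R, 0 < r & forall w, cabs (w - a) < r -> D w.
Proof. by move=> oD Da; apply/nbhsCP; exact: open_nbhs_nbhs. Qed.

Lemma cont01_circ f a r rho : 0 < r -> r < rho ->
  (forall z, cabs (z - a) < rho -> holat f z) -> cont01 (fun t => f (circ a r t)).
Proof.
move=> r0 rrho hf t _; apply: jc_comp; first exact: continuous_circ.
by apply/holat_continuous/hf; rewrite /circ addrC addKr cabs_dcirc.
Qed.

(** As 1 / (c - w) - 1 / (c - a) = (w - a) / ((c - w) (c - a)), Cauchy's formulas for f(w) and f(a)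
    = 0 exhibit the quotient near [a] as a Cauchy integral, holomorphic even at [a]. Elsewhere it is
    defined by division, so the factorization holds on the whole plane. *)
Lemma hol_factor D f a : open D -> D a -> hol D f -> f a = 0 ->
  exists2 q, hol D q & forall z, f z = (z - a) * q z.
Proof.
move=> oD Da hf fa; have [rho rho0 hD] := open_ballP oD Da.
pose r := rho / 2.
have r0 : 0 < r by rewrite divr_gt0.
have rrho : r < rho by rewrite /r ltr_pdivrMr // mulr_natr mulr2n ltrDl.
have hfb z : cabs (z - a) < rho -> holat f z by move=> /hD /hf.
have car : cabs (a - a) < r by rewrite subrr cabs0.
pose psi t := f (circ a r t) * dcirc r t / (circ a r t - a).
have cpsi : cont01 psi.
  move=> t ht; apply: jcM; first apply: jcM.
  - exact: (cont01_circ r0 rrho hfb).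
  - exact: continuous_dcirc.
  - apply: jcV; first exact: circ_neq.
    by apply: jcD; [exact: continuous_circ | exact: jc_cst].
pose q0 w := cint (fun t => psi t / (circ a r t - w)).
have fq w : cabs (w - a) < r -> f w = (w - a) * q0 w.
  move=> wr.
  have E u : cabs (u - a) < r -> f u = cint (fun t => f (circ a r t) * dcirc r t / (circ a r t - u)).
    exact: (cauchy_formula r0 rrho hfb).
  have cE u : cabs (u - a) < r -> cont01 (fun t => f (circ a r t) * dcirc r t / (circ a r t - u)).
    move=> ur t ht; apply: jcM; first apply: jcM.
    - exact: (cont01_circ r0 rrho hfb).
    - exact: continuous_dcirc.
    - apply: jcV; first exact: circ_neq.
      by apply: jcD; [exact: continuous_circ | exact: jc_cst].
  have cq : cont01 (fun t => psi t / (circ a r t - w)).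
    move=> t ht; apply: jcM; first exact: cpsi.
    apply: jcV; first exact: circ_neq.
    by apply: jcD; [exact: continuous_circ | exact: jc_cst].
  rewrite -[LHS]subr0 -fa (E w wr) (E a car) -(cintB (cE w wr) (cE a car)) -(cintZ _ cq).
  apply: eq_cint => t _; rewrite /psi.
  have n1 := circ_neq r0 t wr; have n2 := circ_neq r0 t car.
  move: n1 n2; move: (circ a r t) (dcirc r t) => c d n1 n2.
  by move: (f c) => F; field; rewrite n1 n2.
pose q z := if cabs (z - a) < r then q0 z else f z / (z - a).
exists q => [z Dz|z]; last first.
  rewrite /q; case: ifPn => [|zr]; first exact: fq.
  by rewrite mulrC divfK //; apply: contraNneq zr => ->; rewrite cabs0.
have [->|za] := eqVneq z a.
  have [_ h] := cauchy_kernel_derive r0 cpsi car.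
  apply: holat_eq h; apply/nbhsCP; exists r => // w wr.
  by rewrite /q wr.
have n0 : z - a != 0 by rewrite subr_eq0.
have h : holat (fun z => f z / (z - a)) z.
  apply: holat_div => //; first exact: hf.
  by apply: holatB; [exact: holat_id | exact: holat_cst].
apply: holat_eq h; apply/nbhsCP; exists (cabs (z - a)); first by rewrite cabs_gt0.
move=> w wz; have wa : w - a != 0.
  apply: contraTneq wz => /eqP; rewrite subr_eq0 => /eqP ->.
  by rewrite cabs_distC ltxx.
by rewrite /q; case: ifPn => // wr; rewrite fq // mulrAC mulfV // mul1r.
Qed.

Lemma circ_bound f a r rho : 0 < r -> r < rho ->
  (forall z, cabs (z - a) < rho -> holat f z) ->
  exists2 M : R, 0 <= M & forall t, 0 <= t <= 1 -> cabs (f (circ a r t)) <= M.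
Proof.
move=> r0 rrho hf; have cf := cont01_circ r0 rrho hf.
have [|c _ hc] := @EVT_max R (fun t => cabs (f (circ a r t))) 0 1 ler01.
  apply: continuous_in_subspaceT => t /[!inE]/= /[!in_itv]/= /cf ct.
  apply: (@continuous_comp _ _ _ (fun t => f (circ a r t)) (@cabs R) t ct).
  exact: continuous_cabs.
exists (cabs (f (circ a r c))); first exact: cabs_ge0.
by move=> t ht; apply: hc; rewrite in_itv.
Qed.

Lemma cauchy_bound f a w r rho M : 0 < r -> r < rho ->
  (forall z, cabs (z - a) < rho -> holat f z) -> cabs (w - a) < r ->
  (forall t, 0 <= t <= 1 -> cabs (f (circ a r t)) <= M) ->
  cabs (f w) <= 2 * (M * r / (r - cabs (w - a))).
Proof.
move=> r0 rrho hf wr hM; rewrite (cauchy_formula r0 rrho hf wr).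
have p0 : 0 < r - cabs (w - a) by rewrite subr_gt0.
have M0 : 0 <= M.
  by apply: le_trans (cabs_ge0 _) (hM 0 _); rewrite lexx ler01.
apply: cint_bound.
  move=> t ht; apply: jcM; first apply: jcM.
  - exact: (cont01_circ r0 rrho hf).
  - exact: continuous_dcirc.
  - apply: jcV; first exact: circ_neq.
    by apply: jcD; [exact: continuous_circ | exact: jc_cst].
move=> t ht; rewrite cabsM (cabsM (f _)) cabs_dcirc // cabsV.
apply: ler_pM; rewrite ?mulr_ge0 ?invr_ge0 ?cabs_ge0 ?(ltW r0) //.
  by rewrite ler_wpM2r ?(ltW r0) // hM.
rewrite lef_pV2 ?posrE //; first exact: circ_gap.
by rewrite cabs_gt0 circ_neq.
Qed.

Lemma le_geometric0 (y K x : R) : 0 <= x < 1 -> (forall n, y <= K * x ^+ n) -> y <= 0.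
Proof.
move=> /andP[x0 x1] h; apply/ler_addgt0Pr => e e0; rewrite add0r.
have c : (fun n => K * x ^+ n) @ \oo --> K * 0.
  by apply: cvgMr; apply: cvg_expr; rewrite ger0_norm.
move/cvgrPdist_lt : c => /(_ _ e0) [n _ /(_ n (leqnn n))] /=.
rewrite mulr0 sub0r normrN => hn.
by rewrite (le_trans (h n)) // (le_trans (ler_norm _)) // ltW.
Qed.

(** On the circle of radius r the n-th quotient is at most M / r^n, so Cauchy's bound gives |f w| <=
    K (|w - a| / r)^n for every n, with |w - a| < r. *)
Lemma infinite_order0 f a rho : 0 < rho ->
  (forall n, exists2 q, (forall z, cabs (z - a) < rho -> holat q z) &
     forall z, cabs (z - a) < rho -> f z = (z - a) ^+ n * q z) ->
  forall w, cabs (w - a) < rho / 2 -> f w = 0.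
Proof.
move=> rho0 hq w wr; pose r := rho / 2.
have r0 : 0 < r by rewrite divr_gt0.
have rrho : r < rho by rewrite /r ltr_pdivrMr // mulr_natr mulr2n ltrDl.
have hf z : cabs (z - a) < rho -> holat f z.
  move=> za; have [q hq0 Eq] := hq 0%N; apply: holat_eq (hq0 z za).
  have : nbhs z [set z : C | cabs (z - a) < rho].
    by apply: open_nbhs_nbhs; split => //; exact: open_cball.
  by apply: filterS => v /Eq ->; rewrite expr0 mul1r.
have [M M0 hM] := circ_bound r0 rrho hf.
apply/eqP; rewrite -cabs_eq0 eq_le cabs_ge0 andbT.
pose K := 2 * (M * r / (r - cabs (w - a))).
apply: (@le_geometric0 _ K (cabs (w - a) / r)).
  by rewrite divr_ge0 ?cabs_ge0 ?(ltW r0) // ltr_pdivrMr // mul1r.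
move=> n; have [q hqn Eq] := hq n.
have cr t : cabs (circ a r t - a) = r by rewrite /circ addrC addKr cabs_dcirc.
have hMq t : 0 <= t <= 1 -> cabs (q (circ a r t)) <= M / r ^+ n.
  move=> ht; rewrite ler_pdivlMr ?exprn_gt0 // (le_trans _ (hM t ht)) //.
  by rewrite Eq ?cr // cabsM cabsX cr mulrC.
have := cauchy_bound r0 rrho hqn wr hMq.
rewrite Eq ?(lt_trans wr) // cabsM cabsX => h.
rewrite (le_trans (ler_wpM2l (exprn_ge0 _ (cabs_ge0 _)) h)) //.
rewrite /K le_eqVlt; apply/orP; left; apply/eqP.
rewrite [in RHS]exprMn exprVn.
by move: (cabs (w - a) ^+ n) (r ^+ n) (r - cabs (w - a)) => X Y Z; ring.
Qed.

(** The order of a family as a whole: a factor z - a is removed as long as all members vanish at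
    [a]. Either this stops with some member nonzero there, or every member vanishes to infinite
    order. *)
Lemma order_dichotomy (I : Type) (f : I -> C -> C) D a : open D -> D a ->
  (forall i, hol D (f i)) ->
  (exists2 r : R, 0 < r & forall i w, cabs (w - a) < r -> f i w = 0) \/
  (exists n (q : I -> C -> C), [/\ forall i, hol D (q i),
     forall i z, f i z = (z - a) ^+ n * q i z & exists i, q i a != 0]).
Proof.
move=> oD Da hf; have [rho rho0 hD] := open_ballP oD Da.
have [h|h] := pselect (exists n (q : I -> C -> C), [/\ forall i, hol D (q i),
     forall i z, f i z = (z - a) ^+ n * q i z & exists i, q i a != 0]); [by right | left].
exists (rho / 2); first by rewrite divr_gt0.
have H n : exists2 q : I -> C -> C, forall i, hol D (q i) &
    forall i z, f i z = (z - a) ^+ n * q i z.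
  elim: n => [|n [q hq Eq]].
    by exists f => // i z; rewrite expr0 mul1r.
  have q0 i : q i a = 0.
    apply/eqP/negP => /negP qi; apply: h; exists n, q; split => //.
    by exists i.
  have /choice[q' hq'] : forall i, exists q', hol D q' /\ forall z, q i z = (z - a) * q' z.
    by move=> i; have [q' ? ?] := hol_factor oD Da (hq i) (q0 i); exists q'.
  exists q' => [i|i z]; first by have [] := hq' i.
  by rewrite Eq exprSr -mulrA; have [_ <-] := hq' i.
move=> i; apply: infinite_order0 => // n; have [q hq Eq] := H n.
by exists (q i) => z /hD; [exact: hq | rewrite Eq].
Qed.

Definition convexC D := forall z w t, D z -> D w -> 0 <= t <= 1 ->
  D (z + mkC t 0 * (w - z)).

(** Let T be the supremum of the parameters up to which [f] vanishes on the segment from [a] to [z].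
    At the point of parameter T, infinite order lets T be exceeded or shows T = 1; finite order
    contradicts the vanishing just before T. *)
Lemma identity_theorem f D a r : open D -> convexC D -> hol D f -> D a ->
  0 < r -> (forall w, cabs (w - a) < r -> f w = 0) ->
  forall z, D z -> f z = 0.
Proof.
move=> oD cD hf Da r0 fa z Dz.
pose x t := a + mkC t 0 * (z - a).
have Dx t : 0 <= t <= 1 -> D (x t) by exact: cD.
pose A := [set t : R | 0 <= t <= 1 /\ forall s, 0 <= s <= t -> f (x s) = 0].
pose L := cabs (z - a) + 1.
have L0 : 0 < L by rewrite ltr_wpDl ?cabs_ge0.
have dx s t : cabs (x s - x t) <= `|s - t| * L.
  have -> : x s - x t = mkC (s - t) 0 * (z - a).
    by rewrite /x; apply: cxP; rewrite !reimE; ring.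
  by rewrite cabsM cabs_real ler_wpM2l // lerDl.
have A0 : A 0.
  split=> [|s]; first by rewrite lexx ler01.
  rewrite -eq_le => /eqP <-; apply: fa.
  by rewrite /x addrC addKr cabsM cabs_real normr0 mul0r.
have supA : has_sup A.
  by split; [exists 0 | exists 1 => t [/andP[]]].
pose T := sup A.
have T0 : 0 <= T by apply: ub_le_sup => //; case: supA.
have T1 : T <= 1 by apply: ge_sup; [exists 0 | move=> t [/andP[]]].
have DxT : D (x T) by apply: Dx; rewrite T0.
have below s : 0 <= s -> s < T -> f (x s) = 0.
  move=> s0 sT; have Ts0 : 0 < T - s by rewrite subr_gt0.
  have [t [ht h] st] := sup_adherent Ts0 supA.
  by apply: h; rewrite s0 ltW //; move: st; rewrite -/T; lra.
have [->|za] := eqVneq z a; first by apply: fa; rewrite subrr cabs0.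
have Tgt0 : 0 < T.
  pose t0 := Num.min 1 (r / (2 * L)).
  have t00 : 0 < t0 by rewrite lt_min ltr01 divr_gt0 // mulr_gt0.
  apply: (lt_le_trans t00); apply: ub_le_sup; first by case: supA.
  split; first by rewrite (ltW t00) ge_min lexx.
  move=> s /andP[s0 st]; apply: fa.
  have xa : x 0 = a by rewrite /x mul0r addr0.
  rewrite -xa (le_lt_trans (dx s 0)) // subr0 ger0_norm //.
  have : s <= r / (2 * L) by rewrite (le_trans st) // ge_min lexx orbT.
  by rewrite ler_pdivlMr ?mulr_gt0 // => h; lra.
have [[d d0 hd]|[n [q [hq Eq [[] qT]]]]] := @order_dichotomy unit (fun=> f) D (x T) oD DxT (fun=> hf).
  have E1 s : `|s - T| < d / L -> f (x s) = 0.
    move=> sT; apply: (hd tt); rewrite (le_lt_trans (dx s T)) //.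
    by rewrite -ltr_pdivlMr.
  have [T1'|] := ltP T 1; last first.
    move=> T1'; have ET : T = 1 by apply/eqP; rewrite eq_le T1 T1'.
    have -> : z = x T by rewrite ET /x mul1r addrC subrK.
    by apply: E1; rewrite subrr normr0 divr_gt0.
  pose T' := Num.min 1 (T + d / L / 2).
  have dL : 0 < d / L / 2 by rewrite !divr_gt0.
  have AT' : A T'.
    split; first by rewrite le_min ler01 ge_min lexx /= addr_ge0 // ltW.
    move=> s /andP[s0]; rewrite le_min => /andP[s1 sT'].
    have [sT|Ts] := ltP s T; first exact: below.
    apply: E1; rewrite ger0_norm ?subr_ge0 //.
    by rewrite ltrBlDl (le_lt_trans sT') // ltrD2l ltr_pdivrMr // mulr_natr mulr2n ltrDl divr_gt0.
  have : T' <= T by apply: ub_le_sup => //; case: supA.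
  by rewrite ge_min leNgt T1' /= gerDl leNgt dL.
have cq := holat_continuous (hq tt _ DxT).
have aq : 0 < cabs (q tt (x T)) by rewrite cabs_gt0.
move/(@cvgCP _ _ (nbhs (x T)) _): cq => /(_ _ aq) /nbhsCP[d d0 hd].
(* A parameter just before T: [f] vanishes there, whereas the quotient [q] is still nonzero, being
   close to its value at T. *)
pose s := Num.max 0 (T - d / L / 2).
have dL : 0 < d / L / 2 by rewrite !divr_gt0.
have sT : s < T by rewrite gt_max Tgt0 gtrBl.
have fs : f (x s) = 0 by apply: below => //; rewrite le_max lexx.
have xs : cabs (x s - x T) < d.
  rewrite (le_lt_trans (dx s T)) // -ltr_pdivlMr //.
  rewrite ltr0_norm ?subr_lt0 // opprB ltrBlDl -ltrBlDr.
  by rewrite lt_max; apply/orP; right; rewrite ltrD2l ltrN2 ltr_pdivrMr // mulr_natr mulr2n ltrDl divr_gt0.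
have := hd _ xs; suff -> : q tt (x s) = 0 by rewrite sub0r cabsN ltxx.
have := Eq tt (x s); rewrite fs => /esym/eqP; rewrite mulf_eq0 => /orP[|/eqP //].
rewrite expf_eq0 => /andP[_]; rewrite subr_eq0 => /eqP E.
have : mkC (s - T) 0 * (z - a) = 0.
  transitivity (x s - x T); last by rewrite E subrr.
  by rewrite /x; apply: cxP; rewrite !reimE; ring.
move/eqP; rewrite mulf_eq0 subr_eq0 (negPf za) orbF => /eqP /(congr1 (@re R)) /=.
by move/eqP; rewrite subr_eq0 (lt_eqF sT).
Qed.

End Factorization.

(** * Solutions of the equation exp (e) = g0 + G *)

Section Solutions.
Variable R : realType.
Local Notation C := (Cx R).
Implicit Types (z w c : C) (t r : R) (D : set C) (W s : 'I_3 -> C -> C) (e : 'I_3 -> C).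

(** Identities proved off a point, where one may divide, are carried over to that point by
    continuity. *)
Lemma cont_zero (f : C -> C) y r : 0 < r -> {for y, continuous f} ->
  (forall w, w != y -> cabs (w - y) < r -> f w = 0) -> f y = 0.
Proof.
move=> r0 cf f0; apply/eqP; rewrite -cabs_eq0 -[_ == 0]negbK; apply/negP => n0.
have fy0 : 0 < cabs (f y) by rewrite lt_def n0 cabs_ge0.
move/(@cvgCP _ _ (nbhs y) _): cf => /(_ _ fy0) /nbhsCP[d d0 hd].
pose m := Num.min r d / 2.
have m0 : 0 < m by rewrite divr_gt0 // lt_min r0.
have E : cabs (y + mkC m 0 - y) = m by rewrite addrC addKr cabs_real gtr0_norm.
have mlt : m < Num.min r d by rewrite /m ltr_pdivrMr // mulr_natr mulr2n ltrDl lt_min r0.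
have := mlt; rewrite lt_min => /andP[mr md].
have := hd (y + mkC m 0); rewrite E => /(_ md); rewrite f0 ?E //.
  by rewrite sub0r cabsN ltxx.
by rewrite -subr_eq0 -cabs_eq0 E gt_eqF.
Qed.

(** Bilinear, without conjugation, so that nonzero isotropic vectors exist; in the complexified
    quaternions a vector x has square - x.x. *)
Definition cdot (x y : 'I_3 -> C) : C := \sum_i x i * y i.
Definition ccos z : C := (cexp (iC R * z) + cexp (- (iC R * z))) / 2.
Definition csin z : C := (cexp (iC R * z) - cexp (- (iC R * z))) / (iC R + iC R).

Lemma iC_neq0 : iC R != 0.
Proof. by rewrite -cabs_gt0 /cabs /= expr0n add0r expr1n sqrtr1. Qed.

Lemma two_neq0 : 2 != 0 :> C.
Proof. by rewrite pnatr_eq0. Qed.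

Lemma iCC_neq0 : iC R + iC R != 0.
Proof. by rewrite -mulr2n -mulr_natl mulf_neq0 ?iC_neq0 ?two_neq0. Qed.

Lemma cexp_cos_sin z : cexp (iC R * z) = ccos z + iC R * csin z.
Proof.
rewrite /ccos /csin; move: (cexp (iC R * z)) (cexp _) iCC_neq0 => a b h.
by field.
Qed.

Lemma ccosN z : ccos (- z) = ccos z.
Proof. by rewrite /ccos mulrN opprK addrC. Qed.
Lemma csinN z : csin (- z) = - csin z.
Proof. by rewrite /csin mulrN opprK -[RHS]mulNr opprB. Qed.

Lemma cexp_i2pi (n : int) z :
  cexp (iC R * (z + mkC (pi *+ 2 * n%:~R) 0)) = cexp (iC R * z).
Proof.
rewrite mulrDr cexpD.
have -> : iC R * mkC (pi *+ 2 * n%:~R) 0 = mkC 0 (pi *+ 2 * n%:~R).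
  by apply: cxP; rewrite !reimE; ring.
by rewrite cexp_2pi mulr1.
Qed.

Lemma ccos_2pi (n : int) z : ccos (z + mkC (pi *+ 2 * n%:~R) 0) = ccos z.
Proof. by rewrite /ccos !cexpN cexp_i2pi. Qed.
Lemma csin_2pi (n : int) z : csin (z + mkC (pi *+ 2 * n%:~R) 0) = csin z.
Proof. by rewrite /csin !cexpN cexp_i2pi. Qed.

Lemma cos_sin_inj z w : ccos z = ccos w -> csin z = csin w ->
  exists n : int, z = w + mkC (pi *+ 2 * n%:~R) 0.
Proof.
move=> hc hs; have : cexp (iC R * z) = cexp (iC R * w) by rewrite !cexp_cos_sin hc hs.
move=> /cexp_inj[n hn]; exists n; apply: (mulfI iC_neq0); rewrite hn mulrDr.
by congr (_ + _); apply: cxP; rewrite !reimE; ring.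
Qed.

Variables (g0 : C -> C) (G : 'I_3 -> C -> C).

(* [g0 + G = exp (mu W)] with [W] a square root of [-1] in the complexified quaternions. *)
Definition chart z r (mu : C -> C) W := 0 < r /\ forall y, cabs (y - z) < r ->
  [/\ holat mu y, forall l, holat (W l) y, ccos (mu y) = g0 y,
      forall l, G l y = csin (mu y) * W l y & cdot (W^~ y) (W^~ y) = 1].

(** Only the value at [z] of a local solution is retained, not its germ. Where the zeroes of [G] are
    isolated, two such values differ by a multiple of 2 pi W. *)
Definition sol z e := exists r mu W, chart z r mu W /\ forall l, e l = mu z * W l z.

Definition isol_zeros z := exists2 r, 0 < r &
  forall w, w != z -> cabs (w - z) < r -> exists l, G l w != 0.

Lemma chart_sub z r mu W y r' : chart z r mu W -> 0 < r' -> cabs (y - z) + r' <= r ->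
  chart y r' mu W.
Proof.
move=> [_ h] r0 hr; split => // x xy; apply: h.
have -> : x - z = (y - z) + (x - y) by ring.
by rewrite (le_lt_trans (cabsD _ _)) // (lt_le_trans _ hr) // ltrD2l.
Qed.

Lemma chart_shift z r mu W (n : int) : chart z r mu W ->
  chart z r (fun y => mu y + mkC (pi *+ 2 * n%:~R) 0) W.
Proof.
move=> [r0 h]; split => // y /h[h1 h2 h3 h4 h5]; split => //.
- by apply: holatD => //; exact: holat_cst.
- by rewrite ccos_2pi.
- by move=> l; rewrite csin_2pi.
Qed.

Lemma cdotC x y : cdot x y = cdot y x.
Proof. by apply: eq_bigr => i _; rewrite mulrC. Qed.

Lemma cdotZ (a : C) x y : cdot (fun i => a * x i) y = a * cdot x y.
Proof. by rewrite /cdot mulr_sumr; apply: eq_bigr => i _; rewrite mulrA. Qed.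

(** Off [y] the vector [G] is nonzero and G.G is the square of both sines, so W' = W or W' = - W.
    The products (W' - W)_l (W' + W)_l' vanish in either case, hence also at [y] by continuity,
    which gives one sign for all components. The sines are then recovered as G.W and G.W', and mu'
    is congruent to mu or - mu modulo 2 pi. *)
Lemma chart_compat z r mu W z' r' mu' W' y : chart z r mu W -> chart z' r' mu' W' ->
  cabs (y - z) < r -> cabs (y - z') < r' -> isol_zeros y ->
  exists n : int, forall l, mu' y * W' l y = (mu y + mkC (pi *+ 2 * n%:~R) 0) * W l y.
Proof.
move=> ch ch' yz yz' [d d0 hd].
have [r0 h] := ch; have [r0' h'] := ch'.
have sgn : (forall l, W' l y = W l y) \/ (forall l, W' l y = - W l y).
  have prod l l' : (W' l y - W l y) * (W' l' y + W l' y) = 0.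
    pose m := Num.min d (Num.min (r - cabs (y - z)) (r' - cabs (y - z'))).
    have m0 : 0 < m by rewrite !lt_min d0 !subr_gt0 yz.
    apply: (@cont_zero (fun y => (W' l y - W l y) * (W' l' y + W l' y)) y m m0).
      have [_ hW _ _ _] := h y yz; have [_ hW' _ _ _] := h' y yz'.
      by apply: holat_continuous; apply: holatM; [apply: holatB | apply: holatD].
    move=> w wy; rewrite !lt_min => /and3P[wd wz wz'].
    have {}wz : cabs (w - z) < r.
      have -> : w - z = (w - y) + (y - z) by ring.
      by rewrite (le_lt_trans (cabsD _ _)) // -ltrBrDr.
    have {}wz' : cabs (w - z') < r'.
      have -> : w - z' = (w - y) + (y - z') by ring.
      by rewrite (le_lt_trans (cabsD _ _)) // -ltrBrDr.
    have [_ _ _ hG h1] := h w wz; have [_ _ _ hG' h1'] := h' w wz'.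
    have [j Gj] := hd w wy wd.
    have s2 : csin (mu w) ^+ 2 = csin (mu' w) ^+ 2.
      transitivity (cdot (G^~ w) (G^~ w)).
        under [in RHS]eq_fun do rewrite hG.
        by rewrite cdotZ cdotC cdotZ h1 mulr1 expr2.
      under [in LHS]eq_fun do rewrite hG'.
      by rewrite cdotZ cdotC cdotZ h1' mulr1 expr2.
    have s0 : csin (mu w) != 0.
      by apply: contraNneq Gj => e; rewrite hG e mul0r.
    move/eqP: s2; rewrite eqf_sqr => /orP[/eqP e|/eqP e].
      have -> : W' l w = W l w by apply: (mulfI s0); rewrite -hG {1}e -hG'.
      by rewrite subrr mul0r.
    have -> : W' l' w = - W l' w.
      by apply: (mulfI s0); rewrite mulrN -hG {1}e mulNr -hG'.
    by rewrite addNr mulr0.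
  have [|/existsNP[l /eqP nl]] := pselect (forall l, W' l y = W l y); first by left.
  right=> l'; move/eqP: (prod l l'); rewrite mulf_eq0 subr_eq0 (negPf nl) /=.
  by rewrite addr_eq0 => /eqP.
have [_ _ hc hG h1] := h y yz; have [_ _ hc' hG' h1'] := h' y yz'.
have dotG : cdot (G^~ y) (W^~ y) = csin (mu y).
  by under eq_fun do rewrite hG; rewrite cdotZ h1 mulr1.
have dotG' : cdot (G^~ y) (W'^~ y) = csin (mu' y).
  by under eq_fun do rewrite hG'; rewrite cdotZ h1' mulr1.
case: sgn => e.
  have E : W'^~ y = W^~ y by apply/funext.
  have [n hn] : exists n : int, mu' y = mu y + mkC (pi *+ 2 * n%:~R) 0.
    by apply: cos_sin_inj; rewrite ?hc ?hc' // -dotG -dotG' E.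
  by exists n => l; rewrite hn e.
have [n hn] : exists n : int, - mu' y = mu y + mkC (pi *+ 2 * n%:~R) 0.
  apply: cos_sin_inj; rewrite ?ccosN ?csinN ?hc ?hc' // -dotG -dotG'.
  have -> : W'^~ y = fun l => (-1) * W l y by apply/funext => l; rewrite e mulN1r.
  by rewrite [in LHS]cdotC cdotZ mulN1r opprK cdotC.
by exists n => l; rewrite -hn e mulrN mulNr.
Qed.

Lemma sol_diff z e e' : isol_zeros z -> sol z e -> sol z e' ->
  exists2 n : int, cdot (fun l => e l - e' l) (fun l => e l - e' l) =
     mkC ((pi *+ 2 * n%:~R) ^+ 2) 0 & (n = 0 -> e = e').
Proof.
move=> iz [r [mu [W [ch E]]]] [r' [mu' [W' [ch' E']]]].
have [r0 h] := ch; have [r0' h'] := ch'.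
have zz : cabs (z - z) < r by rewrite subrr cabs0.
have zz' : cabs (z - z) < r' by rewrite subrr cabs0.
have [n hn] := chart_compat ch ch' zz zz' iz.
have [_ _ _ _ h1] := h z zz.
exists n.
  have F l : e l - e' l = - mkC (pi *+ 2 * n%:~R) 0 * W l z.
    by rewrite E E' hn; ring.
  under eq_fun do rewrite F.
  rewrite cdotZ cdotC cdotZ h1 mulr1 mulrNN.
  by apply: cxP; rewrite !reimE; ring.
move=> n0; apply/funext => l; rewrite E E' hn n0 mulr0.
by rewrite (_ : mkC 0 0 = 0) // addr0.
Qed.

Definition secn (N : set C) s := forall x, N x ->
  (forall l, holat (s l) x) /\ sol x (s^~ x).

(** A value at one point selects one of the determinations mu + 2 pi n, and this determination lives
    on the whole disc of the chart. *)
Lemma sol_ext z r mu W y e : chart z r mu W -> cabs (y - z) < r -> isol_zeros y ->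
  sol y e -> exists2 s, secn [set x | cabs (x - z) < r] s & s^~ y = e.
Proof.
move=> ch yz iy [r' [mu' [W' [ch' E]]]].
have [r0' _] := ch'.
have yy : cabs (y - y) < r' by rewrite subrr cabs0.
have [n hn] := chart_compat ch ch' yz yy iy.
exists (fun l x => (mu x + mkC (pi *+ 2 * n%:~R) 0) * W l x); last first.
  by apply/funext => l; rewrite E hn.
move=> x /= xz; have [_ h] := ch; have [h1 h2 _ _ _] := h x xz; split.
  by move=> l; apply: holatM => //; apply: holatD => //; exact: holat_cst.
exists (r - cabs (x - z)), (fun x => mu x + mkC (pi *+ 2 * n%:~R) 0), W; split; last by [].
apply: (chart_sub (chart_shift n ch)); first by rewrite subr_gt0.
by rewrite addrC subrK.
Qed.

Definition seg z w t : C := z + mkC t 0 * (w - z).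

Lemma continuous_seg z w : continuous (seg z w).
Proof.
move=> t; suff : {for t, continuous (fun t => z + mkC t 0 * (w - z))} by [].
apply: jcD; first exact: jc_cst.
apply: jcM; last exact: jc_cst.
apply/(@cvg_reim _ _ (nbhs t)); split; last exact: (@cvg_cst _ _ _ (nbhs t)).
exact: (@cvg_id _ (nbhs t)).
Qed.

Lemma seg0 z w : seg z w 0 = z.
Proof. by rewrite /seg mul0r addr0. Qed.
Lemma seg1 z w : seg z w 1 = w.
Proof. by rewrite /seg mul1r addrC subrK. Qed.

(* The bilinear square of the difference of two solutions is [(2 pi n)^2], so it
   cannot leave [0] continuously. *)
Lemma secn_unique s s' x y : (forall t, 0 <= t <= 1 -> isol_zeros (seg x y t)) ->
  secn (seg x y @` `[0, 1]) s -> secn (seg x y @` `[0, 1]) s' ->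
  s^~ x = s'^~ x -> s^~ y = s'^~ y.
Proof.
move=> iA hs hs' sx.
have img t : 0 <= t <= 1 -> (seg x y @` `[0, 1]) (seg x y t).
  by move=> ht; exists t => //=; rewrite in_itv.
pose d v := cdot (fun l => s l v - s' l v) (fun l => s l v - s' l v).
pose q t := re (d (seg x y t)).
have cq t : 0 <= t <= 1 -> {for t, continuous q}.
  move=> /img st; have [h1 _] := hs _ st; have [h2 _] := hs' _ st.
  have hd : holat d (seg x y t).
    have -> : d = fun v => (s 0 v - s' 0 v) * (s 0 v - s' 0 v) +
      ((s 1 v - s' 1 v) * (s 1 v - s' 1 v) + (s 2 v - s' 2 v) * (s 2 v - s' 2 v)).
      apply/funext => v; rewrite /d /cdot !big_ord_recl big_ord0 addr0.
      by congr (_ + (_ + _)); congr ((s _ v - s' _ v) * (s _ v - s' _ v)); apply/val_inj.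
    by apply: holatD; [|apply: holatD]; apply: holatM; apply: holatB.
  have c1 : {for t, continuous (fun t => d (seg x y t))}.
    by apply: jc_comp; [exact: continuous_seg | exact: holat_continuous].
  exact: (@continuous_comp _ _ _ (fun t => d (seg x y t)) (@re R) t c1 (@continuous_re R _)).
(* For n nonzero, (2 pi n)^2 >= (2 pi)^2 > 1; hence 1 is a value that [q] never takes, against the
   intermediate value theorem if q 1 > 1. *)
have vals t : 0 <= t <= 1 -> q t = 0 /\ s^~ (seg x y t) = s'^~ (seg x y t) \/ 1 < q t.
  move=> ht; have st := img t ht; have [_ h1] := hs _ st; have [_ h2] := hs' _ st.
  have [n E En] := sol_diff (iA t ht) h1 h2.
  have [n0|n0] := eqVneq n 0.
    left; split; last exact: En.
    by rewrite /q /d E n0 mulr0 expr0n.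
  right; rewrite /q /d E /= exprMn.
  have p1 : 1 < (pi *+ 2 : R) ^+ 2.
    rewrite exprn_egt1 // mulr2n; have := @pi_ge2 R; lra.
  apply: (lt_le_trans p1); rewrite ler_peMr ?sqr_ge0 //.
  rewrite -real_normK ?num_real // exprn_ege1 //.
  by rewrite -intr_norm ler1z -gtz0_ge1 normr_gt0.
have h0 : 0 <= (0 : R) <= (1 : R) by rewrite lexx ler01.
have h1 : 0 <= (1 : R) <= (1 : R) by rewrite lexx ler01.
case: (vals 1 h1) => [[_]|q1]; first by rewrite seg1.
have q0 : q 0 = 0.
  rewrite /q /d seg0 /cdot big1 ?re0 // => l _.
  by rewrite (congr1 (fun f => f l) sx) subrr mul0r.
have cw : {within `[0, 1], continuous q}.
  by apply: continuous_in_subspaceT => t /[!inE]/= /[!in_itv]/= /cq.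
have bw : Num.min (q 0) (q 1) <= 1 <= Num.max (q 0) (q 1).
  by rewrite q0 ge_min ler01 le_max (ltW q1) orbT.
have [t] := IVT ler01 cw bw.
move=> /[!in_itv]/= ht qt; case: (vals t ht) => [[e _]|].
  by move: qt; rewrite e => /eqP; rewrite eq_sym oner_eq0.
by rewrite qt ltxx.
Qed.

End Solutions.

(** * Continuation of solutions along a segment *)

Section Continuation.
Variable R : realType.
Local Notation C := (Cx R).
Implicit Types (x y z w c : C) (t r : R) (D N : set C) (s : 'I_3 -> C -> C) (e : 'I_3 -> C).
Variables (g0 : C -> C) (G : 'I_3 -> C -> C) (A : set C).
Hypothesis oA : open A.
Hypothesis chA : forall z, A z -> exists r mu W, chart g0 G z r mu W.
Hypothesis iA : forall z, A z -> isol_zeros G z.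

Local Notation sol := (sol g0 G).
Local Notation secn := (secn g0 G).

Lemma secn_sub N N' s : N' `<=` N -> secn N s -> secn N' s.
Proof. by move=> sN h x /sN /h. Qed.

Lemma secn_agree N s s' x y : N `<=` A -> (forall t, 0 <= t <= 1 -> N (seg x y t)) ->
  secn N s -> secn N s' -> s^~ x = s'^~ x -> s^~ y = s'^~ y.
Proof.
move=> NA sN hs hs'; apply: (@secn_unique _ g0 G).
- by move=> t /sN /NA /iA.
- by apply: secn_sub hs => v [t /=]; rewrite in_itv /= => /sN h <-.
- by apply: secn_sub hs' => v [t /=]; rewrite in_itv /= => /sN h <-.
Qed.

Lemma secn_eq N s s' : open N -> (forall x, N x -> s^~ x = s'^~ x) ->
  secn N s -> secn N s'.
Proof.
move=> oN E h x Nx; have [h1 h2] := h x Nx; split; last by rewrite -E.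
move=> l; apply: holat_eq (h1 l).
have : nbhs x N by apply: open_nbhs_nbhs.
by apply: filterS => v /E /(congr1 (fun f => f l)).
Qed.

Lemma secn_glue N N' s s' : open N -> open N' -> secn N s -> secn N' s' ->
  (forall x, N x -> N' x -> s^~ x = s'^~ x) ->
  exists2 u, secn (N `|` N') u & forall x, N x -> u^~ x = s^~ x.
Proof.
move=> oN oN' hs hs' E; pose u l x := if `[< N x >] then s l x else s' l x.
have uN x : N x -> u^~ x = s^~ x.
  by move=> Nx; apply/funext => l; rewrite /u; case: asboolP.
exists u => // x [Nx|Nx].
  by apply: (secn_eq oN _ hs Nx) => v /uN.
apply: (secn_eq oN' _ hs' Nx) => v Nv.
have [h|h] := pselect (N v); first by rewrite uN // E.
by apply/funext => l; rewrite /u; case: asboolP.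
Qed.

(** The r-neighbourhood of an initial piece of the segment. It is convex, so that two solutions
    agreeing at one point of its intersection with a disc agree on the whole intersection. *)
Definition tube r x y (T : R) : set C :=
  [set v | exists2 t, 0 <= t <= T & cabs (v - seg x y t) < r].

Lemma segB x y (s t : R) : seg x y s - seg x y t = mkC (s - t) 0 * (y - x).
Proof. by rewrite /seg; apply: cxP; rewrite !reimE; ring. Qed.

Lemma seg_dist x y (s t : R) : cabs (seg x y s - seg x y t) = `|s - t| * cabs (y - x).
Proof. by rewrite segB cabsM cabs_real. Qed.

Lemma open_tube r x y T : open (tube r x y T).
Proof.
rewrite openE => v [t ht vt]; have := @open_cball _ (seg x y t) r.
rewrite openE => /(_ v vt); rewrite /interior; apply: filterS => u ut.
by exists t.
Qed.

Lemma cabs_convex v v' p p' t r : 0 <= t <= 1 -> cabs (v - p) < r -> cabs (v' - p') < r ->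
  cabs (seg v v' t - seg p p' t) < r.
Proof.
move=> /andP[t0 t1] h h'.
have -> : seg v v' t - seg p p' t = mkC (1 - t) 0 * (v - p) + mkC t 0 * (v' - p').
  by rewrite /seg; apply: cxP; rewrite !reimE; ring.
rewrite (le_lt_trans (cabsD _ _)) // !cabsM !cabs_real !ger0_norm ?subr_ge0 //.
have [->|tN0] := eqVneq t 0; first by rewrite subr0 mul1r mul0r addr0.
have tp : 0 < t by rewrite lt_def tN0.
have a1 : t * cabs (v' - p') < t * r by rewrite ltr_pM2l.
have a2 : (1 - t) * cabs (v - p) <= (1 - t) * r by rewrite ler_wpM2l ?subr_ge0 // ltW.
by lra.
Qed.

Lemma tube_convex r x y T v v' t : tube r x y T v -> tube r x y T v' -> 0 <= t <= 1 ->
  tube r x y T (seg v v' t).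
Proof.
move=> [a /andP[a0 aT] va] [b /andP[b0 bT] vb] ht; exists ((1 - t) * a + t * b).
  case/andP: ht => t0 t1; rewrite addr_ge0 ?mulr_ge0 ?subr_ge0 //=.
  have a1 : t * b <= t * T by rewrite ler_wpM2l.
  have a2 : (1 - t) * a <= (1 - t) * T by rewrite ler_wpM2l ?subr_ge0.
  by lra.
have -> : seg x y ((1 - t) * a + t * b) = seg (seg x y a) (seg x y b) t.
  by rewrite /seg; apply: cxP; rewrite !reimE; ring.
exact: cabs_convex.
Qed.

Lemma cball_convex p r v v' t : cabs (v - p) < r -> cabs (v' - p) < r -> 0 <= t <= 1 ->
  cabs (seg v v' t - p) < r.
Proof.
move=> h h' ht; have -> : p = seg p p t by rewrite /seg subrr mulr0 addr0.
exact: cabs_convex.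
Qed.

(** Lebesgue's number lemma for the covering of the segment by chart discs: compactness gives one
    radius valid for all points. *)
Lemma lebesgue_chart x y : (forall t, 0 <= t <= 1 -> A (seg x y t)) ->
  exists2 d : R, 0 < d & forall t, 0 <= t <= 1 -> exists p r mu W,
    [/\ chart g0 G p r mu W, [set v | cabs (v - p) < r] `<=` A &
        forall v, cabs (v - seg x y t) < d -> cabs (v - p) < r].
Proof.
move=> sA; have /compact_near_coveringP nc := @segment_compact R 0 1.
pose P (d t : R) := exists p r mu W,
    [/\ chart g0 G p r mu W, [set v | cabs (v - p) < r] `<=` A &
        forall v, cabs (v - seg x y t) < d -> cabs (v - p) < r].
have H : \forall d \near 0^'+, [set` `[0, 1]] `<=` P d.
  refine (nc R (0^'+) P _ _) => t /=; rewrite in_itv /= => t01.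
  have At := sA t t01; have [r [mu [W ch]]] := chA At.
  have [r1 r10 hr1] := open_ballP oA At.
  have [r0 _] := ch; pose m := Num.min r r1.
  have m0 : 0 < m by rewrite lt_min r0.
  have m20 : 0 < m / 2 by rewrite divr_gt0.
  have ch' : chart g0 G (seg x y t) m mu W.
    by apply: (chart_sub ch m0); rewrite subrr cabs0 add0r ge_min lexx.
  have L0 : 0 < cabs (y - x) + 1 by rewrite ltr_wpDl ?cabs_ge0.
  exists ([set t' | `|t' - t| < m / 2 / (cabs (y - x) + 1)], [set d : R | d < m / 2]).
    split => /=.
      apply/nbhs_ballP; exists (m / 2 / (cabs (y - x) + 1)); first by rewrite /= divr_gt0.
      by move=> t'; rewrite /ball /= distrC.
    exact: nbhs_right_lt.
  move=> [t' d] /= [tt' dm]; exists (seg x y t), m, mu, W; split => //.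
    by move=> v; rewrite /= lt_min => /andP[_ /hr1].
  move=> v hv.
  have -> : v - seg x y t = (v - seg x y t') + (seg x y t' - seg x y t) by ring.
  rewrite (le_lt_trans (cabsD _ _)) // [m]splitr ltrD //; first exact: lt_trans dm.
  rewrite seg_dist; apply: (@le_lt_trans _ _ (`|t' - t| * (cabs (y - x) + 1))).
    by rewrite ler_wpM2l // lerDl.
  by rewrite -ltr_pdivlMr.
have [d /= d0 hd] := H.
exists (d / 2); first by rewrite divr_gt0.
move=> t ht; apply: (hd (d / 2)) => /=.
- by rewrite sub0r normrN ger0_norm ?divr_ge0 // ?(ltW d0) // ltr_pdivrMr // mulr_natr mulr2n ltrDl.
- by rewrite divr_gt0.
- by rewrite in_itv.
Qed.

(** The segment is cut into pieces shorter than half the Lebesgue number [d]. At each division point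
    the solution extends to a chart disc containing the next portion of the tube, and the radius, at
    most d / 2, stays the same throughout. *)
Lemma tube_section x y e : (forall t, 0 <= t <= 1 -> A (seg x y t)) -> sol x e ->
  exists r s, [/\ 0 < r, tube r x y 1 `<=` A, secn (tube r x y 1) s & s^~ x = e].
Proof.
move=> sA ex; have [d d0 hd] := lebesgue_chart sA.
pose L := cabs (y - x) + 1.
have L0 : 0 < L by rewrite ltr_wpDl ?cabs_ge0.
have [n hn] : exists n : nat, L / (d / 2) < n.+1%:R.
  have := archi_boundP (x := L / (d / 2)); rewrite divr_ge0 ?(ltW L0) ?(ltW d0) //; last first.
    by rewrite divr_ge0 // ltW.
  move=> /(_ isT) h; exists (Num.bound (L / (d / 2))).
  by rewrite (lt_trans h) // ltr_nat.
pose tau (k : nat) : R := k%:R / n.+1%:R.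
have n0 : 0 < n.+1%:R :> R by rewrite ltr0n.
have step k : tau k.+1 - tau k = n.+1%:R^-1.
  by rewrite /tau -mulrBl -natrB // subSnn mul1r.
have small : n.+1%:R^-1 * cabs (y - x) < d / 2.
  rewrite mulrC ltr_pdivrMr // mulrC -ltr_pdivrMr ?divr_gt0 //.
  by apply: lt_trans hn; rewrite ltr_pM2r ?invr_gt0 ?divr_gt0 // ltrDl.
have tau01 k : (k <= n.+1)%N -> 0 <= tau k <= 1.
  by move=> kn; rewrite /tau divr_ge0 ?ler0n ?(ltW n0) //= ler_pdivrMr // mul1r ler_nat.
suff H k : (k <= n.+1)%N -> exists r s,
    [/\ 0 < r, r <= d / 2, tube r x y (tau k) `<=` A, secn (tube r x y (tau k)) s & s^~ x = e].
  have [r [s [h1 _ h2 h3 h4]]] := H n.+1 (leqnn _).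
  by exists r, s; split => //; rewrite /tau divff ?gt_eqF in h2 h3 *.
elim: k => [_|k IH kn].
  have h0 : 0 <= (0 : R) <= (1 : R) by rewrite lexx ler01.
  have [p [r [mu [W [ch rA dr]]]]] := hd 0 h0.
  have xp : cabs (x - p) < r by apply: dr; rewrite seg0 subrr cabs0.
  have Ax : A x by rewrite -(seg0 x y); apply: sA.
  have [s hs sx] := sol_ext ch xp (iA Ax) ex.
  have sub : tube (d / 2) x y (tau 0) `<=` [set v | cabs (v - p) < r].
    move=> v [t]; rewrite /tau mul0r -eq_le => /eqP <- vt.
    apply: dr; apply: (lt_trans vt).
    by rewrite ltr_pdivrMr // mulr_natr mulr2n ltrDl.
  exists (d / 2), s; split => //; first by rewrite divr_gt0.
    exact: subset_trans sub rA.
  exact: secn_sub sub hs.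
have kn' := ltnW kn.
have [r [s [r0 rd tA hs sx]]] := IH kn'.
set xk := seg x y (tau k).
have /andP[tk0 tk1] := tau01 k kn'.
have txk : tube r x y (tau k) xk.
  by exists (tau k); rewrite ?tk0 ?lexx // subrr cabs0.
have [p [r' [mu [W [ch rA dr]]]]] := hd _ (tau01 k kn').
have xkp : cabs (xk - p) < r' by apply: dr; rewrite subrr cabs0.
have [_ solk] := hs _ txk.
have [s' hs' sx'] := sol_ext ch xkp (iA (tA _ txk)) solk.
pose B := [set v : C | cabs (v - p) < r'].
have oB : open B by exact: open_cball.
have agree v : tube r x y (tau k) v -> B v -> s^~ v = s'^~ v.
  move=> tv Bv; apply: (@secn_agree (tube r x y (tau k) `&` B) _ _ xk).
  - by move=> u [/tA].
  - by move=> t ht; split; [exact: tube_convex | exact: cball_convex].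
  - by apply: secn_sub hs => u [].
  - by apply: secn_sub hs' => u [].
  - by rewrite sx'.
have [u hu us] := secn_glue (@open_tube _ _ _ _) oB hs hs' agree.
(* A new point is within r <= d / 2 of some seg x y t with t past [tau k], itself within d / 2 of
   the division point; the chart disc contains all points at distance less than d. *)
have sub : tube r x y (tau k.+1) `<=` tube r x y (tau k) `|` B.
  move=> v [t /andP[t0 tk] vt].
  have [tle|tgt] := leP t (tau k); first by left; exists t => //; rewrite t0.
  right; apply: dr.
  have -> : v - seg x y (tau k) = (v - seg x y t) + (seg x y t - seg x y (tau k)) by ring.
  rewrite (le_lt_trans (cabsD _ _)) // [d]splitr ltrD //; first exact: lt_le_trans rd.
  rewrite seg_dist ger0_norm ?subr_ge0 ?(ltW tgt) //.
  apply: le_lt_trans small; rewrite ler_wpM2r ?cabs_ge0 // -(step k).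
  by rewrite lerD2r.
exists r, u; split => //.
- by apply: (subset_trans sub) => v [/tA|/rA].
- exact: secn_sub sub hu.
- rewrite us //; exists 0; first by rewrite lexx.
  by rewrite seg0 subrr cabs0.
Qed.

End Continuation.

(** * Extension of a solution from a star-shaped set to a convex domain *)

Section StarExtension.
Variable R : realType.
Local Notation C := (Cx R).
Implicit Types (x y z w : C) (t r : R) (N : set C) (s : 'I_3 -> C -> C) (e : 'I_3 -> C).
Variables (g0 : C -> C) (G : 'I_3 -> C -> C) (A D U : set C) (B : seq C) (c : C).
Hypothesis oA : open A.
Hypothesis chA : forall z, A z -> exists r mu W, chart g0 G z r mu W.
Hypothesis iA : forall z, A z -> isol_zeros G z.
Hypothesis oD : open D.
Hypothesis cD : convexC D.
Hypothesis AB : forall z, D z -> z \notin B -> A z.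
Hypothesis oU : open U.
Hypothesis UD : U `<=` D.
Hypothesis Uc : U c.
Hypothesis starU : forall z t, U z -> 0 <= t <= 1 -> U (seg c z t).
Hypothesis BU : forall b, b \in B -> U b.

Local Notation sol := (sol g0 G).
Local Notation secn := (secn g0 G).

Lemma seg_open z t : U (seg c z t) -> exists2 d : R, 0 < d &
  forall t', `|t' - t| < d -> U (seg c z t').
Proof.
move=> /(open_ballP oU)[r r0 hr].
have L0 : 0 < cabs (z - c) + 1 by rewrite ltr_wpDl ?cabs_ge0.
exists (r / (cabs (z - c) + 1)); first by rewrite divr_gt0.
move=> t' ht; apply: hr; rewrite seg_dist.
apply: (@le_lt_trans _ _ (`|t' - t| * (cabs (z - c) + 1))); first by rewrite ler_wpM2l // lerDl.
by rewrite -ltr_pdivlMr.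
Qed.

Lemma segI z (t t' : R) : z != c -> seg c z t = seg c z t' -> t = t'.
Proof.
move=> zc /eqP; rewrite -subr_eq0 segB mulf_eq0 subr_eq0 (negPf zc) orbF.
by move=> /eqP /(congr1 (@re R)) /= /eqP; rewrite subr_eq0 => /eqP.
Qed.

(** Induction on the finite list: a point of the list met at or after the current parameter lies in
    [U] and is not [z], so, [U] being open, the parameter can be moved just past it without leaving
    [U]. *)
Lemma ray_exit z : ~ U z -> exists t1, [/\ 0 < t1 <= 1, U (seg c z t1) &
  forall t, t1 <= t <= 1 -> seg c z t \notin B].
Proof.
move=> Uz; have zc : z != c by apply: contra_notN Uz => /eqP ->.
elim: B BU => [_|b B' IH BU'].
  have [d d0 hd] : exists2 d : R, 0 < d & forall t', `|t' - 0| < d -> U (seg c z t').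
    by apply: seg_open; rewrite seg0.
  have p0 : 0 < Num.min 1 (d / 2) by rewrite lt_min ltr01 divr_gt0.
  exists (Num.min 1 (d / 2)); split=> //; first by rewrite p0 ge_min lexx.
  apply: hd; rewrite subr0 gtr0_norm // gt_min; apply/orP; right.
  by rewrite ltr_pdivrMr // mulr_natr mulr2n ltrDl.
have [t1 [/andP[t10 t11] Ut1 nB]] : exists t1, [/\ 0 < t1 <= 1, U (seg c z t1) &
    forall t, t1 <= t <= 1 -> seg c z t \notin B'].
  by apply: IH => v vB; apply: BU'; rewrite inE vB orbT.
have [[tb [/andP[tb1 tb2] Eb]]|nb] := pselect (exists tb, t1 <= tb <= 1 /\ b = seg c z tb).
  have Ub : U (seg c z tb) by rewrite -Eb; apply: BU'; rewrite mem_head.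
  have tlt : tb < 1.
    rewrite lt_def tb2 andbT; apply: contra_notN Uz => /eqP E.
    by move: Ub; rewrite -E seg1.
  have [d d0 hd] := seg_open Ub.
  (* Strictly beyond [tb], but within the margin [d] for which the ray is still in [U]. *)
  pose t2 := Num.min 1 (tb + d / 2).
  have d20 : 0 < d / 2 by rewrite divr_gt0.
  have tb2' : tb < t2 by rewrite lt_min tlt ltrDl.
  exists t2; split.
  - by rewrite (lt_trans (lt_le_trans t10 tb1)) //= ge_min lexx.
  - apply: hd; rewrite gtr0_norm ?subr_gt0 // ltrBlDl.
    rewrite gt_min; apply/orP; right.
    by rewrite ltrD2l ltr_pdivrMr // mulr_natr mulr2n ltrDl.
  - move=> t /andP[tt2 t1']; rewrite inE negb_or nB ?(le_trans tb1) ?(le_trans (ltW tb2')) //= ?t1' // andbT.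
    apply/eqP => E; have /(segI zc) e : seg c z t = seg c z tb by rewrite E.
    by move: tt2; rewrite e leNgt tb2'.
exists t1; split=> //; first by rewrite t10.
move=> t ht; rewrite inE negb_or nB // andbT; apply/eqP => E.
by apply: nb; exists t.
Qed.

(** The shadow of the disc around [w], disc included, for a light placed at [c]. A point of the
    shadow is joined to the disc along a ray from [c], and if it lies in [U] that path does too, [U]
    being star-shaped. *)
Definition cone w r : set C := [set v | exists x t,
  [/\ cabs (x - w) < r, 1 <= t & v = seg c x t]].

Lemma open_cone w r : open (cone w r).
Proof.
rewrite openE => v [x [t [xw t1 ->]]]; apply/nbhsCP.
exists (r - cabs (x - w)); first by rewrite subr_gt0.
have t0 : 0 < t := lt_le_trans ltr01 t1.
move=> u uv; exists (seg c u t^-1), t; split => //; last first.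
  rewrite /seg -[RHS](_ : u = _) //.
  have E : mkC t 0 * mkC t^-1 0 = 1 :> C.
    by apply: cxP; rewrite !reimE ?mulr0 ?mul0r ?subr0 ?addr0 // mulfV // gt_eqF.
  by rewrite [c + _ - c]addrC addKr mulrA E mul1r addrC subrK.
have -> : seg c u t^-1 - w = mkC t^-1 0 * (u - seg c x t) + (x - w).
  have E : mkC t^-1 0 * mkC t 0 = 1 :> C.
    by apply: cxP; rewrite !reimE ?mulr0 ?mul0r ?subr0 ?addr0 // mulVf // gt_eqF.
  have -> : mkC t^-1 0 * (u - seg c x t) = mkC t^-1 0 * (u - c) - mkC t^-1 0 * mkC t 0 * (x - c).
    by rewrite /seg; ring.
  by rewrite E /seg; ring.
rewrite (le_lt_trans (cabsD _ _)) // -ltrBrDr; apply: le_lt_trans uv.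
rewrite cabsM cabs_real ger0_norm ?invr_ge0 ?(ltW t0) //.
by rewrite ler_piMl ?cabs_ge0 // invf_le1.
Qed.

Lemma cone_convex w r v v' t : cone w r v -> cone w r v' -> 0 <= t <= 1 ->
  cone w r (seg v v' t).
Proof.
move=> [x [a [xw a1 ->]]] [y [b [yw b1 ->]]] /[dup] ht /andP[t0 t1].
pose T := (1 - t) * a + t * b.
have T1 : 1 <= T.
  have a2 : (1 - t) * 1 <= (1 - t) * a by rewrite ler_wpM2l // subr_ge0.
  have b2 : t * 1 <= t * b by rewrite ler_wpM2l.
  by rewrite /T; lra.
have T0 : 0 < T := lt_le_trans ltr01 T1.
(* With [c] as origin, (1 - t) a x + t b y is T times the convex combination of x and y of parameter
   t b / T. *)
exists (seg x y (t * b / T)), T; split => //.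
  apply: cball_convex => //.
  have tb0 : 0 <= t * b by rewrite mulr_ge0 // (le_trans ler01).
  rewrite divr_ge0 ?(ltW T0) //= ler_pdivrMr // mul1r lerDr.
  by rewrite mulr_ge0 ?subr_ge0 // (le_trans ler01).
have E : mkC T 0 * mkC (t * b / T) 0 = mkC (t * b) 0.
  by apply: cxP; rewrite !reimE ?mulr0 ?mul0r ?subr0 ?addr0 // mulrC divfK // gt_eqF.
rewrite [RHS]/seg /(seg x) .
transitivity (c + mkC T 0 * (x - c) + mkC T 0 * mkC (t * b / T) 0 * (y - x)); last by ring.
by rewrite E /T /seg; apply: cxP; rewrite !reimE; ring.
Qed.

(* The ray from [c] to [z] leaves [U] at some [w] beyond all the points of [B]; a solution
   near [w] is continued along the segment from [w] to [z]. *)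
Lemma local_extension FU z :
  (forall z l, U z -> holat (FU l) z) -> (forall z, U z -> A z -> sol z (FU^~ z)) ->
  D z -> ~ U z -> exists N s, [/\ open N, N z, N `<=` A, secn N s &
   exists w r r1 y, [/\ N = tube r1 w y 1 `&` cone w r, secn (tube r1 w y 1) s,
     tube r1 w y 1 `<=` A,
     [set v | cabs (v - w) < r] `<=` U `&` tube r1 w y 1 &
     forall v, N v -> U v -> s^~ v = FU^~ v]].
Proof.
move=> hFU sFU Dz Uz; have [t1 [/andP[t10 t11] Uw nB]] := ray_exit Uz.
set w := seg c z t1 in Uw.
have wz t : seg w z t = seg c z (t1 + t * (1 - t1)).
  by rewrite /w /seg; apply: cxP; rewrite !reimE; ring.
have rg t : 0 <= t <= 1 -> t1 <= t1 + t * (1 - t1) <= 1.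
  move=> /andP[t0 t1']; rewrite lerDl mulr_ge0 ?subr_ge0 //=.
  have : t * (1 - t1) <= 1 * (1 - t1) by rewrite ler_wpM2r ?subr_ge0.
  by lra.
have sA t : 0 <= t <= 1 -> A (seg w z t).
  move=> ht; apply: AB; last by rewrite wz; apply/nB/rg.
  by apply: cD => //; exact: UD.
have Aw : A w by rewrite -(seg0 w z); apply: sA; rewrite lexx ler01.
have [r1 [s [r10 tA hs sw]]] := tube_section oA chA iA sA (sFU w Uw Aw).
have [r2 r20 hr2] := open_ballP oU Uw.
pose r := Num.min r1 r2.
have r0 : 0 < r by rewrite lt_min r10.
have Bsub : [set v | cabs (v - w) < r] `<=` U `&` tube r1 w z 1.
  move=> v; rewrite /= lt_min => /andP[v1 v2]; split; first exact: hr2.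
  by exists 0; [rewrite lexx ler01 | rewrite seg0].
exists (tube r1 w z 1 `&` cone w r), s; split.
- by apply: openI; [exact: open_tube | exact: open_cone].
- split; first by exists 1; [rewrite lexx ler01 | rewrite seg1 subrr cabs0].
  exists w, t1^-1; split; first by rewrite subrr cabs0.
    by rewrite invf_ge1.
  have E : mkC t1^-1 0 * mkC t1 0 = 1 :> C.
    by apply: cxP; rewrite !reimE ?mulr0 ?mul0r ?subr0 ?addr0 // mulVf // gt_eqF.
  by rewrite /w /seg [c + _ - c]addrC addKr mulrA E mul1r addrC subrK.
- by move=> v [/tA].
- by move=> v [/hs].
exists w, r, r1, z; split => // v [tv [x [t [xw t1' Ev]]]] Uv.
have [Ux tx] := Bsub _ xw.
have hFUt : secn (U `&` tube r1 w z 1) FU.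
  by move=> u [Uu /tA Au]; split; [move=> l; exact: hFU | exact: sFU].
have hst : secn (U `&` tube r1 w z 1) s by move=> u [_ /hs].
have NA : U `&` tube r1 w z 1 `<=` A by move=> u [_ /tA].
have ww : cabs (w - w) < r by rewrite subrr cabs0.
have sx : s^~ x = FU^~ x.
  apply: (secn_agree iA NA _ hst hFUt sw) => u hu; apply: Bsub.
  exact: cball_convex.
apply: (secn_agree iA NA _ hst hFUt sx) => u hu; split; last exact: tube_convex.
have t0 : 0 < t := lt_le_trans ltr01 t1'.
(* The path from [x] to [v] is part of the segment from [c] to [v]; the parameter is at most 1
   because t >= 1. *)
have -> : seg x v u = seg c v ((1 - u) / t + u).
  have E : mkC ((1 - u) / t) 0 * mkC t 0 = mkC (1 - u) 0.
    by apply: cxP; rewrite !reimE ?mulr0 ?mul0r ?subr0 ?addr0 // divfK // gt_eqF.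
  transitivity (c + mkC ((1 - u) / t) 0 * mkC t 0 * (x - c) + mkC u 0 * (v - c)).
    by rewrite E /seg; apply: cxP; rewrite !reimE; ring.
  have -> : v - c = mkC t 0 * (x - c) by rewrite Ev /seg addrC addKr.
  by rewrite /seg Ev /seg [c + _ - c]addrC addKr; apply: cxP; rewrite !reimE; ring.
apply: starU => //; case/andP: hu => u0 u1.
have a1 : 0 <= (1 - u) / t by apply: divr_ge0; [rewrite subr_ge0 | exact: ltW].
have a2 : (1 - u) / t <= 1 - u.
  by rewrite ler_pdivrMr // ler_peMr ?subr_ge0.
by move: a1 a2; move: (_ / t) => a a1 a2; rewrite addr_ge0 //=; lra.
Qed.

(** The local extensions are glued to [FU]. Their neighbourhoods are intersections of a tube and a
    cone, hence convex, so two extensions agree on an overlap as soon as they agree at one of its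
    points; a point of [U], where both coincide with [FU], is found on the ray through the given
    point. *)
Lemma star_extension FU :
  (forall z l, U z -> holat (FU l) z) -> (forall z, U z -> A z -> sol z (FU^~ z)) ->
  exists F : 'I_3 -> C -> C, [/\ forall z l, D z -> holat (F l) z,
    forall z, D z -> A z -> sol z (F^~ z) & forall z, U z -> F^~ z = FU^~ z].
Proof.
move=> hFU sFU.
have loc z : exists N s, D z -> ~ U z -> [/\ open N, N z, N `<=` A, secn N s &
   exists w r r1 y, [/\ N = tube r1 w y 1 `&` cone w r, secn (tube r1 w y 1) s,
     tube r1 w y 1 `<=` A,
     [set v | cabs (v - w) < r] `<=` U `&` tube r1 w y 1 &
     forall v, N v -> U v -> s^~ v = FU^~ v]].
  have [[Dz Uz]|h] := pselect (D z /\ ~ U z).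
    by have [N [s h]] := local_extension hFU sFU Dz Uz; exists N, s.
  by exists setT, (fun _ _ => 0) => Dz Uz; case: h.
have [N /choice[S hS]] := choice loc.
(* [x] and [x'] are the origins of [y] in the two discs. When t <= t', [x] lies between [x'] and
   [y], hence in both neighbourhoods, and it is in [U]. The other order of t and t' follows by
   exchanging the roles of the extensions. *)
have half z z' y x x' t t' : D z -> ~ U z -> D z' -> ~ U z' -> N z y -> N z' y ->
    forall w r r1 v w' r' r1' v', N z = tube r1 w v 1 `&` cone w r ->
    N z' = tube r1' w' v' 1 `&` cone w' r' ->
    [set v | cabs (v - w) < r] `<=` U `&` tube r1 w v 1 ->
    [set v | cabs (v - w') < r'] `<=` U `&` tube r1' w' v' 1 ->
    cabs (x - w) < r -> cabs (x' - w') < r' -> 1 <= t -> t <= t' ->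
    y = seg c x t -> y = seg c x' t' -> (S z)^~ y = (S z')^~ y.
  move=> Dz Uz Dz' Uz' Nzy Nzy' w r r1 v w' r' r1' v' EN EN' sub sub' xw xw' t1 tt' Ey Ey'.
  have [_ _ NA hs [_ [_ [_ [_ [_ _ _ _ agU]]]]]] := hS z Dz Uz.
  have [_ _ NA' hs' [_ [_ [_ [_ [_ _ _ _ agU']]]]]] := hS z' Dz' Uz'.
  have t0 : 0 < t := lt_le_trans ltr01 t1.
  have [Ux tx] := sub _ xw; have [Ux' tx'] := sub' _ xw'.
  have Ex : x = seg c x' (t' / t).
    apply: (@mulfI _ (mkC t 0)).
      by apply/eqP => /(congr1 (@re R)) /= /eqP; rewrite gt_eqF.
    have E : mkC t 0 * mkC (t' / t) 0 = mkC t' 0.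
      by apply: cxP; rewrite !reimE ?mulr0 ?mul0r ?subr0 ?addr0 // mulrC divfK // gt_eqF.
    transitivity (mkC t 0 * c + (y - c)); first by rewrite Ey /seg; ring.
    rewrite Ey' /seg; transitivity (mkC t 0 * c + mkC t 0 * mkC (t' / t) 0 * (x' - c)); last by ring.
    by rewrite E; ring.
  have Nx : N z x.
    rewrite EN; split => //; exists x, 1; split => //; by rewrite seg1.
  have Nx' : N z' x.
    rewrite EN'; split; last first.
      by exists x', (t' / t); split => //; rewrite ler_pdivlMr // mul1r.
    have ty' : tube r1' w' v' 1 y by move: Nzy'; rewrite EN' => -[].
    (* The position of [x] on the segment from [x'] to [y] is (t' / t - 1) / (t' - 1); if t' = 1 the
       three points coincide. *)
    have [tE|tN] := eqVneq t' 1.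
      have t1' : t = 1 by apply/eqP; rewrite eq_le t1 -tE tt'.
      by rewrite Ex tE t1' divr1 seg1.
    have t'1 : 0 < t' - 1 by rewrite subr_gt0 lt_def tN (le_trans t1 tt').
    have -> : x = seg x' y ((t' / t - 1) / (t' - 1)).
      rewrite Ex Ey'.
      have E : mkC ((t' / t - 1) / (t' - 1)) 0 * mkC (t' - 1) 0 = mkC (t' / t - 1) 0.
        by apply: cxP; rewrite !reimE ?mulr0 ?mul0r ?subr0 ?addr0 // divfK // gt_eqF.
      transitivity (x' + mkC (t' / t - 1) 0 * (x' - c)).
        by rewrite /seg; apply: cxP; rewrite !reimE; ring.
      by rewrite -E /seg; apply: cxP; rewrite !reimE; ring.
    apply: tube_convex => //.
    have le1 : 1 <= t' / t by rewrite ler_pdivlMr // mul1r.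
    have le2 : t' / t <= t' by rewrite ler_pdivrMr // ler_peMr // (le_trans _ tt') // ltW.
    apply/andP; split; first by apply: divr_ge0; rewrite subr_ge0 // (le_trans t1).
    by rewrite ler_pdivrMr // mul1r lerD2r.
  have sx : (S z)^~ x = (S z')^~ x by rewrite agU // agU'.
  have NNA : N z `&` N z' `<=` A by move=> u [/NA].
  have cN u : 0 <= u <= 1 -> (N z `&` N z') (seg x y u).
    move=> hu; split.
      by move: Nx Nzy; rewrite EN => -[h1 h2] [h3 h4]; split; [exact: tube_convex | exact: cone_convex].
    by move: Nx' Nzy'; rewrite EN' => -[h1 h2] [h3 h4]; split; [exact: tube_convex | exact: cone_convex].
  apply: (@secn_agree _ g0 G A iA _ _ _ _ _ NNA cN _ _ sx).
    by move=> u [/hs].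
  by move=> u [_ /hs'].
have agree z z' y : D z -> ~ U z -> D z' -> ~ U z' -> N z y -> N z' y -> (S z)^~ y = (S z')^~ y.
  move=> Dz Uz Dz' Uz' Ny Ny'.
  have [_ _ _ _ [w [r [r1 [v [EN _ _ sub _]]]]]] := hS z Dz Uz.
  have [_ _ _ _ [w' [r' [r1' [v' [EN' _ _ sub' _]]]]]] := hS z' Dz' Uz'.
  have [_ [x [t [xw t1 Ey]]]] : (tube r1 w v 1 `&` cone w r) y by rewrite -EN.
  have [_ [x' [t' [xw' t1' Ey']]]] : (tube r1' w' v' 1 `&` cone w' r') y by rewrite -EN'.
  have [tt|tt] := leP t t'.
    exact: (@half z z' y x x' t t' Dz Uz Dz' Uz' Ny Ny' w r r1 v w' r' r1' v').
  apply/esym.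
  exact: (@half z' z y x' x t' t Dz' Uz' Dz Uz Ny' Ny w' r' r1' v' w r r1 v _ _ _ _ _ _ _ (ltW tt)).
pose F l y := if `[< U y >] then FU l y else S y l y.
have FinU y : U y -> F^~ y = FU^~ y.
  by move=> Uy; apply/funext => l; rewrite /F; case: asboolP.
have FinN z y : D z -> ~ U z -> D y -> N z y -> F^~ y = (S z)^~ y.
  move=> Dz Uz Dy Ny; have [Uy|Uy] := pselect (U y).
    by rewrite FinU //; have [_ _ _ _ [_ [_ [_ [_ [_ _ _ _ ag]]]]]] := hS z Dz Uz; rewrite ag.
  have -> : F^~ y = (S y)^~ y by apply/funext => l; rewrite /F; case: asboolP.
  by apply: agree => //; have [] := hS y Dy Uy.
exists F; split=> [z l Dz|z Dz Az|//].
  have [Uz|Uz] := pselect (U z).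
    apply: holat_eq (hFU z l Uz).
    have : nbhs z U by apply: open_nbhs_nbhs.
    by apply: filterS => y /FinU /(congr1 (fun f => f l)).
  have [oN Nz _ hs _] := hS z Dz Uz.
  apply: holat_eq (proj1 (hs z Nz) l).
  have : nbhs z (N z `&` D) by apply: open_nbhs_nbhs; split => //; exact: openI.
  by apply: filterS => y [Ny Dy]; have /(congr1 (fun f => f l)) := FinN z y Dz Uz Dy Ny.
have [Uz|Uz] := pselect (U z); first by rewrite FinU //; exact: sFU.
have [oN Nz _ hs _] := hS z Dz Uz.
by rewrite (FinN z z) //; have [] := hs z Nz.
Qed.

(** Past its last exceptional point but still at a point of [U], the ray from [c] to [z] carries two
    continuations with the same starting value. *)
Lemma star_unique s s' : (forall z l, D z -> holat (s l) z) ->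
  (forall z l, D z -> holat (s' l) z) ->
  (forall z, D z -> A z -> sol z (s^~ z)) -> (forall z, D z -> A z -> sol z (s'^~ z)) ->
  (forall z, U z -> s^~ z = s'^~ z) -> forall z, D z -> s^~ z = s'^~ z.
Proof.
move=> h1 h1' h2 h2' E z Dz; have [Uz|Uz] := pselect (U z); first exact: E.
have [t1 [/andP[t10 t11] Uw nB]] := ray_exit Uz.
set w := seg c z t1 in Uw.
have Dw : D w by exact: UD.
have wz t : seg w z t = seg c z (t1 + t * (1 - t1)).
  by rewrite /w /seg; apply: cxP; rewrite !reimE; ring.
have rg t : 0 <= t <= 1 -> t1 <= t1 + t * (1 - t1) <= 1.
  move=> /andP[t0 t1']; rewrite lerDl mulr_ge0 ?subr_ge0 //=.
  have : t * (1 - t1) <= 1 * (1 - t1) by rewrite ler_wpM2r ?subr_ge0.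
  by lra.
have sA t : 0 <= t <= 1 -> (D `&` A) (seg w z t).
  move=> ht; have Ds : D (seg w z t) by exact: cD.
  by split => //; apply: AB => //; rewrite wz; apply/nB/rg.
apply: (@secn_agree _ g0 G A iA (D `&` A) s s' w z _ sA _ _ (E w Uw)).
- by move=> u [].
- by move=> u [Du Au]; split; [move=> l; exact: h1 | exact: h2].
- by move=> u [Du Au]; split; [move=> l; exact: h1' | exact: h2'].
Qed.

End StarExtension.

(** * Local solutions *)

Section LocalSolutions.
Variable R : realType.
Local Notation C := (Cx R).
Implicit Types (x y z w : C) (t r : R).

(** Division by f z brings the values near 1, where [clog] applies; a logarithm of the constant f z
    is added back. *)
Lemma hol_local_log (D : set C) (f : C -> C) z : open D -> D z -> hol D f -> f z != 0 ->
  exists (r : R) (L : C -> C), 0 < r /\ forall w, cabs (w - z) < r ->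
    [/\ D w, f w != 0, holat L w & cexp (L w) = f w].
Proof.
move=> oD Dz hf f0; have [L0 hL0] := cexp_surj f0.
have cq : {for z, continuous (fun w => f w / f z)}.
  by apply: jcM; [exact/holat_continuous/hf | exact: jc_cst].
have [r1 r10 hr1] := open_ballP oD Dz.
move/(@cvgCP _ _ (nbhs z) _): cq => /(_ _ ltr01) /nbhsCP[r2 r20 hr2].
exists (Num.min r1 r2), (fun w => L0 + clog (f w / f z)); split.
  by rewrite lt_min r10.
move=> w; rewrite lt_min => /andP[/hr1 Dw /hr2]; rewrite /= divff // => h.
have [h1 h2] := clog_spec h; split; first exact: Dw.
- apply: contraTneq h => ->; by rewrite mul0r sub0r cabsN cabs1 ltxx.
- apply: holatD; first exact: holat_cst.
  apply: (holat_comp (f := @clog R) (g := fun w => f w / f z)); last exact: h2.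
  by apply: holatM; [exact: hf | exact: holat_cst].
- by rewrite cexpD hL0 h1 mulrC divfK.
Qed.

Variables (g0 : C -> C) (G : 'I_3 -> C -> C) (D : set C).
Hypothesis oD : open D.
Hypothesis hg0 : hol D g0.
Hypothesis hG : forall l, hol D (G l).
Hypothesis unit_G : forall z, D z -> g0 z ^+ 2 + cdot (G^~ z) (G^~ z) = 1.

Lemma holat_cdot (u v : 'I_3 -> C -> C) z : (forall l, holat (u l) z) ->
  (forall l, holat (v l) z) -> holat (fun z => cdot (u^~ z) (v^~ z)) z.
Proof.
move=> hu hv; rewrite /cdot; elim: (index_enum _) => [|i s IH].
  by under eq_fun do rewrite big_nil; exact: holat_cst.
by under eq_fun do rewrite big_cons; apply: holatD => //; exact: holatM.
Qed.

(** A local logarithm gives a square root [sq] of w.w. Put W = w / sq and sg = (y - z)^n sq, so that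
    G = sg W and g0^2 + sg^2 = 1. Then g0 + i sg has inverse g0 - i sg, and mu is -i times its
    logarithm, so cos mu = g0 and sin mu = sg. *)
Lemma chart_exists z (n : nat) (w : 'I_3 -> C -> C) : D z -> (forall l, hol D (w l)) ->
  (forall l y, D y -> G l y = (y - z) ^+ n * w l y) -> cdot (w^~ z) (w^~ z) != 0 ->
  (exists r mu W, chart g0 G z r mu W) /\ isol_zeros G z.
Proof.
move=> Dz hw Gw om0.
pose om y := cdot (w^~ y) (w^~ y).
have hom : hol D om by move=> y Dy; apply: holat_cdot => l; exact: hw.
have [r1 [L [r10 hL]]] := hol_local_log oD Dz hom om0.
pose sq y := cexp (L y / 2).
have sq2 y : cabs (y - z) < r1 -> sq y * sq y = om y.
  move=> yz; have [_ _ _ <-] := hL y yz; rewrite /sq -cexpD; congr cexp; by field.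
have sq0 y : sq y != 0 by exact: cexp_neq0.
have hsq y : cabs (y - z) < r1 -> holat sq y.
  move=> yz; have [_ _ h _] := hL y yz; apply: (holat_comp (f := @cexp R)); last exact: holat_cexp.
  by apply: holatM => //; exact: holat_cst.
split; last first.
  exists r1; first exact: r10.
  move=> y yz yr; have [Dy omy _ _] := hL y yr.
  have [l wl] : exists l, w l y != 0.
    apply: contrapT => /forallNP h; move/eqP: omy; apply.
    by rewrite /om /cdot big1 // => l _; have /negP/negPn/eqP -> := h l; rewrite mul0r.
  exists l; rewrite (Gw l y Dy); apply: mulf_neq0; last exact: wl.
  by apply: expf_neq0; rewrite subr_eq0.
pose W l y := w l y / sq y.
pose sg y := (y - z) ^+ n * sq y.
have GW l y : cabs (y - z) < r1 -> G l y = sg y * W l y.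
  move=> yz; have [Dy _ _ _] := hL y yz; rewrite Gw // /sg /W.
  by have := sq0 y; move: (sq y) (_ ^+ n) (w l y) => a b c a0; field.
have W1 y : cabs (y - z) < r1 -> cdot (W^~ y) (W^~ y) = 1.
  move=> yz; have -> : W^~ y = fun l => (sq y)^-1 * w l y.
    by apply/funext => l; rewrite /W mulrC.
  rewrite cdotZ cdotC cdotZ -/(om y) -(sq2 y yz).
  by have := sq0 y; move: (sq y) => a a0; field.
have sg2 y : cabs (y - z) < r1 -> sg y ^+ 2 = cdot (G^~ y) (G^~ y).
  move=> yz; have -> : G^~ y = fun l => sg y * W l y by apply/funext => l; exact: GW.
  by rewrite cdotZ cdotC cdotZ W1 // mulr1 expr2.
pose D1 := [set y | cabs (y - z) < r1].
pose zt y := g0 y + iC R * sg y.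
have hsg y : cabs (y - z) < r1 -> holat sg y.
  move=> yz; apply: holatM; last exact: hsq.
  by apply: holatX; apply: holatB; [exact: holat_id | exact: holat_cst].
have ztP y : cabs (y - z) < r1 -> zt y * (g0 y - iC R * sg y) = 1.
  move=> yz; have [Dy _ _ _] := hL y yz; rewrite -(unit_G Dy) -(sg2 y yz) /zt.
  transitivity (g0 y ^+ 2 - iC R * iC R * sg y ^+ 2); first by ring.
  by rewrite iC2; ring.
have zz : cabs (z - z) < r1 by rewrite subrr cabs0.
have zt0 : zt z != 0.
  by apply: contra_eqN (ztP z zz) => /eqP ->; rewrite mul0r eq_sym oner_eq0.
have oD1 : open D1 by exact: open_cball.
have hzt : hol D1 zt.
  move=> y yz; have [Dy _ _ _] := hL y yz; apply: holatD; first exact: hg0.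
  by apply: holatM; [exact: holat_cst | exact: hsg].
have [r2 [M [r20 hM]]] := hol_local_log oD1 zz hzt zt0.
have iI : iC R * - iC R = 1 by rewrite mulrN iC2 opprK.
have iI' : iC R * iC R = -1 := iC2 R.
exists r2, (fun y => - iC R * M y), W; split; first exact: r20.
move=> y yz.
have [D1y zty hMy Ey] := hM y yz.
have e1 : cexp (iC R * (- iC R * M y)) = zt y by rewrite mulrA iI mul1r.
have e2 : cexp (- (iC R * (- iC R * M y))) = g0 y - iC R * sg y.
  rewrite cexpN e1; apply: (mulfI zty); rewrite mulfV // ztP //.
split.
- by apply: holatM; [exact: holat_cst | exact: hMy].
- move=> l; apply: holat_div; first exact: sq0.
    by apply: hw; have [] := hL y D1y.
  exact: hsq.
- rewrite /ccos e1 e2 /zt.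
  have -> : g0 y + iC R * sg y + (g0 y - iC R * sg y) = g0 y * 2 by ring.
  by rewrite mulfK // two_neq0.
- move=> l; rewrite /csin e1 e2 /zt GW //.
  have -> : g0 y + iC R * sg y - (g0 y - iC R * sg y) = sg y * (iC R + iC R) by ring.
  by rewrite mulfK // iCC_neq0.
- exact: W1.
Qed.

(** The same condition as [slit], kept separate because it bears on g = cos mu and not on the square
    of a tangent. *)
Definition slit_value (g : C) := im g != 0 \/ -1 < re g.

Lemma slit_value_neq0 g : slit_value g -> 1 + g != 0.
Proof.
move=> h; apply/eqP => e; have ei := congr1 (@im R) e; have er := congr1 (@re R) e.
move: ei er; rewrite imD im1 im0 reD re1 re0 add0r => ei er.
case: h => [/eqP //|h]; clear e; lra.
Qed.

(* The Moebius map is [tan (mu / 2) ^ 2] in terms of [g = cos mu]. *)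
Lemma slit_value_slit g : slit_value g -> slit ((1 - g) / (1 + g)).
Proof.
move=> h; have n0 := slit_value_neq0 h.
apply: contrapT => /not_orP[/negP/negPn/eqP mi /negP]; rewrite -leNgt => mr.
set m := _ / _ in mi mr.
have E : m * (1 + g) = 1 - g by rewrite divfK.
clearbody m.
have Er := congr1 (@re R) E; have Ei := congr1 (@im R) E.
move: Er Ei; rewrite !reimE mi !mul0r subr0 addr0 add0r sub0r; clear E => Er Ei.
have gi : im g = 0.
  have /eqP : (re m + 1) * im g = 0 by rewrite mulrDl mul1r Ei addNr.
  rewrite mulf_eq0 => /orP[/eqP m1|/eqP //].
  have {}m1 : re m = -1 by clear n0 h; lra.
  by exfalso; move: Er; rewrite m1; clear n0 h; lra.
clear n0; case: h => [|h]; first by rewrite gi eqxx.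
have : (re m + 1) * (1 + re g) <= 0.
  by apply: mulr_le0_ge0; lra.
rewrite mulrDl mul1r Er; lra.
Qed.

(* Twice the arctangent of [x = tan (mu / 2)] divided by [sin mu = 2 x / (1 + x ^ 2)], times [G]. *)
Definition principal (l : 'I_3) (z : C) : C :=
  G l z * ((1 + (1 - g0 z) / (1 + g0 z)) * atanq ((1 - g0 z) / (1 + g0 z))).

Lemma holat_principal l z : D z -> slit_value (g0 z) -> holat (principal l) z.
Proof.
move=> Dz h.
have hm : holat (fun z => (1 - g0 z) / (1 + g0 z)) z.
  apply: holat_div; first exact: slit_value_neq0.
    by apply: holatB; [exact: holat_cst | exact: hg0].
  by apply: holatD; [exact: holat_cst | exact: hg0].
apply: holatM; first exact: hG.
apply: holatM; first by apply: holatD; [exact: holat_cst | exact: hm].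
apply: (holat_comp (f := @atanq R) (g := fun z => (1 - g0 z) / (1 + g0 z))); first exact: hm.
exact/holat_atanq/slit_value_slit.
Qed.

(** With x = tan (mu / 2), the number N = x atanq (x^2) satisfies exp (2 i N) = exp (i mu), so 2 N
    is one of the determinations of mu. Since sin mu = 2 x / (1 + x^2), the principal vector is 2 N
    W; no division by x occurs, so mu = 0 is included. *)
Lemma sol_principal z : D z -> slit_value (g0 z) ->
  (exists r mu W, chart g0 G z r mu W) -> sol g0 G z (principal^~ z).
Proof.
move=> Dz h [r [mu [W ch]]]; have [r0 hch] := ch.
have zz : cabs (z - z) < r by rewrite subrr cabs0.
have [_ _ hc hs _] := hch z zz.
pose zt := cexp (iC R * mu z).
have zt0 : zt != 0 by exact: cexp_neq0.
pose m := (1 - g0 z) / (1 + g0 z).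
have n0 := slit_value_neq0 h.
have gE : 1 + g0 z = (zt + 1) ^+ 2 / (2 * zt).
  rewrite -hc /ccos cexpN -/zt; have := two_neq0 R; move: zt zt0 => a a0 t0.
  by field; rewrite a0.
have ztp : zt + 1 != 0 by apply: contraNneq n0 => e; rewrite gE e expr0n mul0r.
(* tan (mu / 2) written in terms of zt = exp (i mu); zt = -1 is excluded because it would mean g0 =
   -1. *)
pose x := - iC R * ((zt - 1) / (zt + 1)).
have xm : x ^+ 2 = m.
  rewrite /m gE; have -> : 1 - g0 z = - (zt - 1) ^+ 2 / (2 * zt).
    rewrite -hc /ccos cexpN -/zt; have := two_neq0 R; move: zt zt0 {ztp gE x m} => a a0 t0.
    by field; rewrite a0.
  rewrite /x exprMn sqrrN expr2 iC2; have := two_neq0 R; move: zt zt0 ztp {gE x m} => a a0 a1 t0.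
  by field; rewrite a0 a1.
have sx : slit (x ^+ 2) by rewrite xm; exact: slit_value_slit.
have ix : iC R * x = (zt - 1) / (zt + 1) by rewrite /x mulrA mulrN iC2 opprK mul1r.
have := cexp_atanq sx; rewrite ix xm.
set N := x * atanq m => EN.
have EN2 : cexp (iC R * (N + N)) = zt.
  have -> : iC R * (N + N) = (iC R + iC R) * N by ring.
  have u0 : 1 - (zt - 1) / (zt + 1) != 0.
    have -> : 1 - (zt - 1) / (zt + 1) = 2 / (zt + 1).
      by move: zt ztp {zt0 gE x xm sx ix N EN} => a a1; field.
    by rewrite mulf_neq0 ?two_neq0 ?invr_neq0.
  apply: (mulIf u0); rewrite EN.
  by move: zt ztp {zt0 gE x xm sx ix N EN u0} => a a1; field.
have [n hn] : exists n : int, N + N = mu z + mkC (pi *+ 2 * n%:~R) 0.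
  have [n hn] := cexp_inj EN2; exists n; apply: (mulfI (iC_neq0 R)); rewrite hn mulrDr.
  by congr (_ + _); apply: cxP; rewrite !reimE; ring.
exists r, (fun y => mu y + mkC (pi *+ 2 * n%:~R) 0), W; split; first exact: chart_shift.
move=> l; rewrite -hn /principal hs mulrAC; congr (_ * _).
rewrite -/m /N mulrA -mulrDl; congr (_ * _).
rewrite -xm /csin cexpN -/zt.
have -> : x + x = - (iC R + iC R) * ((zt - 1) / (zt + 1)) by rewrite /x; ring.
have -> : x ^+ 2 = - ((zt - 1) / (zt + 1)) ^+ 2.
  by rewrite /x exprMn sqrrN expr2 iC2 mulN1r.
have iv : (iC R + iC R)^-1 = - (iC R + iC R) / 4.
  apply: (mulfI (iCC_neq0 R)); rewrite mulfV ?iCC_neq0 //.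
  have n4 : 4 != 0 :> C by rewrite pnatr_eq0.
  apply: (mulIf n4); rewrite -mulrA divfK // mul1r.
  transitivity (- 4 * (iC R * iC R)); last by ring.
  by rewrite iC2; ring.
rewrite iv; move: zt zt0 ztp {gE x xm sx ix N EN EN2 hn m} (iC R + iC R) => a a0 a1 k.
have n4 : 4 != 0 :> C by rewrite pnatr_eq0.
by field; rewrite a0 a1.
Qed.

End LocalSolutions.

(** * The exponential series *)

Section ExponentialSeries.
Variable R : realType.
Local Notation C := (Cx R).
Implicit Types (x y z w : C) (t r : R).

Definition fact_inv (n : nat) : C := mkC ((n`!%:R)^-1) 0.
Definition exp_sum (n : nat) (z : C) : C := \sum_(0 <= k < n) fact_inv k * z ^+ k.

Lemma exp_sum0 n : exp_sum n.+1 0 = 1.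
Proof.
rewrite /exp_sum big_nat_recl // big1 ?addr0; last first.
  by move=> i _; rewrite expr0n mulr0.
by rewrite expr0 mulr1 /fact_inv fact0 invr1.
Qed.

Lemma fact_invS n : mkC n.+1%:R 0 * fact_inv n.+1 = fact_inv n.
Proof.
apply: cxP; rewrite !reimE ?mul0r ?mulr0 ?subr0 ?addr0 //.
rewrite factS natrM invfM mulrA mulfV ?mul1r // pnatr_eq0 //.
Qed.

Lemma is_derive_exp_sum n z : is_derive z 1 (exp_sum n.+1) (exp_sum n z).
Proof.
elim: n => [|n IH].
  have -> : exp_sum 1 = fun=> 1.
    by apply/funext => w; rewrite /exp_sum big_nat1 expr0 mulr1 /fact_inv fact0 invr1.
  by rewrite /exp_sum big_geq //; exact: is_derive_cst.
have dX m : is_derive z 1 (fun w : C => w ^+ m.+1) (mkC m.+1%:R 0 * z ^+ m).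
  elim: m => [|m IHm].
    by apply: (is_deriveC_eq (is_derive_id z (1 : C))) => //; rewrite expr0 mulr1.
  have d := is_deriveC_mul (is_derive_id z (1 : C)) IHm.
  apply: (is_deriveC_eq d) => [w|]; first by rewrite [RHS]exprS.
  rewrite mul1r mulrCA -exprS -[X in X + _]mul1r -mulrDl; congr (_ * _).
  by apply: cxP; rewrite !reimE ?addr0 // -[RHS]natr1 addrC.
have d := is_deriveC_add IH (is_deriveC_mul (is_derive_cst (fact_inv n.+1) z (1 : C)) (dX n)).
apply: (is_deriveC_eq d) => [w|]; first by rewrite [RHS]/exp_sum big_nat_recr.
rewrite mul0r add0r [RHS]/exp_sum big_nat_recr //=; congr (_ + _).
by rewrite mulrA [_ * mkC _ _]mulrC fact_invS.
Qed.

(** Taking the real part against every [l] of modulus at most 1 makes the remainder a real function,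
    to which the mean value theorem applies without loss of a constant; the choices l = 1, -1 and
    the two units i, -i recover both components. *)
Lemma exp_remainder n z (l : C) (rho : R) : cabs z <= rho -> cabs l <= 1 ->
  re (l * (cexp z - exp_sum n z)) <= expR rho * (cabs z ^+ n / n`!%:R).
Proof.
elim: n z l => [|n IH] z l zr l1.
  rewrite /exp_sum big_geq // subr0 expr0 fact0 divr1 mulr1.
  rewrite (le_trans (ler_norm _)) // (le_trans (cabs_re _)) // cabsM.
  have -> : cabs (cexp z) = expR (re z).
    apply/eqP; rewrite -(@eqrXn2 _ 2) ?cabs_ge0 ?expR_ge0 // cabs2 !reimE.
    by rewrite !exprMn -mulrDr cos2Dsin2 mulr1.
  rewrite (le_trans (ler_piMl (expR_ge0 _) l1)) // ler_expR.
  by rewrite (le_trans (ler_norm _)) // (le_trans (cabs_re _)).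
pose u (t : R) := re (l * (cexp (0 + mkC t 0 * z) - exp_sum n.+1 (0 + mkC t 0 * z))).
pose K := expR rho * (cabs z ^+ n.+1 / n.+1`!%:R).
(* Its derivative is nonnegative by the induction hypothesis at [s * z], so that 0 = v 0 <= v 1,
   which is the claim. *)
pose v (t : R) := K * t ^+ n.+1 - u t.
pose v' (t : R) := K * (n.+1%:R * t ^+ n) - re (l * (cexp (0 + mkC t 0 * z) - exp_sum n (0 + mkC t 0 * z)) * z).
have dv t : is_derive t 1 v (v' t).
  have dc := is_deriveC_add (is_derive_cexp (0 + mkC t 0 * z)) (is_deriveN (is_derive_exp_sum n (0 + mkC t 0 * z))).
  have dl := is_deriveC_mul (is_derive_cst l (0 + mkC t 0 * z) (1 : C)) dc.
  have [du _] := is_deriveC_line erefl dl.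
  have {}du : is_derive t 1 u (re (l * (cexp (0 + mkC t 0 * z) - exp_sum n (0 + mkC t 0 * z)) * z)).
    by apply: (is_derive_eq du); rewrite mul0r add0r.
  have dX : is_derive t 1 (fun t : R => t ^+ n.+1) (n.+1%:R * t ^+ n).
    by apply: DeriveDef; [exact: exprn_derivable | rewrite exp_derive [_%:A]mulr1].
  have dp := is_deriveZ K dX.
  exact: (is_deriveB dp du).
have cv t : {for t, continuous v}.
  by have [d _] := dv t; apply: differentiable_continuous; apply/derivable1_diffP.
have dv' (t : R) : t \in `]0, 1[ -> is_derive t 1 v (v' t) by move=> _; exact: dv.
have cv' : {within `[0, 1], continuous v} by apply: continuous_in_subspaceT => t _; exact: cv.
have [s /[!in_itv]/= /andP[s0 s1] E] := MVT_segment ler01 dv' cv'.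
have v0 : v 0 = 0.
  rewrite /v /u expr0n mulr0 mul0r addr0 cexp0 exp_sum0 subrr mulr0 re0 subr0 //.
have v1 : v 1 = K - re (l * (cexp z - exp_sum n.+1 z)).
  by rewrite /v /u expr1n mulr1 add0r mul1r.
suff v's : 0 <= v' s.
  by move: E; rewrite v0 v1 !subr0 mulr1 => E; rewrite -subr_ge0 -/K E.
rewrite /v' add0r subr_ge0.
have [->|z0] := eqVneq z 0.
  rewrite mulr0 re0; apply: mulr_ge0; last by apply: mulr_ge0 => //; exact: exprn_ge0.
  apply: mulr_ge0; first exact: expR_ge0.
  by apply: divr_ge0 => //; apply/exprn_ge0/cabs_ge0.
have az : 0 < cabs z by rewrite cabs_gt0.
(* The factor z produced by differentiation is split into |z|, which enters the bound, and a factor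
   of modulus 1, absorbed by [l]. *)
pose l' := l * (z * mkC (cabs z)^-1 0).
have l'1 : cabs l' <= 1.
  rewrite /l' cabsM cabsM cabs_real gtr0_norm ?invr_gt0 // mulfV ?gt_eqF // mulr1 //.
have szr : cabs (mkC s 0 * z) = s * cabs z by rewrite cabsM cabs_real ger0_norm.
have szr' : cabs (mkC s 0 * z) <= rho.
  by rewrite szr (le_trans _ zr) // ler_piMl ?cabs_ge0.
have := IH _ _ szr' l'1; rewrite szr.
set T := cexp _ - _ => h.
have -> : l * T * z = mkC (cabs z) 0 * (l' * T).
  have E1 : mkC (cabs z) 0 * mkC (cabs z)^-1 0 = 1 :> C.
    by apply: cxP; rewrite !reimE ?mulr0 ?mul0r ?subr0 ?addr0 // mulfV // gt_eqF.
  transitivity (mkC (cabs z) 0 * mkC (cabs z)^-1 0 * (l * T * z)); first by rewrite E1 mul1r.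
  by rewrite /l'; ring.
rewrite reM /= mul0r subr0 (le_trans (ler_wpM2l (ltW az) h)) //.
rewrite /K le_eqVlt; apply/orP; left; apply/eqP.
rewrite exprMn exprS factS natrM.
have n1 : n.+1%:R != 0 :> R by rewrite pnatr_eq0.
have n2 : n`!%:R != 0 :> R by rewrite pnatr_eq0 -lt0n fact_gt0.
move: n1 n2; move: (n.+1%:R) (n`!%:R) (s ^+ n) (cabs z ^+ n) (cabs z) (expR rho) => a b c d e f n1 n2.
by field; rewrite n1 n2.
Qed.

Lemma cvg_exp_sum z : (fun n => exp_sum n z) @ \oo --> cexp z.
Proof.
have zero : (fun n => expR (cabs z) * (cabs z ^+ n / n`!%:R)) @ \oo --> (0 : R).
  rewrite -[X in _ --> X](mulr0 (expR (cabs z))); apply: cvgMr.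
  exact: cvg_series_cvg_0 (is_cvg_series_exp_coeff (cabs z)).
have bound n (l : C) : cabs l = 1 -> `|re (l * (cexp z - exp_sum n z))| <= expR (cabs z) * (cabs z ^+ n / n`!%:R).
  move=> l1; rewrite ler_norml; apply/andP; split; last by apply: exp_remainder; rewrite ?l1.
  by rewrite lerNl -reN -mulNr; apply: exp_remainder; rewrite ?cabsN ?l1.
apply/(@cvg_reim _ _ \oo); split; apply/cvgrPdist_lt => e e0.
  move/cvgrPdist_lt : zero => /(_ _ e0); apply: filterS => n; rewrite sub0r normrN => h.
  rewrite -reN -reD; apply: le_lt_trans (le_lt_trans (ler_norm _) h).
  by have := bound n 1 (@cabs1 R); rewrite mul1r.
move/cvgrPdist_lt : zero => /(_ _ e0); apply: filterS => n; rewrite sub0r normrN => h.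
rewrite -imN -imD; apply: le_lt_trans (le_lt_trans (ler_norm _) h).
have i1 : cabs (- iC R) = 1 by rewrite cabsN /cabs /= expr0n add0r expr1n sqrtr1.
by have := bound n _ i1; rewrite reM reN imN /= oppr0 mul0r sub0r mulN1r opprK.
Qed.

(* For a vector [e] of square [- kap], the pair [(a, b)] such that [e ^ n = a + b e]. *)
Fixpoint pow_vec (kap : C) (n : nat) : C * C :=
  if n is m.+1 then (- (pow_vec kap m).2 * kap, (pow_vec kap m).1) else (1, 0).

(** For a vector of square - mu^2 the powers are governed by the two numbers i mu and - i mu; the
    second identity is multiplied by mu so as to hold for mu = 0. *)
Lemma pow_vecE (mu : C) n :
  (pow_vec (mu ^+ 2) n).1 = ((iC R * mu) ^+ n + (- (iC R * mu)) ^+ n) / 2 /\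
  (pow_vec (mu ^+ 2) n).2 * mu = ((iC R * mu) ^+ n - (- (iC R * mu)) ^+ n) / (iC R + iC R).
Proof.
move E : (mu ^+ 2) => kap.
elim: n => [|n [IH1 IH2]] /=.
  by rewrite !expr0 subrr !mul0r; split => //; rewrite -mulr2n -[1 *+ 2]/2 divff // two_neq0.
have iv : (iC R + iC R)^-1 = - iC R / 2.
  apply: (mulfI (iCC_neq0 R)); rewrite mulfV ?iCC_neq0 //.
  apply: (mulIf (two_neq0 R)); rewrite -mulrA divfK ?two_neq0 // mul1r.
  transitivity (- 2 * (iC R * iC R)); last by ring.
  by rewrite iC2; ring.
rewrite !exprS; split.
  have -> : - (pow_vec kap n).2 * kap = - ((pow_vec kap n).2 * mu) * mu by rewrite -E; ring.
  rewrite IH2 iv; move: (_ ^+ n) ((- _) ^+ n) => a b.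
  by ring.
rewrite IH1 iv; move: (_ ^+ n) ((- _) ^+ n) => a b.
transitivity (- (iC R * iC R) * mu * (a + b) / 2); last by ring.
by rewrite iC2; ring.
Qed.

Lemma pow_vec_sum (mu : C) n :
  \sum_(0 <= k < n) fact_inv k * (pow_vec (mu ^+ 2) k).1 =
    (exp_sum n (iC R * mu) + exp_sum n (- (iC R * mu))) / 2 /\
  (\sum_(0 <= k < n) fact_inv k * (pow_vec (mu ^+ 2) k).2) * mu =
    (exp_sum n (iC R * mu) - exp_sum n (- (iC R * mu))) / (iC R + iC R).
Proof.
rewrite /exp_sum; split.
  rewrite -big_split /= mulr_suml; apply: eq_bigr => k _.
  by have [-> _] := pow_vecE mu k; rewrite mulrA mulrDr.
rewrite -sumrB mulr_suml mulr_suml; apply: eq_bigr => k _.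
by rewrite -mulrA; have [_ ->] := pow_vecE mu k; rewrite mulrA mulrBr.
Qed.

Lemma cvg_pow_vec (mu : C) (w : C) :
  (fun n => \sum_(0 <= k < n) fact_inv k * (pow_vec (mu ^+ 2) k).1) @ \oo --> ccos mu /\
  (fun n => \sum_(0 <= k < n) fact_inv k * ((pow_vec (mu ^+ 2) k).2 * (mu * w))) @ \oo --> csin mu * w.
Proof.
have c1 := @cvg_exp_sum (iC R * mu); have c2 := @cvg_exp_sum (- (iC R * mu)).
split.
  under eq_fun do rewrite (proj1 (pow_vec_sum mu _)).
  exact: (cvgMr_tmp (cvgD c1 c2)).
have E n : \sum_(0 <= k < n) fact_inv k * ((pow_vec (mu ^+ 2) k).2 * (mu * w)) =
   (exp_sum n (iC R * mu) - exp_sum n (- (iC R * mu))) / (iC R + iC R) * w.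
  rewrite -(proj2 (pow_vec_sum mu n)) !mulr_suml; apply: eq_bigr => k _; ring.
under eq_fun do rewrite E.
exact: (cvgMr_tmp (cvgMr_tmp (cvgB c1 c2))).
Qed.

(** The nilpotent case e^2 = 0: only the powers 0 and 1 contribute, so exp e = 1 + e and the partial
    sums are eventually constant. *)
Lemma cvg_pow_vec0 :
  (fun n => \sum_(0 <= k < n) fact_inv k * (pow_vec 0 k).1) @ \oo --> (1 : C) /\
  (fun n => \sum_(0 <= k < n) fact_inv k * (pow_vec 0 k).2) @ \oo --> (1 : C).
Proof.
have p1 n : (pow_vec 0 n.+1).1 = 0 by rewrite /= mulr0.
have E1 n : \sum_(0 <= k < n.+1) fact_inv k * (pow_vec 0 k).1 = 1.
  rewrite big_nat_recl // big1 ?addr0 => [|i _]; last by rewrite p1 mulr0.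
  by rewrite mulr1 /fact_inv fact0 invr1.
have E2 n : \sum_(0 <= k < n.+2) fact_inv k * (pow_vec 0 k).2 = 1.
  rewrite !big_nat_recl // big1 ?addr0 => [|i _]; last by rewrite [(pow_vec _ _).2]p1 mulr0.
  by rewrite /= mulr0 add0r mulr1 /fact_inv invr1.
split.
  apply/(@cvgCP _ _ \oo) => e e0; exists 1%N => // -[//|n] _ /=.
  by rewrite E1 subrr cabs0.
apply/(@cvgCP _ _ \oo) => e e0; exists 2%N => // -[|[|n]] // _ /=.
by rewrite E2 subrr cabs0.
Qed.

End ExponentialSeries.

(** * Slice functions and their complex components *)

Section QuaternionSlices.
Variable R : realType.
Local Notation C := (Cx R).
Local Notation H := (quat R).
Implicit Types (p q I J : H) (a b : R) (z w : C).

Lemma qcoordN q : (q0 (- q) = - q0 q) * (q1 (- q) = - q1 q) *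
  (q2 (- q) = - q2 q) * (q3 (- q) = - q3 q).
Proof. by rewrite /q0 /q1 /q2 /q3 !mxE. Qed.

Lemma qcoordM p q : (q0 (p * q) = q0 p * q0 q - q1 p * q1 q - q2 p * q2 q - q3 p * q3 q) *
  (q1 (p * q) = q0 p * q1 q + q1 p * q0 q + q2 p * q3 q - q3 p * q2 q) *
  (q2 (p * q) = q0 p * q2 q - q1 p * q3 q + q2 p * q0 q + q3 p * q1 q) *
  (q3 (p * q) = q0 p * q3 q + q1 p * q2 q - q2 p * q1 q + q3 p * q0 q).
Proof. by rewrite !Quat_coord. Qed.

Lemma qcoord1 : (q0 (1 : H) = 1) * (q1 (1 : H) = 0) * (q2 (1 : H) = 0) * (q3 (1 : H) = 0).
Proof. by rewrite !Quat_coord. Qed.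

Lemma qcoordI : ((q0 (qi R) = 0) * (q1 (qi R) = 1) * (q2 (qi R) = 0) * (q3 (qi R) = 0)) *
  ((q0 (qj R) = 0) * (q1 (qj R) = 0) * (q2 (qj R) = 1) * (q3 (qj R) = 0)) *
  ((q0 (qk R) = 0) * (q1 (qk R) = 0) * (q2 (qk R) = 0) * (q3 (qk R) = 1)).
Proof. by rewrite !Quat_coord. Qed.

Definition qE := (quat_coordD, qcoordN, quat_coordZ, qcoordM, quat_coord0 R, qcoord1, qcoordI,
  (@q0_Quat R, @q1_Quat R, @q2_Quat R, @q3_Quat R)).

Lemma qeqP p q : p = q <-> [/\ q0 p = q0 q, q1 p = q1 q, q2 p = q2 q & q3 p = q3 q].
Proof. by split=> [->|/quatP]. Qed.

Lemma isphereP I : isphere I <-> q0 I = 0 /\ q1 I ^+ 2 + q2 I ^+ 2 + q3 I ^+ 2 = 1.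
Proof.
rewrite /isphere /= qeqP !qE; split; last first.
  by move=> [-> h]; split; try ring; rewrite -h; ring.
case=> h0 h1 h2 h3.
have e0 : q0 I = 0.
  apply/eqP/negP => /negP n0.
  have k x : q0 I * x + x * q0 I = 0 -> x = 0.
    by move=> e; apply: (mulfI n0); rewrite mulr0; move: e; rewrite [x * _]mulrC; lra.
  have e1 : q1 I = 0 by apply: k; lra.
  have e2 : q2 I = 0 by apply: k; lra.
  have e3 : q3 I = 0 by apply: k; lra.
  by move: h0; rewrite e1 e2 e3 => h0; have := sqr_ge0 (q0 I); rewrite expr2; lra.
by split => //; move: h0; rewrite e0 !expr2; lra.
Qed.

Lemma qi_sphere : isphere (qi R).
Proof. by apply/isphereP; rewrite !qE; split; ring. Qed.

Lemma sphereN I : isphere I -> isphere (- I).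
Proof. by rewrite /isphere /= mulrNN. Qed.

Lemma sphere_conj I p : isphere I -> p != 0 -> isphere (p^-1 * I * p).
Proof.
rewrite /isphere /= => hI p0.
have up : p \is a GRing.unit by [].
by rewrite -!mulrA mulVKr // [I * _]mulrA hI mulN1r mulrN mulVr.
Qed.

Definition cpt I z : H := (re z)%:A + im z *: I.

Lemma cpt_cj I z : cpt I (cj z) = cpt (- I) z.
Proof. by rewrite /cpt !cj_def scaleNr scalerN. Qed.

Lemma cpt_coord I z : isphere I -> q0 (cpt I z) = re z.
Proof. by move=> /isphereP[h _]; rewrite /cpt !qE h; ring. Qed.

Lemma qvec_cpt I z : isphere I -> qvec (cpt I z) = im z *: I.
Proof.
move=> hI; rewrite /qvec cpt_coord // /cpt addrC addKr //.
Qed.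

Lemma qnormE q : qnorm q ^+ 2 = q0 q ^+ 2 + q1 q ^+ 2 + q2 q ^+ 2 + q3 q ^+ 2.
Proof. by rewrite sqr_sqrtr // !addr_ge0 ?sqr_ge0. Qed.

Lemma qnorm_ge0 q : 0 <= qnorm q. Proof. exact: sqrtr_ge0. Qed.

Lemma qnorm_sphere b I : isphere I -> qnorm (b *: I) = `|b|.
Proof.
move=> /isphereP[h0 h]; apply/eqP.
rewrite -(@eqrXn2 _ 2) ?qnorm_ge0 // qnormE !qE h0 real_normK ?num_real //.
apply/eqP; transitivity (b ^+ 2 * (q1 I ^+ 2 + q2 I ^+ 2 + q3 I ^+ 2)); first by ring.
by rewrite h mulr1.
Qed.

Lemma qnorm_cpt I z : isphere I -> qnorm (cpt I z) ^+ 2 = re z ^+ 2 + im z ^+ 2.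
Proof.
move=> /isphereP[h0 h]; rewrite qnormE /cpt !qE h0.
transitivity (re z ^+ 2 + im z ^+ 2 * (q1 I ^+ 2 + q2 I ^+ 2 + q3 I ^+ 2)); first by ring.
by rewrite h mulr1.
Qed.

Lemma qnorm_eq0 q : qnorm q = 0 -> q = 0.
Proof.
move=> h; have := qnormE q; rewrite h expr0n => /esym/eqP.
rewrite !paddr_eq0 ?addr_ge0 ?sqr_ge0 // !sqrf_eq0.
by case/andP=> /andP[/andP[/eqP h0 /eqP h1] /eqP h2] /eqP h3; apply: quatP; rewrite !qE.
Qed.

Lemma quat_cpt q : exists2 I, isphere I &
  q = cpt I (mkC (q0 q) (qnorm (qvec q))).
Proof.
have [v0|v0] := eqVneq (qnorm (qvec q)) 0.
  exists (qi R); first exact: qi_sphere.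
  by rewrite v0 /cpt /= scale0r addr0; have /eqP := qnorm_eq0 v0; rewrite subr_eq0 => /eqP.
exists ((qnorm (qvec q))^-1 *: qvec q); last first.
  by rewrite /cpt /= scalerA mulfV // scale1r /qvec addrC subrK.
apply/isphereP; have h0 : q0 (qvec q) = 0 by rewrite /qvec !qE; ring.
move: (qvec q) v0 h0 => v v0 h0; have := qnormE v.
rewrite !qE h0; move: v0; move: (qnorm _) (q1 _) (q2 _) (q3 _) => n x y t n0 E; split; first by rewrite mulr0.
have -> : (n^-1 * x) ^+ 2 + (n^-1 * y) ^+ 2 + (n^-1 * t) ^+ 2 = n^-1 ^+ 2 * n ^+ 2 by rewrite E; ring.
by rewrite -exprMn mulVf // expr1n.
Qed.

Lemma cpt_real I z : isphere I -> qreals (cpt I z) -> im z = 0.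
Proof.
move=> hI [a _ e]; have := qnorm_sphere (im z) hI.
rewrite -(qvec_cpt z hI) -e /qvec !qE mulr1 subrr.
rewrite (_ : qnorm 0 = 0) ?/qnorm => [/esym/eqP|]; first by rewrite normr_eq0 => /eqP.
by rewrite !qE !expr0n !addr0 sqrtr0.
Qed.

(* The value at [alpha + I beta] of a slice function with complex components [p] and [v]. *)
Definition ev I (p : C) (v : 'I_3 -> C) : H :=
  cpt I p + (cpt I (v 0) * qi R + (cpt I (v 1) * qj R + cpt I (v 2) * qk R)).

Definition qre (p : C) (v : 'I_3 -> C) : H := Quat (re p) (re (v 0)) (re (v 1)) (re (v 2)).
Definition qim (p : C) (v : 'I_3 -> C) : H := Quat (im p) (im (v 0)) (im (v 1)) (im (v 2)).

Lemma evE I (p : C) (v : 'I_3 -> C) : ev I p v = qre p v + I * qim p v.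
Proof. by apply: quatP; rewrite /ev /cpt /qre /qim !qE; split; ring. Qed.

Lemma sphere_neq I : isphere I -> I != 0.
Proof.
rewrite /isphere /= => h; apply/eqP => e; move: h; rewrite e mul0r => /eqP.
by rewrite eq_sym oppr_eq0 oner_eq0.
Qed.

(** The values at two opposite units determine the stem: A is half their sum, and B then follows
    because I is invertible. *)
Lemma stem_values_inj I (A B A' B' : H) : isphere I -> A + I * B = A' + I * B' ->
  A - I * B = A' - I * B' -> A = A' /\ B = B'.
Proof.
move=> hI h1 h2.
have e : A = A'.
  have K (X Y : H) : X = 2^-1 *: ((X + Y) + (X - Y)).
    by apply: quatP; rewrite !qE; split; field.
  by rewrite (K A (I * B)) h1 h2 -K.
split => //; move: h1; rewrite e => /addrI.
have uI : I \is a GRing.unit by exact: sphere_neq.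
exact: mulrI.
Qed.

Lemma cpt_inj I z w : isphere I -> cpt I z = cpt I w -> z = w.
Proof.
move=> hI e; have e0 : re z = re w by rewrite -(cpt_coord z hI) e cpt_coord.
apply: cxP => //; move: e; rewrite /cpt e0 => /addrI /eqP.
by rewrite -subr_eq0 -scalerBl scaler_eq0 (negPf (sphere_neq hI)) orbF subr_eq0 => /eqP.
Qed.

End QuaternionSlices.

(** * Stem functions and their complex components *)

Section StemComponents.
Variable R : realType.
Local Notation C := (Cx R).
Local Notation H := (quat R).
Implicit Types (q I J : H) (a b : R) (z w : C).

Definition pt z : R * R := (re z, im z).

Lemma continuous_pt : continuous pt.
Proof.
move=> z; have c1 := @continuous_re R z; have c2 := @continuous_im R z.
exact: (cvg_pair c1 c2).
Qed.

Lemma derivable_coord (F : R * R -> H) (u v : R * R) (j : 'I_4) : derivable F u v ->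
  derivable (fun x => F x ord0 j) u v /\ 'D_v (fun x => F x ord0 j) u = 'D_v F u ord0 j.
Proof.
move=> dF; have d2 : derivable (F : R * R -> 'rV[R]_4) u v by [].
split; first by move/derivable_mxP: d2 => /(_ ord0 j).
by have /(congr1 (fun M : 'rV[R]_4 => M ord0 j)) := derive_mx d2; rewrite !mxE => <-.
Qed.

Lemma line_alpha (f : R * R -> R) a b : derivable f (a, b) ((1, 0) : R * R) ->
  is_derive a 1 (fun x => f (x, b)) ('D_((1, 0) : R * R) f (a, b)).
Proof.
have E : (fun h : R => h^-1 *: (f (h *: ((1, 0) : R * R) + (a, b)) - f (a, b))) =
  (fun h : R => h^-1 *: (f (h *: 1 + a, b) - f (a, b))).
  by apply/funext => h; congr (_ *: (f _ - _)); congr pair; rewrite /= scaler0 add0r.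
by move=> df; apply: DeriveDef; rewrite /derivable /derive -E.
Qed.

Lemma line_beta (f : R * R -> R) a b : derivable f (a, b) ((0, 1) : R * R) ->
  is_derive b 1 (fun x => f (a, x)) ('D_((0, 1) : R * R) f (a, b)).
Proof.
have E : (fun h : R => h^-1 *: (f (h *: ((0, 1) : R * R) + (a, b)) - f (a, b))) =
  (fun h : R => h^-1 *: (f (a, h *: 1 + b) - f (a, b))).
  by apply/funext => h; congr (_ *: (f _ - _)); congr pair; rewrite /= scaler0 add0r.
by move=> df; apply: DeriveDef; rewrite /derivable /derive -E.
Qed.

Lemma continuous_coord (T : topologicalType) (F : T -> H) (x : T) (j : 'I_4) :
  {for x, continuous F} -> {for x, continuous (fun y => F y ord0 j)}.
Proof.
move=> cF; apply: (@continuous_comp _ _ _ F (fun M : 'rV[R]_4 => M ord0 j) x cF).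
exact: coord_continuous.
Qed.

Variables (Omega : set H) (D : set C).
Hypothesis circ_D : forall I z, isphere I -> Omega (cpt I z) <-> D z.
Hypothesis oD : open D.

Lemma D_cj z : D z -> D (cj z).
Proof.
move=> /(circ_D z (qi_sphere R)) h; apply/(circ_D _ (sphereN (qi_sphere R))).
by rewrite cpt_cj opprK.
Qed.

Lemma stem_domainP z : stem_domain Omega (pt z) <-> D z.
Proof.
split=> [[I hI h]|Dz]; first exact/(circ_D z hI).
by exists (qi R); [exact: qi_sphere | apply/(circ_D z (qi_sphere R))].
Qed.

Lemma stem_domain_mk a b : stem_domain Omega (a, b) <-> D (mkC a b).
Proof. exact: (stem_domainP (mkC a b)). Qed.

Definition stem_comp (E : (R * R -> H) * (R * R -> H)) (j : 'I_4) z : C :=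
  mkC (E.1 (pt z) ord0 j) (E.2 (pt z) ord0 j).

(** Coordinate by coordinate, the equations between the two stem functions are the Cauchy-Riemann
    equations of F0 + sqrt(-1) F1. *)
Lemma comp_hol E j : holomorphic_stem (stem_domain Omega) E.1 E.2 -> hol D (stem_comp E j).
Proof.
case=> C0 C1 _ _ CRa CRb.
pose f' z : C := mkC (d_alpha E.1 (pt z) ord0 j) (d_alpha E.2 (pt z) ord0 j).
have cf z : D z -> {for z, continuous f'}.
  move=> /stem_domainP Dz; have [_ _ c0 _] := C0 _ Dz; have [_ _ c1 _] := C1 _ Dz.
  apply/(@cvg_reim _ _ (nbhs z)); split.
    apply: (@continuous_coord _ (fun z => d_alpha E.1 (pt z)) z j).
    exact: (@continuous_comp _ _ _ pt (d_alpha E.1) z (@continuous_pt z) c0).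
  apply: (@continuous_coord _ (fun z => d_alpha E.2 (pt z)) z j).
  exact: (@continuous_comp _ _ _ pt (d_alpha E.2) z (@continuous_pt z) c1).
move=> z Dz; apply: (holat_open oD _ cf Dz) => {z Dz}.
apply: (is_derive_CR oD) => // z /stem_domainP Dz.
have [da0 db0 _ _] := C0 _ Dz; have [da1 db1 _ _] := C1 _ Dz.
have [a0 ea0] := derivable_coord j da0; have [b0 eb0] := derivable_coord j db0.
have [a1 ea1] := derivable_coord j da1; have [b1 eb1] := derivable_coord j db1.
have la0 := line_alpha a0; have la1 := line_alpha a1.
have lb0 := line_beta b0; have lb1 := line_beta b1.
split.
- by rewrite ea0 in la0.
- by rewrite ea1 in la1.
- apply: (is_derive_eq lb0); rewrite eb0 -/(d_beta E.1 _) CRb //.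
  by rewrite /f' im_mk mxE.
- have e : d_alpha E.1 (pt z) = 'D_((0, 1) : R * R) E.2 (pt z) := CRa _ Dz.
  by rewrite eb1 -e in lb1.
Qed.

Lemma comp_sym E j z : holomorphic_stem (stem_domain Omega) E.1 E.2 -> D z ->
  stem_comp E j (cj z) = cj (stem_comp E j z).
Proof.
case=> _ _ ev od _ _ /stem_domainP Dz.
have h0 := ev (re z) (im z) Dz; have h1 := od (re z) (im z) Dz.
by apply: cxP; rewrite cj_def /stem_comp /pt /= ?h0 ?h1 // mxE.
Qed.

Definition sym_hol (f : C -> C) := hol D f /\ forall z, D z -> f (cj z) = cj (f z).

Definition slice_fun (p : C -> C) (v : 'I_3 -> C -> C) : H -> H := fun q =>
  let z := mkC (q0 q) (qnorm (qvec q)) in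
  qre (p z) (v^~ z) + ((qnorm (qvec q))^-1 *: qvec q) * qim (p z) (v^~ z).

(** [slice_fun] evaluates at the representative in the upper half-plane. If im z < 0 this replaces z
    and I by their conjugates, and the two changes of sign cancel; at a real point the components
    are real by symmetry, so the second term vanishes on both sides. *)
Lemma slice_fun_cpt p v I z : sym_hol p -> (forall l, sym_hol (v l)) -> isphere I -> D z ->
  slice_fun p v (cpt I z) = ev I (p z) (v^~ z).
Proof.
move=> hp hv hI Dz; rewrite evE /slice_fun qvec_cpt // qnorm_sphere // cpt_coord //.
have [z0|z0|z0] := ltgtP (im z) 0.
- have -> : mkC (re z) `|im z| = cj z by rewrite ltr0_norm.
  have sp := hp.2 z Dz; have sv l := (hv l).2 z Dz.
  rewrite scalerA ltr0_norm // invrN mulNr mulVf ?lt_eqF // scaleN1r.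
  have -> : qre (p (cj z)) (v^~ (cj z)) = qre (p z) (v^~ z) by rewrite /qre sp !sv.
  have -> : qim (p (cj z)) (v^~ (cj z)) = - qim (p z) (v^~ z).
    by rewrite /qim sp !sv; apply: quatP; rewrite !qE.
  by rewrite mulrNN.
- have -> : mkC (re z) `|im z| = z by rewrite gtr0_norm // mk_reim.
  by rewrite scalerA gtr0_norm // mulVf ?gt_eqF // scale1r.
have ez : cj z = z by apply: cxP; rewrite cj_def // z0 oppr0.
have -> : mkC (re z) `|im z| = z by rewrite z0 normr0 -z0 mk_reim.
have im0' (x : C) : cj x = x -> im x = 0.
  by move=> /(congr1 (@im R)); rewrite cj_def; lra.
have -> : qim (p z) (v^~ z) = 0.
  have ip : im (p z) = 0 by apply: im0'; rewrite -hp.2 // ez.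
  have iv l : im (v l z) = 0 by apply: im0'; rewrite -(hv l).2 // ez.
  by rewrite /qim ip !iv; apply: quatP; rewrite !qE.
by rewrite !mulr0.
Qed.

Lemma derive_of_line (f : C -> C) (c : C) (u v : R * R) :
  is_derive (mkC u.1 u.2) 1 f c ->
  is_derive u v (fun x : R * R => re (f (mkC x.1 x.2))) (re (c * mkC v.1 v.2)) /\
  is_derive u v (fun x : R * R => im (f (mkC x.1 x.2))) (im (c * mkC v.1 v.2)).
Proof.
move=> df; have E0 : mkC u.1 u.2 + mkC 0 0 * mkC v.1 v.2 = mkC u.1 u.2.
  by apply: cxP; rewrite !reimE; ring.
have [[d1 e1] [d2 e2]] := is_deriveC_line E0 df.
have Eh (h : R) : mkC u.1 u.2 + mkC (h *: 1 + 0) 0 * mkC v.1 v.2 = mkC (h *: v + u).1 (h *: v + u).2.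
  by apply: cxP; rewrite !reimE /= /GRing.scale /=; ring.
split; apply: DeriveDef.
- move: d1; rewrite /derivable; under eq_fun do rewrite /= Eh E0; exact.
- rewrite -e1 /derive; under [in RHS]eq_fun do rewrite /= Eh E0; by [].
- move: d2; rewrite /derivable; under eq_fun do rewrite /= Eh E0; exact.
- rewrite -e2 /derive; under [in RHS]eq_fun do rewrite /= Eh E0; by [].
Qed.

End StemComponents.

(** * Slice regularity expressed by symmetric holomorphic components *)

Section SliceCalculus.
Variable R : realType.
Local Notation C := (Cx R).
Local Notation H := (quat R).
Implicit Types (q I J : H) (a b : R) (z w : C).

Lemma QuatE a b c d : Quat a b c d = a *: 1 + b *: qi R + (c *: qj R + d *: qk R).
Proof. by apply: quatP; rewrite !qE; split; ring. Qed.

Lemma cvg_scalel (T : Type) (F : set_system T) {FF : Filter F} (f : T -> R) (l : R) (q : H) :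
  f @ F --> l -> (fun t => f t *: q) @ F --> l *: q.
Proof. by move=> h; exact: (cvgZr_tmp h). Qed.

Lemma cvg_Quat (T : Type) (F : set_system T) {FF : Filter F} (f0 f1 f2 f3 : T -> R) a b c d :
  f0 @ F --> a -> f1 @ F --> b -> f2 @ F --> c -> f3 @ F --> d ->
  (fun t => Quat (f0 t) (f1 t) (f2 t) (f3 t)) @ F --> Quat a b c d.
Proof.
move=> h0 h1 h2 h3; rewrite QuatE; under eq_fun do rewrite QuatE.
exact: (cvgD (cvgD (cvg_scalel h0) (cvg_scalel h1)) (cvgD (cvg_scalel h2) (cvg_scalel h3))).
Qed.

Lemma ord4_ind (P : 'I_4 -> Prop) : P (inord 0) -> P (inord 1) -> P (inord 2) ->
  P (inord 3) -> forall j, P j.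
Proof.
move=> p0 p1 p2 p3 j; have -> : j = inord j by rewrite inord_val.
by case: j => -[|[|[|[|//]]]].
Qed.

Lemma is_derive_Quat (f0 f1 f2 f3 : R * R -> R) (d0 d1 d2 d3 : R) (u v : R * R) :
  is_derive u v f0 d0 -> is_derive u v f1 d1 -> is_derive u v f2 d2 -> is_derive u v f3 d3 ->
  is_derive u v (fun x => Quat (f0 x) (f1 x) (f2 x) (f3 x)) (Quat d0 d1 d2 d3).
Proof.
move=> h0 h1 h2 h3.
pose F (x : R * R) : 'rV[R]_4 := Quat (f0 x) (f1 x) (f2 x) (f3 x).
have H j : is_derive u v (fun x => F x ord0 j) (Quat d0 d1 d2 d3 ord0 j).
  move: j; apply: ord4_ind.
  - have -> : (fun x => F x ord0 (inord 0)) = f0 by apply/funext => x; exact: q0_Quat.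
    by rewrite -/(q0 _) q0_Quat.
  - have -> : (fun x => F x ord0 (inord 1)) = f1 by apply/funext => x; exact: q1_Quat.
    by rewrite -/(q1 _) q1_Quat.
  - have -> : (fun x => F x ord0 (inord 2)) = f2 by apply/funext => x; exact: q2_Quat.
    by rewrite -/(q2 _) q2_Quat.
  - have -> : (fun x => F x ord0 (inord 3)) = f3 by apply/funext => x; exact: q3_Quat.
    by rewrite -/(q3 _) q3_Quat.
have dF : derivable F u v.
  by apply/derivable_mxP => i j; rewrite (ord1 i); have [] := H j.
suff : 'D_v F u = Quat d0 d1 d2 d3 by move=> ?; apply: DeriveDef.
by rewrite (derive_mx dF); apply/rowP => j; rewrite mxE; have [] := H j.
Qed.

Variables (Omega : set H) (D : set C).
Hypothesis circ_D : forall I z, isphere I -> Omega (cpt I z) <-> D z.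
Hypothesis oD : open D.

Local Notation sym_hol := (sym_hol D).

Lemma continuous_mkC : continuous (fun x : R * R => mkC x.1 x.2 : C).
Proof. by move=> [a b]; apply: cvg_mk; [exact: cvg_fst | exact: cvg_snd]. Qed.

Lemma cont_qre (p : C -> C) (v : 'I_3 -> C -> C) (x : R * R) :
  {for mkC x.1 x.2, continuous p} -> (forall l, {for mkC x.1 x.2, continuous (v l)}) ->
  {for x, continuous (fun x : R * R => qre (p (mkC x.1 x.2)) (v^~ (mkC x.1 x.2)))} /\
  {for x, continuous (fun x : R * R => qim (p (mkC x.1 x.2)) (v^~ (mkC x.1 x.2)))}.
Proof.
move=> cp cv.
have H (f : C -> C) : {for mkC x.1 x.2, continuous f} ->
    {for x, continuous (fun x : R * R => re (f (mkC x.1 x.2)))} /\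
    {for x, continuous (fun x : R * R => im (f (mkC x.1 x.2)))}.
  move=> cf; have := @continuous_comp _ _ _ (fun x : R * R => mkC x.1 x.2) f x (@continuous_mkC x) cf.
  by move/(@cvg_reim _ _ (nbhs x)).
have [p1 p2] := H _ cp; have [u1 u2] := H _ (cv 0).
have [v1 v2] := H _ (cv 1); have [w1 w2] := H _ (cv 2).
by split; [exact: (cvg_Quat p1 u1 v1 w1) | exact: (cvg_Quat p2 u2 v2 w2)].
Qed.

Definition slice_fun_stem (p : C -> C) (v : 'I_3 -> C -> C) : (R * R -> H) * (R * R -> H) :=
  (fun x => qre (p (mkC x.1 x.2)) (v^~ (mkC x.1 x.2)),
   fun x => qim (p (mkC x.1 x.2)) (v^~ (mkC x.1 x.2))).

Lemma slice_fun_holomorphic_stem p v : sym_hol p -> (forall l, sym_hol (v l)) ->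
  holomorphic_stem (stem_domain Omega) (slice_fun_stem p v).1 (slice_fun_stem p v).2.
Proof.
move=> hp hv.
pose p' : C -> C := 'D_1 p; pose v' l : C -> C := 'D_1 (v l).
have DD (x : R * R) : stem_domain Omega x -> D (mkC x.1 x.2).
  by case: x => a b /(stem_domain_mk circ_D).
have dp z : D z -> is_derive z 1 p (p' z) /\ {for z, continuous p'}.
  by move=> Dz; exact: holat_derive (hp.1 z Dz).
have dv l z : D z -> is_derive z 1 (v l) (v' l z) /\ {for z, continuous (v' l)}.
  by move=> Dz; exact: holat_derive ((hv l).1 z Dz).
have da x : stem_domain Omega x ->
    is_derive x ((1, 0) : R * R) (slice_fun_stem p v).1 (qre (p' (mkC x.1 x.2)) (v'^~ (mkC x.1 x.2))) /\
    is_derive x ((1, 0) : R * R) (slice_fun_stem p v).2 (qim (p' (mkC x.1 x.2)) (v'^~ (mkC x.1 x.2))).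
  move=> /DD Dx; have [d0 _] := dp _ Dx; have dl l := (dv l _ Dx).1.
  have one (c : C) : c * mkC (1, 0).1 (1, 0).2 = c by apply: cxP; rewrite !reimE /=; ring.
  have H (f : C -> C) c : is_derive (mkC x.1 x.2) 1 f c ->
    is_derive x ((1, 0) : R * R) (fun x : R * R => re (f (mkC x.1 x.2))) (re c) /\
    is_derive x ((1, 0) : R * R) (fun x : R * R => im (f (mkC x.1 x.2))) (im c).
    by move=> hf; have := @derive_of_line _ f c x (1, 0) hf; rewrite one.
  have [p1 p2] := H _ _ d0; have [u1 u2] := H _ _ (dl 0).
  have [v1 v2] := H _ _ (dl 1); have [w1 w2] := H _ _ (dl 2).
  by split; [exact: (is_derive_Quat p1 u1 v1 w1) | exact: (is_derive_Quat p2 u2 v2 w2)].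
have db x : stem_domain Omega x ->
    is_derive x ((0, 1) : R * R) (slice_fun_stem p v).1 (- qim (p' (mkC x.1 x.2)) (v'^~ (mkC x.1 x.2))) /\
    is_derive x ((0, 1) : R * R) (slice_fun_stem p v).2 (qre (p' (mkC x.1 x.2)) (v'^~ (mkC x.1 x.2))).
  move=> /DD Dx; have [d0 _] := dp _ Dx; have dl l := (dv l _ Dx).1.
  have ere (c : C) : re (c * mkC (0, 1).1 (0, 1).2) = - im c by rewrite !reimE /=; ring.
  have eim (c : C) : im (c * mkC (0, 1).1 (0, 1).2) = re c by rewrite !reimE /=; ring.
  have H (f : C -> C) c : is_derive (mkC x.1 x.2) 1 f c ->
    is_derive x ((0, 1) : R * R) (fun x : R * R => re (f (mkC x.1 x.2))) (- im c) /\
    is_derive x ((0, 1) : R * R) (fun x : R * R => im (f (mkC x.1 x.2))) (re c).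
    by move=> hf; have := @derive_of_line _ f c x (0, 1) hf; rewrite ere eim.
  have -> : - qim (p' (mkC x.1 x.2)) (v'^~ (mkC x.1 x.2)) =
      Quat (- im (p' (mkC x.1 x.2))) (- im (v' 0 (mkC x.1 x.2)))
           (- im (v' 1 (mkC x.1 x.2))) (- im (v' 2 (mkC x.1 x.2))).
    by apply: quatP; rewrite !qE.
  have [p1 p2] := H _ _ d0; have [u1 u2] := H _ _ (dl 0).
  have [v1 v2] := H _ _ (dl 1); have [w1 w2] := H _ _ (dl 2).
  by split; [exact: (is_derive_Quat p1 u1 v1 w1) | exact: (is_derive_Quat p2 u2 v2 w2)].
have oS x : stem_domain Omega x -> nbhs x (stem_domain Omega).
  move=> Dx; have : nbhs (mkC x.1 x.2) D by apply: open_nbhs_nbhs; split => //; exact: DD.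
  move=> /(@continuous_mkC x) h; have h' : \forall y \near x, D (mkC y.1 y.2) by exact: h.
  apply: filterS h' => -[a b] /= hab.
  exact/(stem_domain_mk circ_D).
have cts x (F : R * R -> H) (G : R * R -> H) (u : R * R) : stem_domain Omega x ->
    (forall y, stem_domain Omega y -> is_derive y u F (G y)) -> {for x, continuous G} ->
    {for x, continuous ('D_u F : R * R -> H)}.
  move=> Dx dF cG.
  have E : \forall y \near x, G y = 'D_u F y.
    have h' : \forall y \near x, stem_domain Omega y by exact: oS.
    by apply: filterS h' => y /dF [_ ->].
  have cG1 : G @ nbhs x --> 'D_u F x by rewrite -(nbhs_singleton E).
  by apply: cvg_trans cG1; exact: (near_eq_cvg E).
have cc x : stem_domain Omega x ->
    {for x, continuous (fun x : R * R => qre (p' (mkC x.1 x.2)) (v'^~ (mkC x.1 x.2)))} /\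
    {for x, continuous (fun x : R * R => qim (p' (mkC x.1 x.2)) (v'^~ (mkC x.1 x.2)))}.
  move=> /DD Dx; apply: cont_qre; first by have [] := dp _ Dx.
  by move=> l; have [] := dv l _ Dx.
split.
- move=> x Dx; have [[d1 _] _] := da x Dx; have [[d2 _] _] := db x Dx.
  have [c1 c2] := cc x Dx; split; [exact: d1 | exact: d2 | |].
    by apply: (cts x _ _ _ Dx _ c1) => y hy; have [h _] := da y hy; exact: h.
  apply: (cts x _ (fun x : R * R => - qim (p' (mkC x.1 x.2)) (v'^~ (mkC x.1 x.2))) _ Dx).
    by move=> y hy; have [h _] := db y hy; exact: h.
  exact: (cvgN c2).
- move=> x Dx; have [_ [d1 _]] := da x Dx; have [_ [d2 _]] := db x Dx.
  have [c1 c2] := cc x Dx; split; [exact: d1 | exact: d2 | |].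
    by apply: (cts x _ _ _ Dx _ c2) => y hy; have [_ h] := da y hy; exact: h.
  by apply: (cts x _ _ _ Dx _ c1) => y hy; have [_ h] := db y hy; exact: h.
- move=> a b /(stem_domain_mk circ_D) Dz; rewrite /=.
  have -> : mkC a (- b) = cj (mkC a b) by [].
  by rewrite /qre (hp.2 _ Dz) !((hv _).2 _ Dz).
- move=> a b /(stem_domain_mk circ_D) Dz; rewrite /=.
  have -> : mkC a (- b) = cj (mkC a b) by [].
  by rewrite /qim (hp.2 _ Dz) !((hv _).2 _ Dz); apply: quatP; rewrite !qE.
- by move=> x Dx; have [[_ e1] _] := da x Dx; have [_ [_ e2]] := db x Dx; rewrite /d_alpha /d_beta e1 e2.
- by move=> x Dx; have [_ [_ e1]] := da x Dx; have [[_ e2] _] := db x Dx; rewrite /d_alpha /d_beta e1 e2.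
Qed.

(** The working form of slice regularity, equivalent to it by [slice_regularP]: [p] is the scalar
    component, [v] the vector one, and both are unique on [D] by [comps_unique]. *)
Definition has_comps (f : H -> H) (p : C -> C) (v : 'I_3 -> C -> C) :=
  [/\ sym_hol p, forall l, sym_hol (v l) &
    forall I z, isphere I -> D z -> f (cpt I z) = ev I (p z) (v^~ z)].

Lemma stem_comps f E : is_stem Omega f E -> has_comps f (stem_comp E (inord 0)) (fun l => stem_comp E (inord l.+1)).
Proof.
case=> hE iE; split=> [|l|I z hI Dz].
- by split=> [|z Dz]; [exact: (comp_hol circ_D) | exact: (comp_sym circ_D)].
- by split=> [|z Dz]; [exact: (comp_hol circ_D) | exact: (comp_sym circ_D)].
rewrite (iE I (re z) (im z) hI); last exact/(circ_D z hI).
rewrite evE; congr (_ + _ * _); apply: quatP; rewrite !Quat_coord; split => //.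
Qed.

Lemma comps_stem f p v : has_comps f p v -> is_stem Omega f (slice_fun_stem p v).
Proof.
case=> hp hv hf; split; first exact: slice_fun_holomorphic_stem.
move=> I a b hI Om; have Dz : D (mkC a b) by apply/(circ_D _ hI).
by rewrite (hf I (mkC a b) hI Dz) evE.
Qed.

Lemma slice_regularP f : slice_regular Omega f <-> exists p v, has_comps f p v.
Proof.
split=> [[E hE]|[p [v h]]]; first by do 2 eexists; exact: stem_comps hE.
by exists (slice_fun_stem p v); exact: comps_stem.
Qed.

Lemma qre_inj (p p' : C) (v v' : 'I_3 -> C) : qre p v = qre p' v' -> qim p v = qim p' v' ->
  p = p' /\ v = v'.
Proof.
move=> /qeqP; rewrite !qE => -[a0 a1 a2 a3] /qeqP; rewrite !qE => -[b0 b1 b2 b3].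
split; first exact: cxP.
apply/funext => l; have : l \in [:: 0; 1; 2] by case: l => -[|[|[|//]]].
by rewrite !inE => /or3P[] /eqP ->; exact: cxP.
Qed.

Lemma comps_unique f p v p' v' : has_comps f p v -> has_comps f p' v' ->
  forall z, D z -> p z = p' z /\ v^~ z = v'^~ z.
Proof.
move=> [_ _ h] [_ _ h'] z Dz; have hI := qi_sphere R.
have e1 : qre (p z) (v^~ z) + qi R * qim (p z) (v^~ z) =
    qre (p' z) (v'^~ z) + qi R * qim (p' z) (v'^~ z).
  by rewrite -!evE -h // -h'.
have e2 : qre (p z) (v^~ z) - qi R * qim (p z) (v^~ z) =
    qre (p' z) (v'^~ z) - qi R * qim (p' z) (v'^~ z).
  by rewrite -!mulNr -!evE -h // ?h' //; exact: sphereN.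
have [a b] := stem_values_inj hI e1 e2.
exact: qre_inj.
Qed.

End SliceCalculus.

(** * Real part, conjugate, product and exponential in terms of components *)

Section SliceAlgebra.
Variable R : realType.
Local Notation C := (Cx R).
Local Notation H := (quat R).
Implicit Types (q I J : H) (a b : R) (z w : C).
Variables (Omega : set H) (D : set C).
Hypothesis circ_D : forall I z, isphere I -> Omega (cpt I z) <-> D z.
Hypothesis oD : open D.

Local Notation sym_hol := (sym_hol D).
Local Notation has_comps := (has_comps D).

Definition vec3 (x y t : C) : 'I_3 -> C := fun l => nth 0 [:: x; y; t] l.

Lemma ev0 I (p : C) : ev I p (fun=> 0) = cpt I p.
Proof. by rewrite /ev /cpt !re0 !im0 !scale0r !addr0 !mul0r !addr0. Qed.

Lemma sym_hol_cst (c : C) : cj c = c -> sym_hol (fun=> c).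
Proof. by move=> cc; split=> [z _|z _]; [exact: holat_cst | rewrite cc]. Qed.

Lemma sym_hol0 : sym_hol (fun=> 0).
Proof. by apply: sym_hol_cst; rewrite cj0. Qed.

Lemma Omega_cpt q : Omega q -> exists I z, [/\ isphere I, D z, 0 <= im z & q = cpt I z].
Proof.
have [I hI e] := quat_cpt q; move=> Oq; exists I, (mkC (q0 q) (qnorm (qvec q))).
split => //; last exact: qnorm_ge0.
by apply/(circ_D _ hI); rewrite -e.
Qed.

Lemma slice_plane_cpt I z : slice_plane I (cpt I z).
Proof. by exists (re z), (im z). Qed.

Lemma slice_planeN I : slice_plane (- I) `<=` slice_plane I.
Proof. by move=> _ [a [b ->]]; exists a, (- b); rewrite scalerN scaleNr. Qed.

Lemma qj_sphere : isphere (qj R).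
Proof. by apply/isphereP; rewrite !qE; split; ring. Qed.

(** Preservation of the plane of i, tested at i and -i, kills the components along j and k; the
    plane of j kills the one along i. *)
Lemma slice_preserving_comps f : slice_preserving Omega f -> exists2 p, sym_hol p &
  forall I z, isphere I -> D z -> f (cpt I z) = cpt I (p z).
Proof.
case=> /(slice_regularP circ_D oD)[p [v [hp hv hf]]] pres; exists p => // I z hI Dz.
have mem J : isphere J -> slice_plane J (f (cpt J z)) /\ slice_plane J (f (cpt (- J) z)).
  move=> hJ; split.
    by apply: (pres J hJ); exists (cpt J z) => //; split; [exact/(circ_D z hJ) | exact: slice_plane_cpt].
  have hJ' := sphereN hJ; apply: slice_planeN.
  by apply: (pres _ hJ'); exists (cpt (- J) z) => //; split; [exact/(circ_D z hJ') | exact: slice_plane_cpt].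
have [[a1 [b1 e1]] [a2 [b2 e2]]] := mem _ (qi_sphere R).
rewrite hf ?evE // in e1; last exact: qi_sphere.
rewrite hf ?evE // in e2; last exact/sphereN/qi_sphere.
move/qeqP: e1; rewrite /qre /qim !qE => -[_ _ e12 e13].
move/qeqP: e2; rewrite /qre /qim !qE => -[_ _ e22 e23].
have [[a3 [b3 e3]] [a4 [b4 e4]]] := mem _ qj_sphere.
rewrite hf ?evE // in e3; last exact: qj_sphere.
rewrite hf ?evE // in e4; last exact/sphereN/qj_sphere.
move/qeqP: e3; rewrite /qre /qim !qE => -[_ e31 _ e33].
move/qeqP: e4; rewrite /qre /qim !qE => -[_ e41 _ e43].
have v1 : v 1 z = 0 by apply: cxP; rewrite ?re0 ?im0; lra.
have v2 : v 2 z = 0 by apply: cxP; rewrite ?re0 ?im0; lra.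
have v0 : v 0 z = 0 by apply: cxP; rewrite ?re0 ?im0; lra.
rewrite hf // -ev0; congr ev; apply/funext => l.
have : l \in [:: 0; 1; 2] by case: l => -[|[|[|//]]].
by rewrite !inE => /or3P[] /eqP ->.
Qed.

(** The real part is an arbitrary choice among decompositions: one exists, built from the
    components, and any other has the same components by uniqueness. *)
Lemma real_part_ev f p v : has_comps f p v ->
  forall I z, isphere I -> D z -> real_part Omega f (cpt I z) = cpt I (p z).
Proof.
move=> hf; have [hp hv fE] := hf.
have sp u : sym_hol u -> slice_preserving Omega (slice_fun u (fun _ _ => 0)).
  move=> hu.
  have uE I z : isphere I -> D z -> slice_fun u (fun _ _ => 0) (cpt I z) = cpt I (u z).
    by move=> hI Dz; rewrite (slice_fun_cpt hu (fun=> sym_hol0)) // ev0.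
  split.
    apply/(slice_regularP circ_D oD); exists u, (fun _ _ => 0); split => //.
      by move=> _; exact: sym_hol0.
    by move=> I z hI Dz; rewrite uE // ev0.
  move=> I hI _ [q [Oq [a [b e]]] <-]; move: Oq; rewrite e => Oq.
  have Dz : D (mkC a b) by apply/(circ_D _ hI).
  by rewrite -[_ + _]/(cpt I (mkC a b)) uE //; exact: slice_plane_cpt.
have ex : is_real_part Omega f (slice_fun p (fun _ _ => 0)).
  exists (slice_fun (v 0) (fun _ _ => 0)), (slice_fun (v 1) (fun _ _ => 0)), (slice_fun (v 2) (fun _ _ => 0)).
  split; try exact: sp.
  move=> q /Omega_cpt[I [z [hI Dz _ ->]]]; rewrite fE //.
  have uE u : sym_hol u -> slice_fun u (fun _ _ => 0) (cpt I z) = cpt I (u z).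
    by move=> hu; rewrite (slice_fun_cpt hu (fun=> sym_hol0)) // ev0.
  by rewrite !uE // /ev !addrA.
have := xgetPex (cst 0) (ex_intro (is_real_part Omega f) _ ex).
rewrite -/(real_part Omega f) => -[f1 [f2 [f3 [s0 s1 s2 s3 E]]]].
have [u0 hu0 E0] := slice_preserving_comps s0.
have [u1 hu1 E1] := slice_preserving_comps s1.
have [u2 hu2 E2] := slice_preserving_comps s2.
have [u3 hu3 E3] := slice_preserving_comps s3.
have hf' : has_comps f u0 (fun l z => vec3 (u1 z) (u2 z) (u3 z) l).
  split => //.
    move=> l; have : l \in [:: 0; 1; 2] by case: l => -[|[|[|//]]].
    by rewrite !inE => /or3P[] /eqP ->.
  move=> I z hI Dz; rewrite E; last exact/(circ_D z hI).
  by rewrite E0 // E1 // E2 // E3 // /ev !addrA.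
move=> I z hI Dz; rewrite E0 //; congr cpt.
by have [-> _] := comps_unique hf hf' Dz.
Qed.

(** With [hmv], the scalar and vector parts of the Hamilton product of two quaternions with complex
    coefficients. *)
Definition hm0 (p : C) (v : 'I_3 -> C) (p' : C) (v' : 'I_3 -> C) : C :=
  p * p' - (v 0 * v' 0 + v 1 * v' 1 + v 2 * v' 2).
Definition hmv (p : C) (v : 'I_3 -> C) (p' : C) (v' : 'I_3 -> C) : 'I_3 -> C :=
  vec3 (p * v' 0 + v 0 * p' + v 1 * v' 2 - v 2 * v' 1)
       (p * v' 1 - v 0 * v' 2 + v 1 * p' + v 2 * v' 0)
       (p * v' 2 + v 0 * v' 1 - v 1 * v' 0 + v 2 * p').

Lemma qre_hm p v p' v' : qre (hm0 p v p' v') (hmv p v p' v') =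
  qre p v * qre p' v' - qim p v * qim p' v'.
Proof.
by apply: quatP; rewrite /qre /qim /hm0 /hmv /vec3 /= !reimE !qE; split; ring.
Qed.

Lemma qim_hm p v p' v' : qim (hm0 p v p' v') (hmv p v p' v') =
  qre p v * qim p' v' + qim p v * qre p' v'.
Proof.
by apply: quatP; rewrite /qre /qim /hm0 /hmv /vec3 /= !reimE !qE; split; ring.
Qed.

(* [(f * g)(q) = f(q) g(f(q)^-1 q f(q))] becomes the product of complexified quaternions. *)
Lemma star_ev f h z p v p' v' :
  (forall I, isphere I -> f (cpt I z) = ev I p v) ->
  (forall I, isphere I -> h (cpt I z) = ev I p' v') ->
  forall I, isphere I -> star f h (cpt I z) = ev I (hm0 p v p' v') (hmv p v p' v').
Proof.
move=> hf hh I hI.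
have E x : x = ev I p v -> ev I (hm0 p v p' v') (hmv p v p' v') = x * qre p' v' + I * x * qim p' v'.
  move=> ->; rewrite !evE qre_hm qim_hm.
  have II : I * I = -1 by [].
  move: (qre p v) (qim p v) (qre p' v') (qim p' v') => A B P Q.
  have -> : I * (A + I * B) * Q = I * (A * Q) - B * Q.
    by rewrite mulrDr mulrDl [I * (I * B)]mulrA II mulN1r mulNr mulrA.
  have -> : (A + I * B) * P = A * P + I * (B * P) by rewrite mulrDl mulrA.
  rewrite mulrDr -!addrA; congr (_ + _).
  by rewrite [LHS]addrC -addrA [RHS]addrCA.
rewrite /star; case: eqVneq => [f0|f0].
  by rewrite (E 0) ?mulr0 ?mul0r ?addr0 // -hf // f0.
set x := f (cpt I z) in f0 *.
have ux : x \is a GRing.unit by [].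
have -> : x^-1 * cpt I z * x = cpt (x^-1 * I * x) z.
  have := mulVr ux; move: x^-1 => y yx.
  by rewrite /cpt mulrDr mulrDl -!scalerAr mulr1 -!scalerAl yx.
rewrite hh; last exact: sphere_conj.
rewrite (E x (hf I hI)) evE mulrDr; congr (_ + _).
by rewrite !mulrA divrr // mul1r.
Qed.

(** The stem pair behind the conjugate is an arbitrary choice too; its values on the domain are
    forced by those of [f] at two opposite units. *)
Lemma slice_conj_ev f p v : has_comps f p v -> forall I z, isphere I -> D z ->
  slice_conj Omega f (cpt I z) = ev I (p z) (fun l => - v l z).
Proof.
move=> hf; have [hp hv fE] := hf.
have ex : is_stem Omega f (slice_fun_stem p v) by exact: (comps_stem circ_D oD hf).
have := xgetPex (cst 0, cst 0) (ex_intro (is_stem Omega f) _ ex).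
rewrite -/(stem Omega f); set E := stem Omega f => hE.
have EE z : D z -> E.1 (pt z) = qre (p z) (v^~ z) /\ E.2 (pt z) = qim (p z) (v^~ z).
  move=> Dz; have hI := qi_sphere R; case: hE => _ iE.
  apply: (stem_values_inj hI).
    by rewrite -evE -fE // (iE (qi R) (re z) (im z) hI) //; exact/(circ_D z hI).
  have hI' := sphereN hI.
  by rewrite -!mulNr -evE -fE // (iE (- qi R) (re z) (im z) hI') //; exact/(circ_D z hI').
move=> I z hI Dz.
have hN l : sym_hol (fun z => - v l z).
  by split=> [w Dw|w Dw]; [exact/holatN/(hv l).1 | rewrite (hv l).2 // cjN].
rewrite -(slice_fun_cpt hp hN hI Dz) /slice_fun /slice_conj /Defs.induced.
rewrite qvec_cpt // qnorm_sphere // cpt_coord //.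
have Dz' : D (mkC (re z) `|im z|).
  have [h|h] := leP 0 (im z); first by rewrite ger0_norm // mk_reim.
  by rewrite ltr0_norm //; exact: (D_cj circ_D Dz).
have [e1 e2] := EE _ Dz'.
rewrite -/E /= -[(re z, _)]/(pt (mkC (re z) `|im z|)) e1 e2.
by congr (_ + _ * _); rewrite /qconj /qre /qim !qE ?reN ?imN.
Qed.

Lemma symm_ev f p v : has_comps f p v -> forall I z, isphere I -> D z ->
  symm Omega f (cpt I z) = cpt I (p z ^+ 2 + cdot (v^~ z) (v^~ z)).
Proof.
move=> hf I z hI Dz; have [hp hv fE] := hf.
rewrite /symm (star_ev (p := p z) (v := v^~ z) (p' := p z) (v' := fun l => - v l z)) //.
- rewrite -ev0; congr ev.
    rewrite /hm0 /cdot !big_ord_recl big_ord0.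
    rewrite (_ : lift ord0 ord0 = 1); last exact/val_inj.
    rewrite (_ : lift ord0 (lift ord0 ord0) = 2); last exact/val_inj.
    by rewrite -[ord0]/(0 : 'I_3); ring.
  apply/funext => l; have : l \in [:: 0; 1; 2] by case: l => -[|[|[|//]]].
  by rewrite !inE => /or3P[] /eqP ->; rewrite /hmv /vec3 /=; ring.
- by move=> J hJ; exact: fE.
- by move=> J hJ; rewrite (slice_conj_ev hf).
Qed.

Lemma vector_part_comps g p v : has_comps g p v ->
  has_comps (vector_part Omega g) (fun=> 0) v.
Proof.
move=> hg; have [hp hv gE] := hg; split => //; first exact: sym_hol0.
move=> I z hI Dz; rewrite /vector_part gE // (real_part_ev hg) //.
have c0 : cpt I (0 : C) = 0 by rewrite /cpt re0 im0 !scale0r addr0.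
by rewrite /ev addrAC subrr add0r c0 add0r.
Qed.

Lemma star_pow_ev f (F : 'I_3 -> C -> C) : has_comps f (fun=> 0) F ->
  forall n I z, isphere I -> D z -> star_pow f n (cpt I z) =
    ev I (pow_vec (cdot (F^~ z) (F^~ z)) n).1
         (fun l => (pow_vec (cdot (F^~ z) (F^~ z)) n).2 * F l z).
Proof.
move=> hf; have [_ _ fE] := hf; elim=> [|n IH] I z hI Dz.
  rewrite /=; have -> : (fun l : 'I_3 => 0 * F l z) = fun=> 0 by apply/funext => l; rewrite mul0r.
  by rewrite ev0 /cpt re1 im1 scale0r addr0 scale1r.
transitivity (star f (star_pow f n) (cpt I z)); first by [].
rewrite (star_ev (fun J hJ => fE J z hJ Dz) (fun J hJ => IH J z hJ Dz) hI) /=.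
set x := pow_vec _ n; congr ev.
  rewrite /hm0 /cdot !big_ord_recl big_ord0.
  rewrite (_ : lift ord0 ord0 = 1); last exact/val_inj.
  rewrite (_ : lift ord0 (lift ord0 ord0) = 2); last exact/val_inj.
  by rewrite -[ord0]/(0 : 'I_3); ring.
apply/funext => l; have : l \in [:: 0; 1; 2] by case: l => -[|[|[|//]]].
by rewrite !inE => /or3P[] /eqP ->; rewrite /hmv /vec3 /=; ring.
Qed.

Lemma evD I p v p' v' : ev I p v + ev I p' v' = ev I (p + p') (fun l => v l + v' l).
Proof. by rewrite !evE; apply: quatP; rewrite /qre /qim !reimE !qE; split; ring. Qed.

Lemma evZ I a p v : a *: ev I p v = ev I (mkC a 0 * p) (fun l => mkC a 0 * v l).
Proof. by rewrite !evE; apply: quatP; rewrite /qre /qim !reimE !qE; split; ring. Qed.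

Lemma ev_sum I (c : nat -> R) (p : nat -> C) (v : nat -> 'I_3 -> C) n :
  \sum_(0 <= k < n) c k *: ev I (p k) (v k) =
  ev I (\sum_(0 <= k < n) mkC (c k) 0 * p k) (fun l => \sum_(0 <= k < n) mkC (c k) 0 * v k l).
Proof.
elim: n => [|n IH].
  rewrite !big_geq //; have -> : (fun l : 'I_3 => \sum_(0 <= k < 0) mkC (c k) 0 * v k l) = fun=> 0.
    by apply/funext => l; rewrite big_geq.
  by rewrite ev0 /cpt re0 im0 !scale0r addr0.
rewrite !big_nat_recr //= IH evZ evD; congr ev.
by apply/funext => l; rewrite big_nat_recr.
Qed.

Lemma cvg_ev I (p : nat -> C) (v : nat -> 'I_3 -> C) (x : C) (y : 'I_3 -> C) :
  p @ \oo --> x -> (forall l, (fun n => v n l) @ \oo --> y l) ->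
  (fun n => ev I (p n) (v n)) @ \oo --> ev I x y.
Proof.
move=> px vy.
have E p' v' : ev I p' v' = re p' *: 1 + im p' *: I +
   (re (v' 0) *: qi R + im (v' 0) *: (I * qi R) +
    (re (v' 1) *: qj R + im (v' 1) *: (I * qj R) +
     (re (v' 2) *: qk R + im (v' 2) *: (I * qk R)))).
  by rewrite /ev /cpt !mulrDl -!scalerAl !mul1r.
have cp (u : nat -> C) (l : C) (q q' : H) : u @ \oo --> l ->
    (fun n => re (u n) *: q + im (u n) *: q') @ \oo --> re l *: q + im l *: q'.
  by move=> /cvg_reim[c1 c2]; exact: (cvgD (cvg_scalel c1) (cvg_scalel c2)).
rewrite E; under eq_fun do rewrite E.
exact: (cvgD (cp _ _ _ _ px) (cvgD (cp _ _ _ _ (vy 0)) (cvgD (cp _ _ _ _ (vy 1)) (cp _ _ _ _ (vy 2))))).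
Qed.

(* [exp (mu w) = cos mu + sin mu w] when [w * w = -1], with a degenerate case at [mu = 0]. *)
Definition expsol (g0 : C) (G : 'I_3 -> C) (e : 'I_3 -> C) :=
  (exists (mu : C) (w : 'I_3 -> C), [/\ forall l, e l = mu * w l, cdot w w = 1, ccos mu = g0 &
     forall l, G l = csin mu * w l]) \/
  [/\ forall l, e l = G l, cdot G G = 0 & g0 = 1].

(** Every point of Omega is alpha + I beta with beta >= 0, so the pointwise equation is needed only
    in the closed upper half-plane. *)
Lemma star_exp_ev f g p v (F : 'I_3 -> C -> C) : has_comps g p v ->
  has_comps f (fun=> 0) F ->
  (forall z, D z -> 0 <= im z -> expsol (p z) (v^~ z) (F^~ z)) -> is_star_exp Omega f g.
Proof.
move=> [_ _ gE] hf sol q /Omega_cpt[I [z [hI Dz iz ->]]].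
rewrite gE //.
have E n : \sum_(0 <= k < n) (k`!%:R : R)^-1 *: star_pow f k (cpt I z) =
    ev I (\sum_(0 <= k < n) fact_inv R k * (pow_vec (cdot (F^~ z) (F^~ z)) k).1)
      (fun l => \sum_(0 <= k < n) fact_inv R k * ((pow_vec (cdot (F^~ z) (F^~ z)) k).2 * F l z)).
  under eq_bigr do rewrite (star_pow_ev hf _ hI Dz).
  exact: (ev_sum I (fun k => (k`!%:R)^-1) (fun k => (pow_vec _ k).1) (fun k l => (pow_vec _ k).2 * F l z)).
rewrite (funext E); apply: cvg_ev.
  case: (sol z Dz iz) => [[mu [w [eF w1 c0 cv]]]|[eF G0 c0]].
    have -> : cdot (F^~ z) (F^~ z) = mu ^+ 2.
      have -> : F^~ z = fun l => mu * w l by apply/funext.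
      by rewrite cdotZ cdotC cdotZ w1 mulr1.
    rewrite -c0; have [h _] := cvg_pow_vec mu 0; exact: h.
  have -> : cdot (F^~ z) (F^~ z) = 0.
    by have -> : F^~ z = v^~ z by apply/funext.
  rewrite c0; have [h _] := cvg_pow_vec0 R; exact: h.
move=> l; case: (sol z Dz iz) => [[mu [w [eF w1 c0 cv]]]|[eF G0 c0]].
  have -> : cdot (F^~ z) (F^~ z) = mu ^+ 2.
    have -> : F^~ z = fun l => mu * w l by apply/funext.
    by rewrite cdotZ cdotC cdotZ w1 mulr1.
  rewrite cv; have [_ h] := cvg_pow_vec mu (w l).
  by under eq_fun do under eq_bigr do rewrite eF; exact: h.
have -> : cdot (F^~ z) (F^~ z) = 0.
  by have -> : F^~ z = v^~ z by apply/funext.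
have [_ h] := cvg_pow_vec0 R.
have h2 : (fun n => (\sum_(0 <= k < n) fact_inv R k * (pow_vec 0 k).2) * v l z) @ \oo --> 1 * v l z.
  exact: (cvgMr_tmp h).
rewrite mul1r in h2.
have E2 n : \sum_(0 <= k < n) fact_inv R k * ((pow_vec 0 k).2 * F l z) =
    (\sum_(0 <= k < n) fact_inv R k * (pow_vec 0 k).2) * v l z.
  by rewrite mulr_suml; apply: eq_bigr => k _; rewrite eF mulrA.
by rewrite (funext E2); exact: h2.
Qed.

End SliceAlgebra.

(** * Non-real isolated zeroes *)

Section IsolatedZeros.
Variable R : realType.
Local Notation C := (Cx R).
Local Notation H := (quat R).
Implicit Types (q I J : H) (a b : R) (z w y : C).

Lemma cptD I z w : cpt I (z + w) = cpt I z + cpt I w.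
Proof. by rewrite /cpt reD imD !scalerDl addrACA. Qed.

Lemma cptM I z w : isphere I -> cpt I (z * w) = cpt I z * cpt I w.
Proof.
move=> hI; have II : I * I = -1 by [].
rewrite /cpt reM imM mulrDl !mulrDr -!scalerAl -!scalerAr !mul1r !mulr1 II.
rewrite !scalerA scalerN scalerBl !scalerDl -!addrA; congr (_ + _).
by rewrite addrC addrA.
Qed.

Lemma cpt1 I : cpt I 1 = 1.
Proof. by rewrite /cpt re1 im1 scale1r scale0r addr0. Qed.

Lemma cptX I z n : isphere I -> cpt I (z ^+ n) = cpt I z ^+ n.
Proof.
move=> hI; elim: n => [|n IH]; first by rewrite !expr0 cpt1.
by rewrite !exprS cptM // IH.
Qed.

Lemma cpt_ev I z p v : isphere I -> cpt I z * ev I p v = ev I (z * p) (fun l => z * v l).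
Proof.
move=> hI; rewrite /ev !cptM //.
move: (cpt I z) (cpt I p) (cpt I (v 0)) (cpt I (v 1)) (cpt I (v 2)) => a b c d e.
by rewrite !mulrDr !mulrA.
Qed.

Lemma Delta_cpt I J z y : isphere I -> isphere J ->
  Delta (cpt I z) (cpt J y) = cpt J ((y - z) * (y - cj z)).
Proof.
move=> hI hJ; rewrite /Delta cpt_coord // qnorm_cpt // -cptX //.
have E (a : R) x : a *: cpt J x = cpt J (mkC a 0 * x).
  by rewrite /cpt scalerDr !scalerA !reimE !mul0r subr0 addr0.
have E1 (a : R) : a%:A = cpt J (mkC a 0) by rewrite /cpt /= scale0r addr0.
have EN x : - cpt J x = cpt J (- x) by rewrite /cpt reN imN !scaleNr opprD.
rewrite E E1 EN -!cptD; congr cpt.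
by apply: cxP; rewrite !expr2 !(reimE, cj_def); ring.
Qed.

(** Write v = a + sqrt(-1) b with a, b real vectors: isotropy means that a and b are orthogonal and
    of equal length. For nonzero b the unit I = (a x b) / |b|^2 satisfies I b = - a. *)
Lemma isotropic_sphere (v : 'I_3 -> C) : cdot v v = 0 -> exists2 I, isphere I & ev I 0 v = 0.
Proof.
move=> h.
have Ed : cdot v v = v 0 * v 0 + v 1 * v 1 + v 2 * v 2.
  rewrite /cdot !big_ord_recl big_ord0 addr0 addrA.
  rewrite (_ : lift ord0 ord0 = 1); last exact/val_inj.
  by rewrite (_ : lift ord0 (lift ord0 ord0) = 2); last exact/val_inj.
rewrite Ed in h; have hr := congr1 (@re R) h; have hi := congr1 (@im R) h.
move: hr hi; rewrite !reimE => hr hi.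
suff [I hI e] : exists2 I, isphere I & qre 0 v + I * qim 0 v = 0 by exists I => //; rewrite evE.
rewrite /qre /qim re0 im0; clear h Ed.
move: (re (v 0)) (re (v 1)) (re (v 2)) (im (v 0)) (im (v 1)) (im (v 2)) hr hi => a1 a2 a3 b1 b2 b3 hr hi.
pose N := b1 ^+ 2 + b2 ^+ 2 + b3 ^+ 2.
have Na : a1 ^+ 2 + a2 ^+ 2 + a3 ^+ 2 = N by rewrite /N; move: hr; rewrite !expr2; lra.
have ab : a1 * b1 + a2 * b2 + a3 * b3 = 0.
  by move: hi; rewrite [b1 * _]mulrC [b2 * _]mulrC [b3 * _]mulrC; lra.
have [N0|N0] := eqVneq N 0.
  have z3 (x y t : R) : x ^+ 2 + y ^+ 2 + t ^+ 2 = 0 -> [/\ x = 0, y = 0 & t = 0].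
    move/eqP; rewrite !paddr_eq0 ?addr_ge0 ?sqr_ge0 // !sqrf_eq0.
    by case/andP=> /andP[/eqP -> /eqP ->] /eqP ->.
  have [-> -> ->] := z3 _ _ _ N0; rewrite N0 in Na; have [-> -> ->] := z3 _ _ _ Na.
  exists (qi R); first exact: qi_sphere.
  by apply: quatP; rewrite !qE; split; ring.
(* The normalised cross product; Lagrange's identity shows that it is a unit. *)
exists (Quat 0 (N^-1 * (a2 * b3 - a3 * b2)) (N^-1 * (a3 * b1 - a1 * b3)) (N^-1 * (a1 * b2 - a2 * b1))).
  apply/isphereP; rewrite !qE; split => //.
  transitivity (N^-1 ^+ 2 * ((a1 ^+ 2 + a2 ^+ 2 + a3 ^+ 2) * N - (a1 * b1 + a2 * b2 + a3 * b3) ^+ 2)).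
    by rewrite /N; move: (_^-1) => m; ring.
  by rewrite Na ab expr0n subr0 -expr2 -exprMn mulVf // expr1n.
have K (x y : R) : N^-1 * (y * (a1 * b1 + a2 * b2 + a3 * b3) - x * N) = - x.
  by rewrite ab mulr0 sub0r mulrN mulrC mulfK.
have [k1 k2 k3] := And3 (K a1 b1) (K a2 b2) (K a3 b3).
apply: quatP; rewrite !qE; split.
- by ring.
- apply/eqP; rewrite -[0](subrr a1) -[X in _ == _ + X]k1 /N; apply/eqP; move: (_^-1) => m; ring.
- apply/eqP; rewrite -[0](subrr a2) -[X in _ == _ + X]k2 /N; apply/eqP; move: (_^-1) => m; ring.
- apply/eqP; rewrite -[0](subrr a3) -[X in _ == _ + X]k3 /N; apply/eqP; move: (_^-1) => m; ring.
Qed.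

Variables (Omega : set H) (D : set C).
Hypothesis circ_D : forall I z, isphere I -> Omega (cpt I z) <-> D z.
Hypothesis oD : open D.
Local Notation has_comps := (has_comps D).
Variables (gv : H -> H) (G : 'I_3 -> C -> C).
Hypothesis gvG : has_comps gv (fun=> 0) G.

Definition badz z := exists2 I, isphere I & nonreal_isolated_zero Omega gv (cpt I z).

Let dl z y := (y - z) * (y - cj z).

Let dl_sym z : sym_hol D (dl z).
Proof.
split=> y Dy.
  apply: holatM; apply: holatB; solve [exact: holat_id | exact: holat_cst].
by rewrite /dl cjM !cjB cjK mulrC.
Qed.

Lemma sym_holM f h : sym_hol D f -> sym_hol D h -> sym_hol D (fun z => f z * h z).
Proof.
move=> [f1 f2] [h1 h2]; split=> z Dz; first by apply: holatM; [exact: f1 | exact: h1].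
by rewrite f2 // h2 // cjM.
Qed.

Lemma sym_holX f n : sym_hol D f -> sym_hol D (fun z => f z ^+ n).
Proof.
move=> [f1 f2]; split=> z Dz; first by apply: holatX; exact: f1.
by rewrite f2 // cjX.
Qed.

Lemma Delta_factor_comps I z m ft : isphere I -> Delta_factor Omega gv (cpt I z) m ft ->
  exists p' v', has_comps ft p' v' /\ forall y, D y ->
    dl z y ^+ m * p' y = 0 /\ forall l, G l y = dl z y ^+ m * v' l y.
Proof.
move=> hI [/(slice_regularP circ_D oD)[p' [v' hft]] E].
exists p', v'; split => // y Dy; have [hp hv fE] := hft.
have hc : has_comps gv (fun y => dl z y ^+ m * p' y) (fun l y => dl z y ^+ m * v' l y).
  split=> [|l|J x hJ Dx].
  - by apply: sym_holM => //; apply: sym_holX; exact: dl_sym.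
  - by apply: sym_holM => //; apply: sym_holX; exact: dl_sym.
  - rewrite E; last exact/(circ_D x hJ).
    by rewrite Delta_cpt // -cptX // fE // cpt_ev.
have [e1 e2] := comps_unique gvG hc Dy.
by split=> // l; exact: (congr1 (fun f => f l) e2).
Qed.

(* Write [G = (y - z)^n w] with [w] nonzero at [z].  If [w z] is isotropic then [z] is not real,
   since [w] is real at real points, and [w z] vanishes when it is evaluated at a suitable
   imaginary unit, which makes a point of the sphere of [z] an isolated zero. *)
Lemma nonbad_chart (g0 : C -> C) z : hol D g0 ->
  (forall y, D y -> g0 y ^+ 2 + cdot (G^~ y) (G^~ y) = 1) -> D z -> ~ badz z ->
  (forall r : R, 0 < r -> exists2 y, cabs (y - z) < r & D y /\ cdot (G^~ y) (G^~ y) != 0) ->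
  (exists r mu W, chart g0 G z r mu W) /\ isol_zeros G z.
Proof.
move=> hg0 uG Dz nbad nz.
have hG l : hol D (G l) by have [_ h _] := gvG; exact: (h l).1.
have sG l y : D y -> G l (cj y) = cj (G l y) by have [_ h _] := gvG; exact: (h l).2.
have [[r r0 h]|[n [q [hq Eq [i qi0]]]]] := order_dichotomy oD Dz hG.
  have [y yz [_]] := nz r r0; rewrite /cdot big1 ?eqxx // => l _.
  by rewrite h // mul0r.
have [rD rD0 hrD] := open_ballP oD Dz.
have [z0|z0] := eqVneq (im z) 0.
  have cz : cj z = z by apply: cxP; rewrite cj_def // z0 oppr0.
  (* The symmetry of [G] passes to the quotient by the real power (y - z)^n off [z], and to [z] by
     continuity; a nonzero real vector is not isotropic. *)
  have qreal l : im (q l z) = 0.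
    have : q l z - cj (q l (cj z)) = 0.
      apply: (@cont_zero _ (fun y => q l y - cj (q l (cj y))) z rD rD0).
        apply: holat_continuous; apply: holatB; first exact: hq.
        by apply: holat_cj; rewrite cz; exact: hq.
      move=> y yz /hrD Dy; apply: (@mulfI _ ((y - z) ^+ n)).
        by rewrite expf_neq0 // subr_eq0.
      have e : (y - z) ^+ n = cj ((cj y - z) ^+ n) by rewrite cjX cjB cjK cz.
      by rewrite mulr0 mulrBr -Eq e -cjM -Eq sG // cjK subrr.
    by rewrite cz => /(congr1 (@im R)); rewrite imD imN cj_def im0; lra.
  apply: (chart_exists oD hg0 uG (z := z) (n := n) (w := q)) => //.
  apply/eqP => /(congr1 (@re R)); rewrite re0 /cdot.
  have -> : re (\sum_i0 q i0 z * q i0 z) = \sum_i0 re (q i0 z) ^+ 2.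
    rewrite (big_morph (@re R) (@reD R) (@re0 R)); apply: eq_bigr => l _.
    by rewrite reM qreal mulr0 subr0 expr2.
  move=> /eqP; rewrite psumr_eq0 => [/allP /(_ i)|l _]; last exact: sqr_ge0.
  rewrite mem_index_enum sqrf_eq0 => /(_ isT) /= /eqP e.
  by move/eqP: qi0; apply; apply: cxP; rewrite ?re0 ?im0.
have zcz : z != cj z.
  by apply: contraNneq z0 => /(congr1 (@im R)); rewrite cj_def => ?; apply/eqP; lra.
have hI := qi_sphere R.
(* The exponents m for which Delta^m divides the vector part. They are bounded by the order [n] of G
   at [z], since Delta vanishes there; the largest one gives the reduced function of the definition
   of isolated zeroes. *)
pose P m := `[< exists ft, Delta_factor Omega gv (cpt (qi R) z) m ft >].
have exP : exists m, P m.
  exists 0%N; apply/asboolP; exists gv; split; last by move=> x _; rewrite expr0 mul1r.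
  by apply/(slice_regularP circ_D oD); do 2 eexists; exact: gvG.
have bndP m : P m -> (m <= n)%N.
  move=> /asboolP[ft /(Delta_factor_comps hI)[p' [v' [[_ hv' _] hE]]]].
  rewrite leqNgt; apply/negP => nm; move/eqP: qi0; apply.
  have : q i z - (z - z) ^+ (m - n) * ((z - cj z) ^+ m * v' i z) = 0.
    apply: (@cont_zero _ (fun y => q i y - (y - z) ^+ (m - n) * ((y - cj z) ^+ m * v' i y)) z rD rD0).
      apply: holat_continuous; apply: holatB; first exact: hq.
      apply: holatM; first by apply: holatX; apply: holatB; [exact: holat_id | exact: holat_cst].
      apply: holatM; first by apply: holatX; apply: holatB; [exact: holat_id | exact: holat_cst].
      exact: (hv' i).1.
    move=> y yz /hrD Dy; apply: (@mulfI _ ((y - z) ^+ n)).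
      by rewrite expf_neq0 // subr_eq0.
    rewrite mulr0 mulrBr -Eq; apply/eqP; rewrite subr_eq0; apply/eqP.
    rewrite [RHS]mulrA -exprD subnKC ?(ltnW nm) //.
    by rewrite (hE y Dy).2 /dl exprMn mulrA.
  rewrite subrr expr0n subn_eq0 leqNgt nm mul0r subr0 //.
have [m /asboolP[ft hft] maxm] : exists2 m, P m & forall k, P k -> (k <= m)%N.
  by case: (ex_maxnP exP bndP) => m Pm mx; exists m.
have [p' [v' [hc hE]]] := Delta_factor_comps hI hft.
have [hp' hv' fE] := hc.
have p'z : p' z = 0.
  have r0 : 0 < Num.min rD (cabs (z - cj z)) by rewrite lt_min rD0 cabs_gt0 subr_eq0.
  (* Delta^m p' = 0, and Delta has no zero near [z] except [z] itself once the radius is less than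
     the distance to the conjugate point. *)
  apply: (@cont_zero _ p' z _ r0); first exact/holat_continuous/hp'.1.
  move=> y yz; rewrite lt_min => /andP[/hrD Dy yc].
  have [/eqP + _] := hE y Dy; rewrite mulf_eq0 expf_eq0 => /orP[/andP[_]|/eqP //].
  rewrite /dl mulf_eq0 !subr_eq0 (negPf yz) /= => /eqP e.
  by move: yc; rewrite e cabs_distC ltxx.
have [c0|c0] := eqVneq (cdot (v'^~ z) (v'^~ z)) 0; last first.
  apply: (chart_exists oD hg0 uG (z := z) (n := m) (w := fun l y => (y - cj z) ^+ m * v' l y)).
  - exact: Dz.
  - move=> l y Dy; apply: holatM; last exact: (hv' l).1.
    by apply: holatX; apply: holatB; [exact: holat_id | exact: holat_cst].
  - by move=> l y Dy; rewrite (hE y Dy).2 /dl exprMn mulrA.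
  - rewrite cdotZ cdotC cdotZ !mulf_neq0 //; by rewrite expf_neq0 // subr_eq0.
exfalso; apply: nbad; have [I hI' e0] := isotropic_sphere c0.
(* Delta depends only on the sphere of [z], so the maximal exponent found with the unit i also
   serves the unit [I] where the reduced function vanishes. *)
have DE ft' k : Delta_factor Omega gv (cpt I z) k ft' <-> Delta_factor Omega gv (cpt (qi R) z) k ft'.
  have E q' : Omega q' -> Delta (cpt I z) q' = Delta (cpt (qi R) z) q'.
    by move=> _; have [J hJ ->] := quat_cpt q'; rewrite !Delta_cpt.
  by split=> -[h1 h2]; (split; first exact: h1) => q' Oq'; rewrite (h2 _ Oq') (E _ Oq').
exists I => //; split.
- exact/(circ_D z hI').
- by move=> /(cpt_real hI') /eqP; rewrite (negPf z0).
- move=> s0; have [y _ [Dy]] := nz 1 ltr01.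
  have := s0 (cpt I y); rewrite (symm_ev circ_D oD gvG) // expr0n add0r.
  have c00 : cpt I (0 : C) = 0 by rewrite /cpt re0 im0 !scale0r addr0.
  by rewrite -c00 => /(_ (proj2 (circ_D y hI') Dy)) /(cpt_inj hI') ->; rewrite eqxx.
- exists m, ft; split; first exact/DE.
  + by move=> k fk /DE hk; apply: maxm; apply/asboolP; exists fk.
  + by rewrite fE // p'z.
Qed.

End IsolatedZeros.

(** * The logarithm *)

Section StemLogarithm.
Variable R : realType.
Local Notation C := (Cx R).
Implicit Types (x y z w c : C) (t r : R) (D U : set C) (B : seq C) (e : 'I_3 -> C).

Lemma ccos_cj z : ccos (cj z) = cj (ccos z).
Proof.
have iz : iC R * cj z = cj (- (iC R * z)) by apply: cxP; rewrite !(reimE, cj_def); ring.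
rewrite /ccos iz -cjN !cexp_cj opprK [LHS]mulrC [in RHS]cjM cjD [RHS]mulrC addrC.
by congr (_ * _); rewrite cjV (_ : 2 = 1 + 1 :> C) // cjD cj1.
Qed.

Lemma csin_cj z : csin (cj z) = cj (csin z).
Proof.
have iz : iC R * cj z = cj (- (iC R * z)) by apply: cxP; rewrite !(reimE, cj_def); ring.
have ii : cj (iC R + iC R) = - (iC R + iC R) by apply: cxP; rewrite !(reimE, cj_def); ring.
rewrite /csin iz -cjN !cexp_cj opprK [in RHS]cjM cjB cjV ii.
by rewrite invrN mulrN -mulNr opprB.
Qed.

Section Symmetry.
Variables (D : set C) (g0 : C -> C) (G : 'I_3 -> C -> C).
Hypothesis oD : open D.
Hypothesis sym_g0 : forall z, D z -> g0 (cj z) = cj (g0 z).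
Hypothesis sym_G : forall l z, D z -> G l (cj z) = cj (G l z).

(** Schwarz reflection of the chart, [mu] and [W] being replaced by their conjugates at the
    conjugate point. *)
Lemma sol_cj z e : D z -> sol g0 G (cj z) e -> sol g0 G z (fun l => cj (e l)).
Proof.
move=> Dz [r [mu [W [[r0 ch] eE]]]]; have [d d0 hd] := open_ballP oD Dz.
exists (Num.min r d), (fun y => cj (mu (cj y))), (fun l y => cj (W l (cj y))).
split; last by move=> l; rewrite eE cjM.
split=> [|y]; first by rewrite lt_min r0.
rewrite lt_min => /andP[yr /hd Dy].
have /ch[h1 h2 h3 h4 h5] : cabs (cj y - cj z) < r by rewrite -cjB cabs_cj.
split.
- exact: holat_cj.
- by move=> l; apply: holat_cj.
- by rewrite ccos_cj h3 sym_g0 // cjK.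
- by move=> l; rewrite csin_cj -cjM -h4 sym_G // cjK.
- rewrite -[RHS]cj1 -h5 /cdot (big_morph (@cj R) (@cjD R) (@cj0 R)).
  by apply: eq_bigr => l _; rewrite cjM.
Qed.

Lemma slit_value_cj a : slit_value a -> slit_value (cj a : C).
Proof. by rewrite /slit_value cj_def /= oppr_eq0. Qed.

Lemma principal_cj l z : D z -> slit_value (g0 z) ->
  principal g0 G l (cj z) = cj (principal g0 G l z).
Proof.
move=> Dz h; rewrite /principal sym_G // sym_g0 //.
have -> : (1 - cj (g0 z)) / (1 + cj (g0 z)) = cj ((1 - g0 z) / (1 + g0 z)).
  by rewrite cjM cjV cjB cjD cj1.
rewrite atanq_cj; last exact: slit_value_slit.
by move: (_ / _) => m; rewrite !cjM cjD cj1.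
Qed.

End Symmetry.

Lemma sol_expsol g0 (G : 'I_3 -> C -> C) z e : sol g0 G z e -> expsol (g0 z) (G^~ z) e.
Proof.
move=> [r [mu [W [[r0 ch] eE]]]]; have /ch[_ _ h3 h4 h5] : cabs (z - z) < r by rewrite subrr cabs0.
left; exists (mu z), (W^~ z).
by split; [exact: eE | exact: h5 | exact: h3 | exact: h4].
Qed.

(** For g0 = 1 the argument of [atanq] is 0 and the principal vector is G itself, which is
    isotropic: the nilpotent case of the exponential. *)
Lemma expsol_principal g0 (G : 'I_3 -> C -> C) z : g0 z ^+ 2 + cdot (G^~ z) (G^~ z) = 1 ->
  g0 z = 1 -> expsol (g0 z) (G^~ z) ((principal g0 G)^~ z).
Proof.
move=> u e1; right; split => //.
  by move=> l; rewrite /principal e1 subrr mul0r atanq0 addr0 !mulr1.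
by move: u; rewrite e1 expr1n -[RHS]addr0 => /addrI.
Qed.

Lemma open_notin B : open [set z | z \notin B].
Proof.
elim: B => [|b B IH].
  by rewrite (_ : [set z | _] = setT); [exact: openT | apply/seteqP; split].
have -> : [set z | z \notin b :: B] = [set z | z != b] `&` [set z | z \notin B].
  by apply/seteqP; split=> z /=; rewrite inE negb_or => /andP.
apply: openI => //; rewrite openE => z /= zb; apply/nbhsCP.
exists (cabs (z - b)); first by rewrite cabs_gt0 subr_eq0.
move=> y yz /=; apply: contraTneq yz => ->.
by rewrite -leNgt cabs_distC.
Qed.

(** Charts are available on [D] minus the list [B], where continuation takes place; at the points of
    [B] the value comes from [FU]. The uniqueness clause is what gives conjugation symmetry
    later. *)
Lemma stem_log g0 (G FU : 'I_3 -> C -> C) D U B c :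
  open D -> convexC D ->
  (forall z, D z -> z \notin B -> (exists r mu W, chart g0 G z r mu W) /\ isol_zeros G z) ->
  open U -> U `<=` D -> U c -> (forall z t, U z -> 0 <= t <= 1 -> U (seg c z t)) ->
  (forall b, b \in B -> U b) ->
  (forall l z, U z -> holat (FU l) z) ->
  (forall z, U z -> z \notin B -> sol g0 G z (FU^~ z)) ->
  (forall b, b \in B -> expsol (g0 b) (G^~ b) (FU^~ b)) ->
  exists F : 'I_3 -> C -> C, [/\ forall l, hol D (F l),
    forall z, D z -> expsol (g0 z) (G^~ z) (F^~ z),
    forall z, D z -> z \notin B -> sol g0 G z (F^~ z),
    forall z, U z -> F^~ z = FU^~ z &
    forall F', (forall l, hol D (F' l)) ->
      (forall z, D z -> z \notin B -> sol g0 G z (F'^~ z)) ->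
      (forall z, U z -> F'^~ z = FU^~ z) -> forall z, D z -> F'^~ z = F^~ z].
Proof.
move=> oD cD ch oU UD Uc sU BU hFU sFU eB.
pose A := D `&` [set z | z \notin B].
have oA : open A by apply: openI => //; exact: open_notin.
have chA z : A z -> exists r mu W, chart g0 G z r mu W by case=> Dz /(ch _ Dz)[].
have iA z : A z -> isol_zeros G z by case=> Dz /(ch _ Dz)[].
have AB z : D z -> z \notin B -> A z by split.
have hFU' z l : U z -> holat (FU l) z by move=> Uz; exact: hFU.
have sFU' z : U z -> A z -> sol g0 G z (FU^~ z) by move=> Uz [_ zB]; exact: sFU.
have [F [hF sF EF]] := star_extension oA chA iA oD cD AB oU UD Uc sU BU hFU' sFU'.
exists F; split.
- by move=> l z Dz; exact: hF.
- move=> z Dz; have [zB|zB] := boolP (z \in B).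
    by rewrite EF; [exact: eB | exact: BU].
  by apply: sol_expsol; apply: sF => //; exact: AB.
- by move=> z Dz zB; apply: sF => //; exact: AB.
- exact: EF.
- move=> F' hF' sF' EF'; apply: (star_unique iA cD AB oU UD Uc BU (s := F') (s' := F)).
  + by move=> z l Dz; exact: hF'.
  + exact: hF.
  + by move=> z Dz [_ zB]; exact: sF'.
  + exact: sF.
  + by move=> z Uz; rewrite EF' // EF.
Qed.

End StemLogarithm.

(** * The connected component of the slit domain, seen in one slice *)

Section Component.
Variable R : realType.
Local Notation C := (Cx R).
Local Notation H := (quat R).
Implicit Types (q I J : H) (a b t r : R) (z w y : C).
Variables (Omega : set H) (D : set C).
Hypothesis circ_D : forall I z, isphere I -> Omega (cpt I z) <-> D z.
Hypothesis oD : open D.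
Variables (g : H -> H) (p : C -> C) (v : 'I_3 -> C -> C).
Hypothesis gc : has_comps D g p v.
Variable U : set H.
Hypothesis compU : is_component (Omega `\` preimage_real_le Omega (real_part Omega g) (-1)) U.

Lemma slit_domain_cpt I z : isphere I ->
  (Omega `\` preimage_real_le Omega (real_part Omega g) (-1)) (cpt I z) <->
  D z /\ slit_value (p z).
Proof.
move=> hI; split=> [[/(circ_D z hI) Dz nz]|[Dz s]]; split => //.
- apply: contrapT => /not_orP[/negP/negPn/eqP ip /negP]; rewrite -leNgt => rp; apply: nz.
  split; first exact/(circ_D z hI); exists (re (p z)) => //.
  by rewrite (real_part_ev circ_D oD gc) // /cpt ip scale0r addr0.
- exact/(circ_D z hI).
- move=> [_ [a a1]]; rewrite (real_part_ev circ_D oD gc) // => e.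
  have {e} e : cpt I (p z) = cpt I (mkC a 0) by rewrite e /cpt /= scale0r addr0.
  move: (cpt_inj hI e) s => -> [|/=]; first by rewrite /= eqxx.
  by rewrite ltNge a1.
Qed.

Lemma slit_domain_open z : D z -> slit_value (p z) ->
  exists2 r, 0 < r & forall y, cabs (y - z) < r -> D y /\ slit_value (p y).
Proof.
move=> Dz s; have [r1 r10 hr1] := open_ballP oD Dz.
have cp : {for z, continuous p} by have [[hp _] _ _] := gc; apply/holat_continuous/hp.
have {}s : 0 < `|im (p z)| \/ 0 < re (p z) + 1.
  by case: s => h; [left; rewrite normr_gt0 | right; lra].
(* A positive margin: a change of p z by less than [m] in modulus keeps whichever of the two
   conditions realizes the maximum. *)
pose m := Num.max `|im (p z)| (re (p z) + 1).
have m0 : 0 < m by rewrite lt_max; case: s => ->; rewrite ?orbT.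
move/(@cvgCP _ _ (nbhs z) _): cp => /(_ _ m0) /nbhsCP[r2 r20 hr2].
exists (Num.min r1 r2); first by rewrite lt_min r10.
move=> y; rewrite lt_min => /andP[/hr1 Dy /hr2]; rewrite cabs_distC => yr; split => //.
have h1 : `|im (p z) - im (p y)| < m by rewrite -imN -imD (le_lt_trans (cabs_im _)).
have h2 : `|re (p z) - re (p y)| < m by rewrite -reN -reD (le_lt_trans (cabs_re _)).
have [mi|mi] := leP `|im (p z)| (re (p z) + 1).
  right; move: h2; rewrite /m (max_idPr mi) ltr_norml => /andP[h2 h3]; clear h1; lra.
left; apply: contraTneq h1 => ->; rewrite subr0 /m max_l ?ltxx //; exact: ltW.
Qed.

Lemma component_slit I z : isphere I -> U (cpt I z) -> D z /\ slit_value (p z).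
Proof.
move=> hI; have [x Ax ->] := compU => /connected_component_sub.
by move/(slit_domain_cpt _ hI).
Qed.

Lemma continuous_cpt_seg I z y : continuous (fun t => cpt I (seg z y t)).
Proof.
move=> t; have [c1 c2] := (@cvg_reim _ _ (nbhs t) _ (seg z y) (seg z y t)).1 (@continuous_seg _ z y t).
have c3 := @cvg_scalel R R (nbhs t) (nbhs_filter t) _ _ 1 c1.
have c4 := @cvg_scalel R R (nbhs t) (nbhs_filter t) _ _ I c2.
exact: (cvgD c3 c4).
Qed.

(** Nearby points of the slice are joined to the given one by a segment inside the slit domain,
    hence lie in the same component. *)
Lemma component_ball I z : isphere I -> U (cpt I z) ->
  exists2 r, 0 < r & forall y, cabs (y - z) < r -> U (cpt I y).
Proof.
move=> hI Uz; have [Dz s] := component_slit hI Uz.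
have [r r0 hr] := slit_domain_open Dz s; exists r => // y yz.
have [x Ax EU] := compU; move: Uz; rewrite EU => Uz.
apply: connected_component_trans Uz _.
pose S := (fun t => cpt I (seg z y t)) @` `[0, 1].
apply: (@connected_component_max _ _ S).
- by exists 0; rewrite /= ?in_itv /= ?lexx ?ler01 // seg0.
- move=> q [t]; rewrite /= in_itv /= => ht <-; apply/(slit_domain_cpt _ hI); apply: hr.
  by apply: cball_convex; rewrite ?subrr ?cabs0.
- apply: connected_continuous_connected; first exact: segment_connected.
  exact/continuous_subspaceT/continuous_cpt_seg.
- by exists 1; rewrite /= ?in_itv /= ?lexx ?ler01 // seg1.
Qed.

Lemma component_convex I z w t : isphere I -> convex_set (U `&` slice_half_plane I) ->
  0 <= im z -> U (cpt I z) -> 0 <= im w -> U (cpt I w) -> 0 <= t <= 1 ->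
  0 <= im (seg z w t) /\ U (cpt I (seg z w t)).
Proof.
move=> hI cU iz Uz iw Uw /andP[t0 t1]; split.
  rewrite /seg !reimE mul0r addr0; have h : 0 <= (1 - t) * im z + t * im w.
    by rewrite addr_ge0 // mulr_ge0 // subr_ge0.
  move: (im z) (im w) h => a b; lra.
have mem y : 0 <= im y -> U (cpt I y) -> cpt I y \in U `&` slice_half_plane I.
  by move=> iy Uy; rewrite inE; split => //; exists (re y), (im y).
have := cU _ _ (Itv01 t0 t1) (mem w iw Uw) (mem z iz Uz); rewrite inE => -[+ _].
congr U.
rewrite /cpt /seg; apply: quatP; rewrite !qE !reimE /=.
by split; rewrite /unstable.onem /=; ring.
Qed.

End Component.

(** * From continuation to a slice regular logarithm *)

Section Logarithm.
Variable R : realType.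
Local Notation C := (Cx R).
Local Notation H := (quat R).
Implicit Types (q I J : H) (a b t r : R) (z w y : C).
Variables (Omega : set H) (D : set C).
Hypothesis circ_D : forall I z, isphere I -> Omega (cpt I z) <-> D z.
Hypothesis oD : open D.
Variables (g : H -> H) (p : C -> C) (v : 'I_3 -> C -> C).
Hypothesis gc : has_comps D g p v.
Local Notation gv := (vector_part Omega g).
Local Notation badz := (badz Omega gv).

Lemma log_of_comps (F : 'I_3 -> C -> C) : (forall l, sym_hol D (F l)) ->
  (forall z, D z -> 0 <= im z -> expsol (p z) (v^~ z) (F^~ z)) ->
  exists2 f, slice_regular Omega f & is_star_exp Omega f g.
Proof.
move=> hF eF.
have fc : has_comps D (slice_fun (fun=> 0) F) (fun=> 0) F.
  split; [exact: sym_hol0 | exact: hF |].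
  by move=> I z hI Dz; apply: (slice_fun_cpt) => //; exact: sym_hol0.
exists (slice_fun (fun=> 0) F).
  by apply/(slice_regularP circ_D oD); do 2 eexists; exact: fc.
exact: (star_exp_ev circ_D gc fc eF).
Qed.

Hypothesis symm1 : forall q, Omega q -> symm Omega g q = 1.

Lemma stem_unit z : D z -> p z ^+ 2 + cdot (v^~ z) (v^~ z) = 1.
Proof.
move=> Dz; have hI := qi_sphere R; apply: (cpt_inj hI).
rewrite -(symm_ev circ_D oD gc) // symm1 ?cpt1 //; exact/(circ_D z hI).
Qed.

Lemma badz_D z : badz z -> D z.
Proof. by case=> I hI [/(circ_D z hI)]. Qed.

Lemma badz_cj z : badz z -> badz (cj z).
Proof. by case=> I hI h; exists (- I); [exact: sphereN | rewrite cpt_cj opprK]. Qed.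

Hypothesis fin : finite_set [set q | nonreal_isolated_zero Omega gv q].

(** A bad point in the closed upper half-plane is read off from a zero by [k], and the others are
    conjugates of such points. *)
Lemma badz_seq : exists B : seq C, forall z, z \in B <-> badz z.
Proof.
pose k q := mkC (q0 q) (qnorm (qvec q)).
have : finite_set (k @` [set q | nonreal_isolated_zero Omega gv q] `|`
    (@cj R \o k) @` [set q | nonreal_isolated_zero Omega gv q]).
  by rewrite finite_setU; split; exact: finite_image.
move=> /finite_seqP[s Es]; exists [seq z <- s | `[< badz z >]] => z.
rewrite mem_filter; split=> [/andP[/asboolP]//|bz]; apply/andP; split; first exact/asboolP.
have : [set` s] z; last by [].
rewrite -Es; have [I hI nz] := bz.
have [iz|iz] := leP 0 (im z); [left | right]; exists (cpt I z) => //; rewrite /k /= ?cpt_coord ?qvec_cpt ?qnorm_sphere //.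
  by apply: cxP => //=; rewrite ger0_norm.
by apply: cxP; rewrite cj_def //= ltr0_norm // opprK.
Qed.

Hypothesis real1 : forall q, nonreal_isolated_zero Omega gv q -> real_part Omega g q = 1.

Lemma badz_one z : badz z -> p z = 1.
Proof.
move=> bz; have Dz := badz_D bz; have [I hI /real1] := bz.
by rewrite (real_part_ev circ_D oD gc) // -(cpt1 I) => /(cpt_inj hI).
Qed.

Variables (U : set H) (I0 : H).
Hypothesis compU : is_component (Omega `\` preimage_real_le Omega (real_part Omega g) (-1)) U.
Hypothesis sphU : \bigcup_(q in [set q | nonreal_isolated_zero Omega gv q]) sphere_at q `<=` U.
Hypothesis hI0 : isphere I0.
Hypothesis cU : convex_set (U `&` slice_half_plane I0).

Lemma badz_U z : badz z -> 0 <= im z -> U (cpt I0 z).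
Proof.
case=> J hJ nz iz; apply: sphU; exists (cpt J z) => //; exists I0 => //.
by rewrite cpt_coord // qvec_cpt // qnorm_sphere // ger0_norm.
Qed.

Variable D' : set C.
Hypothesis oD' : open D'.
Hypothesis cD' : convexC D'.
Hypothesis D'D : D' `<=` D.
Hypothesis half : forall z, D z -> 0 <= im z -> D' z.

Let hp : hol D p. Proof. by case: gc => -[]. Qed.
Let hv l : hol D (v l). Proof. by have [_ h _] := gc; exact: (h l).1. Qed.

(* Here [g0 ^ 2 = 1], and [g0 = -1] is excluded at the points of [U]. *)
Lemma isotropic_log : (forall z, D' z -> cdot (v^~ z) (v^~ z) = 0) ->
  exists2 f, slice_regular Omega f & is_star_exp Omega f g.
Proof.
move=> v0.
have [z [D'z sz]] : exists z, D' z /\ slit_value (p z).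
  have [x Ax _] := compU; have [I [z [hI Dz iz xE]]] := Omega_cpt circ_D Ax.1.
  move: Ax; rewrite xE => /(slit_domain_cpt circ_D oD gc _ hI)[_ s].
  by exists z; split => //; exact: half.
have [r r0 hr] := slit_domain_open oD gc (D'D D'z) sz.
have p1 : forall y, D' y -> p y - 1 = 0.
  have [r' r'0 hr'] := open_ballP oD' D'z.
  have rr : 0 < Num.min r r' by rewrite lt_min r0.
  apply: (@identity_theorem _ _ _ z _ oD' cD' _ D'z rr).
    by move=> y D'y; apply: holatB; [exact/hp/D'D | exact: holat_cst].
  move=> y; rewrite lt_min => /andP[/hr[Dy sy] /hr' D'y].
  have u := stem_unit Dy; rewrite v0 // addr0 in u.
  have /eqP : (p y - 1) * (1 + p y) = 0.
    have -> : (p y - 1) * (1 + p y) = p y ^+ 2 - 1 by move: (p y) => c; ring.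
    by rewrite u subrr.
  by rewrite mulf_eq0 (negPf (slit_value_neq0 sy)) orbF => /eqP.
apply: (@log_of_comps v); first by case: gc.
move=> y Dy iy; have D'y := half Dy iy; right; split => //; first exact: v0.
by apply/eqP; rewrite -subr_eq0 p1.
Qed.

(** If v.v vanished near one point of the convex set [D'], it would vanish on all of it; this
    supplies the nondegeneracy that [nonbad_chart] asks for at every point. *)
Lemma regular_chart : (exists2 z, D' z & cdot (v^~ z) (v^~ z) != 0) ->
  forall z, D' z -> ~ badz z -> (exists r mu W, chart p v z r mu W) /\ isol_zeros v z.
Proof.
move=> [x D'x nx] z D'z nb.
apply: (nonbad_chart circ_D oD (vector_part_comps circ_D oD gc) hp stem_unit (D'D D'z) nb) => r r0.
apply: contrapT => nex; case/eqP: nx.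
have [r' r'0 hr'] := open_ballP oD' D'z.
have rr : 0 < Num.min r r' by rewrite lt_min r0.
apply: (@identity_theorem _ (fun y => cdot (v^~ y) (v^~ y)) _ z _ oD' cD' _ D'z rr) => //.
  by move=> y D'y; apply: holat_cdot => l; exact/hv/D'D.
move=> y; rewrite lt_min => /andP[yr /hr' D'y].
apply/eqP/negPn/negP => ny; apply: nex; exists y => //; split => //; exact: D'D.
Qed.

Hypothesis reg : forall z, D' z -> ~ badz z ->
  (exists r mu W, chart p v z r mu W) /\ isol_zeros v z.

Lemma slice_log a : (forall z, D' z -> D' (cj z)) -> U a%:A ->
  exists2 f, slice_regular Omega f & is_star_exp Omega f g.
Proof.
move=> D'cj Ua; have [B hB] := badz_seq.
pose u z := 0 <= im z /\ U (cpt I0 z).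
have DD' z : D z -> D' z.
  move=> Dz; have [iz|iz] := leP 0 (im z); first exact: half.
  rewrite -(cjK z); apply: D'cj; apply: half; first exact: (D_cj circ_D).
  by rewrite cj_def oppr_ge0 ltW.
have us z : u z -> D' z /\ slit_value (p z).
  by move=> [_ /(component_slit circ_D oD gc compU hI0)[Dz s]]; split => //; exact: DD'.
have up : forall z, D z -> p (cj z) = cj (p z) by case: gc => -[].
have uv l : forall z, D z -> v l (cj z) = cj (v l z) by have [_ h _] := gc; exact: (h l).2.
pose V := [set z | u z \/ u (cj z)].
have VE z : V z -> D' z /\ slit_value (p z).
  case=> [/us //|/us [D'z s]]; have D'z2 := D'cj _ D'z; rewrite cjK in D'z2.
  split=> //; rewrite -(cjK z) up; first exact: slit_value_cj.
  exact: D'D.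
have Vcj z : V z -> V (cj z) by case=> h; [right; rewrite cjK | left].
have ua : u (mkC a 0) by split; rewrite //= /cpt /= scale0r addr0.
have starV z t : V z -> 0 <= t <= 1 -> V (seg (mkC a 0) z t).
  move=> Vz ht; have sc : cj (seg (mkC a 0) z t) = seg (mkC a 0) (cj z) t.
    by rewrite /seg cjD cjM cjB !cj_real.
  have st w : u w -> u (seg (mkC a 0) w t).
    by case: ua => a0 Ua' [iw Uw]; exact: (component_convex hI0 cU).
  by case: Vz => /st h; [left | right; rewrite sc].
have oV : open V.
  have ball z : u z -> exists2 r, 0 < r & forall y, cabs (y - z) < r -> V y.
    move=> [iz Uz]; have [r r0 hr] := component_ball circ_D oD gc compU hI0 Uz.
    move: iz; rewrite le_eqVlt => /orP[/eqP iz|iz].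
      (* Around a real point the disc crosses the axis; a point below belongs to [V] through its
         conjugate, which lies in the same disc. *)
      exists r => // y yz; have [iy|iy] := leP 0 (im y); first by left; split => //; exact: hr.
      right; split; first by rewrite cj_def oppr_ge0 ltW.
      apply: hr; have cz : z = cj z by apply: cxP; rewrite cj_def // -iz oppr0.
      by rewrite cz -cjB cabs_cj.
    exists (Num.min r (im z)); first by rewrite lt_min r0.
    move=> y; rewrite lt_min => /andP[/hr Uy yz]; left; split => //.
    have := le_lt_trans (cabs_im _) yz; rewrite imD imN ltr_norml => /andP[h _].
    by move: (im y) (im z) h => b c; lra.
  rewrite openE => z Vz; apply/nbhsCP; case: Vz => /ball[r r0 hr]; exists r => // y yz.
  by rewrite -(@cjK R y); apply/Vcj/hr; rewrite -cjB cabs_cj.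
have BV w : w \in B -> V w.
  move=> /hB bb; have [ib|ib] := leP 0 (im w); [left | right]; split => //.
  - exact: badz_U.
  - by rewrite cj_def oppr_ge0 ltW.
  - by apply: badz_U; [exact: badz_cj | rewrite cj_def oppr_ge0 ltW].
have nB z : z \notin B -> ~ badz z by move=> /negP zB /hB.
have [F [hF eF sF EF uF]] := @stem_log _ p v (principal p v) D' V B (mkC a 0) oD' cD'
  (fun z D'z zB => reg D'z (nB z zB)) oV (fun z Vz => (VE z Vz).1) (or_introl ua) starV BV
  (fun l z Vz => holat_principal hp hv l (D'D (VE z Vz).1) (VE z Vz).2)
  (fun z Vz zB => sol_principal (VE z Vz).1 (VE z Vz).2 (reg (VE z Vz).1 (nB z zB)).1)
  (fun z zB => expsol_principal (stem_unit (badz_D (proj1 (hB z) zB))) (badz_one (proj1 (hB z) zB))).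
apply: (@log_of_comps F) => [l|z Dz iz]; last by apply: eF; exact: DD'.
(* The reflected function is again a solution equal to the principal one on [V], so uniqueness
   identifies it with [F]. *)
have symF z : D' z -> (fun l => cj (F l (cj z))) = F^~ z.
  apply: (uF (fun l z => cj (F l (cj z)))) => [m|y D'y yB|y Vy].
  - by move=> y D'y; apply: holat_cj; apply: hF; exact: D'cj.
  - apply: (sol_cj oD up uv (D'D D'y)); apply: sF; first exact: D'cj.
    by apply: contra yB => /hB /badz_cj; rewrite cjK => /hB.
  - apply/funext => m.
    rewrite -[RHS]cjK -(principal_cj up uv); [|exact/D'D/(VE y Vy).1|exact: (VE y Vy).2].
    by have := congr1 (fun h => h m) (EF _ (Vcj _ Vy)) => /= ->.
split=> [z /DD' D'z|z Dz]; first exact: hF.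
by have := congr1 (fun h => h l) (symF _ (DD' _ (D_cj circ_D Dz))); rewrite cjK /= => <-.
Qed.

(** If the slice of [I0] meets [U] in its upper half, that trace is convex and any of its points can
    be the centre. Otherwise there are no bad points above the axis, as these would lie in [U], and
    the continuation starts from a chart disc around [z0]. *)
Lemma upper_log z0 : (forall z, D' z -> 0 < im z) -> D' z0 ->
  exists2 f, slice_regular Omega f & is_star_exp Omega f g.
Proof.
move=> pos D'z0; have [B0 hB0] := badz_seq.
(* The list of bad points is closed under conjugation, but [D'] contains only its upper half. *)
pose B := [seq z <- B0 | 0 <= im z].
have nB z : D' z -> z \notin B -> ~ badz z.
  by move=> D'z /negP zB /hB0 h; apply: zB; rewrite mem_filter h (ltW (pos _ D'z)).
have hB z : z \in B -> [/\ badz z, D' z & U (cpt I0 z)].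
  rewrite mem_filter => /andP[iz /hB0 bz]; split => //; last exact: badz_U.
  by apply: half => //; exact: badz_D.
have [F [hF eF]] : exists F : 'I_3 -> C -> C, (forall l, hol D' (F l)) /\
    forall z, D' z -> expsol (p z) (v^~ z) (F^~ z).
  have regB z (D'z : D' z) (zB : z \notin B) := reg D'z (nB z D'z zB).
  have [[w [iw Uw]]|nU] := pselect (exists w, 0 <= im w /\ U (cpt I0 w)).
    pose V := [set z | D' z /\ U (cpt I0 z)].
    have VE z : V z -> D' z /\ slit_value (p z).
      by move=> [D'z /(component_slit circ_D oD gc compU hI0)[_ s]].
    have Vw : V w.
      by split => //; apply: half => //; case: (component_slit circ_D oD gc compU hI0 Uw).
    have starV z t : V z -> 0 <= t <= 1 -> V (seg w z t).
      move=> [D'z Uz] ht; split; first by apply: cD' => //; case: Vw.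
      by case: (component_convex hI0 cU iw Uw (ltW (pos _ D'z)) Uz ht).
    have oV : open V.
      rewrite openE => z [D'z Uz]; apply/nbhsCP.
      have [r r0 hr] := component_ball circ_D oD gc compU hI0 Uz.
      have [r' r'0 hr'] := open_ballP oD' D'z.
      exists (Num.min r r'); first by rewrite lt_min r0.
      by move=> y; rewrite lt_min => /andP[/hr Uy /hr' D'y]; split.
    have BV z : z \in B -> V z by move=> /hB[].
    have Bb z : z \in B -> badz z by move=> /hB[].
    have [F [hF eF _ _ _]] := @stem_log _ p v (principal p v) D' V B w oD' cD' regB
      oV (fun z Vz => (VE z Vz).1) Vw starV BV
      (fun l z Vz => holat_principal hp hv l (D'D (VE z Vz).1) (VE z Vz).2)
      (fun z Vz zB => sol_principal (VE z Vz).1 (VE z Vz).2 (regB z (VE z Vz).1 zB).1)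
      (fun z zB => expsol_principal (stem_unit (badz_D (Bb z zB))) (badz_one (Bb z zB))).
    by exists F.
  have nBz z : z \notin B.
    by apply/negP => /hB[_ D'z Uz]; apply: nU; exists z; split => //; apply/ltW/pos.
  have [[r [mu [W ch]]] _] := regB _ D'z0 (nBz z0); have [r0 hr] := ch.
  have [r' r'0 hr'] := open_ballP oD' D'z0.
  pose m := Num.min r r'.
  have m0 : 0 < m by rewrite lt_min r0.
  pose V := [set z | cabs (z - z0) < m].
  have VE z : V z -> D' z /\ cabs (z - z0) < r.
    by rewrite /V /= lt_min => /andP[h /hr'].
  have Vz0 : V z0 by rewrite /V /= subrr cabs0.
  have hFU l z : V z -> holat (fun z => mu z * W l z) z.
    by move=> /VE[_ /hr[h1 h2 _ _ _]]; apply: holatM; [exact: h1 | exact: h2].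
  have sFU z : V z -> z \notin B -> sol p v z (fun l => mu z * W l z).
    move=> /VE[_ zr] _; exists (r - cabs (z - z0)), mu, W; split => //.
    by apply: (chart_sub ch); rewrite ?subr_gt0 // addrC subrK.
  have [F [hF eF _ _ _]] := @stem_log _ p v (fun l z => mu z * W l z) D' V B z0 oD' cD' regB
    (@open_cball _ z0 m) (fun z Vz => (VE z Vz).1) Vz0
    (fun z t Vz ht => cball_convex Vz0 Vz ht)
    (fun z zB => False_ind _ (negP (nBz z) zB)) hFU sFU
    (fun z zB => False_ind _ (negP (nBz z) zB)).
  by exists F.
(* [D'] and its mirror image are disjoint, so the reflected function is holomorphic with no matching
   condition on the real axis. *)
pose F' l z := if 0 < im z then F l z else cj (F l (cj z)).
have DE z : D z -> D' z \/ (im z < 0 /\ D' (cj z)).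
  move=> Dz; have [iz|iz] := leP 0 (im z); [left; exact: half | right; split => //].
  by apply: half; [exact: (D_cj circ_D) | rewrite cj_def oppr_ge0 ltW].
have F'up l y : D' y -> F' l y = F l y by move=> /pos iy; rewrite /F' iy.
have F'dn l y : D' (cj y) -> F' l y = cj (F l (cj y)).
  by move=> /pos; rewrite /F' cj_def oppr_gt0 => iy; rewrite ltNge (ltW iy).
apply: (@log_of_comps F') => [l|z Dz iz]; last first.
  rewrite (_ : F'^~ z = F^~ z); first exact/eF/half.
  by apply/funext => l; apply/F'up/half.
split=> z Dz; last first.
  case: (DE _ Dz) => [D'z|[iz D'z]]; last first.
    by rewrite (F'up _ _ D'z) (F'dn _ _ D'z) cjK.
  by rewrite (F'up _ _ D'z) F'dn cjK.
case: (DE _ Dz) => [D'z|[iz D'z]].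
  apply: holat_eq (hF l z D'z); have [r r0 hr] := open_ballP oD' D'z.
  by apply/nbhsCP; exists r => // y /hr D'y; rewrite F'up.
apply: (holat_eq _ (holat_cj (hF l _ D'z))); have [r r0 hr] := open_ballP oD' D'z.
apply/nbhsCP; exists r => // y yz; rewrite F'dn //; apply: hr.
by rewrite -cjB cabs_cj.
Qed.

End Logarithm.

(** * The three domains *)

Section Domains.
Variable R : realType.
Local Notation C := (Cx R).
Local Notation H := (quat R).
Implicit Types (q I J : H) (a b t r : R) (z w y : C).

Lemma qnorm_cabs I z : isphere I -> qnorm (cpt I z) = cabs z.
Proof.
move=> hI; apply/eqP; rewrite -(@eqrXn2 _ 2) ?qnorm_ge0 ?cabs_ge0 //.
by rewrite qnorm_cpt // cabs2.
Qed.

Lemma cpt_eq I J z w : isphere I -> isphere J -> cpt I z = cpt J w -> z = w \/ z = cj w.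
Proof.
move=> hI hJ e; have e0 : re z = re w by rewrite -(cpt_coord z hI) e cpt_coord.
have : `|im z| = `|im w| by rewrite -(qnorm_sphere _ hI) -qvec_cpt // e qvec_cpt // qnorm_sphere.
move/eqP; rewrite eqr_norm2 => /orP[/eqP e1|/eqP e1]; [left | right]; apply: cxP => //;
  by rewrite cj_def.
Qed.

Definition upper_disc : set C := [set z | cabs (z - mkC 0 2) < 1].

Lemma upper_discE z : upper_disc z <-> re z ^+ 2 + (im z - 2) ^+ 2 < 1.
Proof.
rewrite /upper_disc /= -(ltr_pXn2r (n := 2)) ?nnegrE ?cabs_ge0 // expr1n cabs2.
by rewrite !(reD, imD, reN, imN) /= subr0.
Qed.

Lemma upper_disc_gt0 z : upper_disc z -> 0 < im z.
Proof.
move=> /upper_discE h; have : 0 <= re z ^+ 2 by exact: sqr_ge0.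
by move: (re z ^+ 2) (im z) h => s b; nra.
Qed.

(** [D] is the trace of Omega on each slice, and [D'] the convex set where continuation takes place:
    all of [D] for the ball and the whole space, the upper one of two conjugate discs for the
    product domain. *)
Lemma domain_data (Omega : set H) : (Omega = @qball R \/ Omega = setT \/ Omega = @qD R) ->
  exists D D' : set C, [/\ forall I z, isphere I -> Omega (cpt I z) <-> D z,
    open D /\ open D', convexC D', D' `<=` D /\ (forall z, D z -> 0 <= im z -> D' z) &
    (is_slice Omega /\ forall z, D' z -> D' (cj z)) \/
    ((forall z, D' z -> 0 < im z) /\ exists z0, D' z0)].
Proof.
have r0 : qreals (0 : H) by exists 0 => //; rewrite scale0r.
have q00 : (0 : H) = cpt (qi R) 0 by rewrite /cpt re0 im0 !scale0r addr0.
have hI := qi_sphere R.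
case=> [->|[->|->]].
- pose D : set C := [set z | cabs (z - 0) < 1].
  exists D, D; split.
  + by move=> I z hI'; rewrite /qball /D /= qnorm_cabs // subr0.
  + by split; exact: open_cball.
  + by move=> z w t Dz Dw ht; exact: cball_convex.
  + by split.
  + left; split; first by exists 0; split => //; rewrite /qball /= q00 qnorm_cabs // cabs0.
    by move=> z; rewrite /D /= !subr0 cabs_cj.
- exists setT, setT; split; [by []|by split; exact: openT|by []|by split|].
  by left; split=> //; exists 0.
- pose D : set C := [set z | upper_disc z \/ upper_disc (cj z)].
  have oU : open upper_disc by exact: open_cball.
  exists D, upper_disc; split.
  + move=> I z hI'; split=> [[J [a [b [hJ ab]]]]|].
      have E : a%:A + b *: J = cpt J (mkC a b) by [].
      rewrite E => /(cpt_eq hI' hJ)[->|->]; [left|right]; rewrite ?cjK; exact/upper_discE.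
    case=> /upper_discE h; first by exists I, (re z), (im z).
    exists (- I), (re (cj z)), (im (cj z)); split => //; first exact: sphereN.
    by rewrite -[RHS]/(cpt (- I) (cj z)) cpt_cj opprK.
  + split => //; rewrite openE => z; case=> Uz; have [r r0' hr] := open_ballP oU Uz;
      apply/nbhsCP; exists r => // y yz; [left; exact: hr | right; apply: hr].
    by rewrite -cjB cabs_cj.
  + by move=> z w t Dz Dw ht; exact: cball_convex.
  + split=> [z Uz|z [//|/upper_disc_gt0]]; first by left.
    by rewrite cj_def oppr_gt0 ltNge => /negPf ->.
  + by right; split; [exact: upper_disc_gt0 | exists (mkC 0 2); rewrite /upper_disc /= subrr cabs0].
Qed.

End Domains.

Theorem theorem1p6 (R : realType) (Omega : set (quat R))
    (g : quat R -> quat R) (U : set (quat R)) :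
  (Omega = @qball R \/ Omega = setT \/ Omega = @qD R) ->
  slice_regular Omega g ->
  (forall q, Omega q -> symm Omega g q = 1) ->
  finite_set [set q | nonreal_isolated_zero Omega (vector_part Omega g) q] ->
  (forall q, nonreal_isolated_zero Omega (vector_part Omega g) q ->
     real_part Omega g q = 1) ->
  is_component (Omega `\` preimage_real_le Omega (real_part Omega g) (-1)) U ->
  \bigcup_(q in [set q | nonreal_isolated_zero Omega (vector_part Omega g) q])
     sphere_at q `<=` U ->
  (exists2 I, isphere I & convex_set (U `&` slice_half_plane I)) ->
  (is_slice Omega -> is_slice U) ->
  exists2 f, slice_regular Omega f & is_star_exp Omega f g.
Proof.
move=> /domain_data[D [D' [circ_D [oD oD'] cD' [D'D half] dich]]].
move=> /(slice_regularP circ_D oD)[p [v gc]] symm1 fin real1 compU sphU [I hI cU] slU.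
have [nz|z0] := pselect (exists2 z, D' z & cdot (v^~ z) (v^~ z) != 0); last first.
  apply: (isotropic_log circ_D oD gc symm1 compU oD' cD' D'D half) => z D'z.
  by apply/eqP/negPn/negP => n0; apply: z0; exists z.
have reg := regular_chart circ_D oD gc symm1 oD' cD' D'D nz.
case: dich => [[/slU[x [Ux [a _ aE]]] D'cj]|[pos [z D'z]]].
  have Ua : U a%:A by rewrite aE.
  exact: (slice_log circ_D oD gc symm1 fin real1 compU sphU hI cU oD' cD' D'D half reg D'cj Ua).
exact: (upper_log circ_D oD gc symm1 fin real1 compU sphU hI cU oD' cD' D'D half reg pos D'z).
Qed.
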